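(* Let $p\in(0,1)$ and let $f\in Co(p)$, with Laurent expansion $f(z)=\sum_{n=-1}^{\infty}a_n(f)(z-p)^n$ for $0<|z-p|<1-p$. Then $$\operatorname{Re} a_0(f)\ \geq\ -\frac{p}{(1-p^2)^2}.$$ Equality is attained in this inequality if and only if $$f(z)=\frac{z}{\left(1-\frac{z}{p}\right)(1-zp)},\qquad z\in\mathbb{D}.$$
   Context: $\mathbb{D}=\{z\in\mathbb{C}:|z|<1\}$ is the open unit disc and $\overline{\mathbb{C}}$ is the Riemann sphere. For $p\in(0,1)$, $Co(p)$ denotes the family of functions $f:\mathbb{D}\to\overline{\mathbb{C}}$ such that: (i) $f$ is meromorphic in $\mathbb{D}$ and has a simple pole at the point $p$; (ii) $f(0)=f'(0)-1=0$; (iii) $f$ maps $\mathbb{D}$ conformally (in particular injectively) onto a set whose complement with respect to $\overline{\mathbb{C}}$ is convex. For $f\in Co(p)$, the numbers $a_n(f)$, $n\geq -1$, are the Laurent coefficients of $f$ at the point $p$. *)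

(* Defs.v *)
From Stdlib Require Import Reals ZArith.
From Coquelicot Require Import Coquelicot.

Open Scope R_scope.
Open Scope C_scope.

(* The Riemann sphere: [Some w] is the finite point w, [None] is infinity. *)
Definition Csphere : Type := option C.

Definition unit_disc (z : C) : Prop := (Cmod z < 1)%R.

(* [ex_derive] and [is_derive] at type [C -> C] are complex differentiability
   and the complex derivative. *)
Definition holomorphic_at (f : C -> Csphere) (z0 : C) : Prop :=
  exists g : C -> C, locally z0 (fun z => f z = Some (g z) /\ ex_derive g z).

Definition sphere_is_derive (f : C -> Csphere) (z0 l : C) : Prop :=
  exists g : C -> C, locally z0 (fun z => f z = Some (g z)) /\ is_derive g z0 l.

Definition pole_at (f : C -> Csphere) (z0 : C) (m : nat) : Prop :=
  (1 <= m)%nat /\ f z0 = None /\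
  exists g : C -> C,
    g z0 <> 0 /\
    locally z0 (fun z =>
      ex_derive g z /\ (z <> z0 -> f z = Some (g z / (z - z0) ^ m))).

Definition simple_pole_at (f : C -> Csphere) (z0 : C) : Prop := pole_at f z0 1.

Definition meromorphic_on (D : C -> Prop) (f : C -> Csphere) : Prop :=
  forall z, D z -> holomorphic_at f z \/ exists m, pole_at f z m.

Definition injective_on (D : C -> Prop) (f : C -> Csphere) : Prop :=
  forall z w, D z -> D w -> f z = f w -> z = w.

Definition image (D : C -> Prop) (f : C -> Csphere) (w : Csphere) : Prop :=
  exists z, D z /\ f z = w.

Definition complement (S : Csphere -> Prop) (w : Csphere) : Prop := ~ S w.

(* A subset of the sphere is convex when it lies in the finite plane and is
   convex there. *)
Definition sphere_convex (S : Csphere -> Prop) : Prop :=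
  ~ S None /\
  forall (u v : C) (t : R), (0 <= t <= 1)%R ->
    S (Some u) -> S (Some v) -> S (Some (t * u + (1 - t) * v)).

(* Members of Co(p) are functions on the disc; they are encoded as total
   functions of which only the values on the disc are constrained. A
   meromorphic map is conformal onto its image when it is injective. *)
Record Co (p : R) (f : C -> Csphere) : Prop := {
  Co_meromorphic : meromorphic_on unit_disc f;
  Co_pole : simple_pole_at f p;
  Co_zero : f 0 = Some (RtoC 0);
  Co_derive : sphere_is_derive f 0 1;
  Co_injective : injective_on unit_disc f;
  Co_convex : sphere_convex (complement (image unit_disc f))
}.

(* f(z) = sum_(n >= -1) a_n (z - z0)^n for 0 < |z - z0| < r; the entries a_n
   with n < -1 are unused. *)
Definition laurent_expansion (f : C -> Csphere) (z0 : C) (r : R) (a : Z -> C)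
    : Prop :=
  forall z, (0 < Cmod (z - z0) < r)%R ->
    exists s : C,
      is_pseries (fun n : nat => a (Z.of_nat n)) (z - z0) s /\
      f z = Some (a (-1)%Z / (z - z0) + s).

(* Quotient with values in the sphere; only meant for u and v not both 0. *)
Definition sphere_div (u v : C) : Csphere :=
  if Ceq_dec v 0 then None else Some (u / v).

(* Main.v *)
Require Import Defs.
From Stdlib Require Import Reals ZArith.
From Coquelicot Require Import Coquelicot.
From Stdlib Require Import Lra Lia Classical ClassicalEpsilon.

(** Move the pole to the origin: with [x = (z - p) / (1 - p z)] the function
    becomes [h x = c / x + b + k x], with [k] holomorphic on the unit disc and
    [k 0 = 0]. In these terms [a_0 = b - p c]. The normalisation [f 0 = 0],
    [f' 0 = 1] is read at [x = - p]; it gives [p b = c - p (k (- p))] and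
    [c = p^2 k' (- p) - p^2 / (1 - p^2)].

    Everything then follows from one sharp estimate for concave functions,
    [|k'| <= |c|] ([regular_part_derive_le]). It implies [|k (- p)| <= p |c|],
    so that [p |a_0| <= (1 - p^2) |c| + p^2 |c| = |c|], and
    [|c| <= p^2 |c| + p^2 / (1 - p^2)], which together give
    [|a_0| <= p / (1 - p^2)^2]. If [Re a_0] is minimal, all these are
    equalities, hence [k' (- p) = c]; by the strong maximum principle [k' = c]
    throughout, [k x = c x], and [f] is determined.

    The estimate is proved in three steps. Let [K] be the convex set omitted by
    [h] and [N = - x^2 h']. For [w] in [K] the function [F = 1 / (h - w)] is
    injective and, because [K] is convex, has a starlike image; the Schwarz lemma
    applied to the maps [x |-> F^-1 (t F x)] yields [Re ((h x - w) x / N x) >= 0]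
    ([omitted_value_starlike]). Next, [h (l x)] approaches [K] when [|l x|] tends
    to 1, so the maximum principle in [x] replaces [w] by [h (l x)] for
    [|l| >= 1] ([level_convex]): the level curves of [h] are convex. Finally, on
    the circle [|l| = 1] this quotient is divided by [|1 - l|^2], a boundary value
    of the holomorphic [- (1 - l)^2 / l]; after subtraction of the pole at [l = 1]
    the mean value property gives [Re (c / N) >= 1 / 2]
    ([scaled_derivative_near_residue]). That is [|c - N| <= |c|], and
    [c - N = x^2 k'], so the maximum principle removes the factor [x^2].

    The function theory used is derived from complex differentiability alone.
    Goursat's bisection on polar rectangles shows that the mean over a circle
    does not depend on the radius ([circle_integral_const]). The mean value
    property, Cauchy's formula, differentiability of the derivative, removable
    singularities, the maximum principle, the Schwarz lemma and the
    holomorphy of the inverse of an injective function follow from this. *)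

Local Open Scope C_scope.

(** * Differentiability in the complex plane *)

Lemma locally_Cmod (z : C) (P : C -> Prop) :
  locally z P <->
  exists d : R, (0 < d)%R /\ forall y : C, (Cmod (y - z) < d)%R -> P y.
Proof.
  rewrite locally_C; split.
  - intros [d Hd]; exists d; split; [apply cond_pos | intros y Hy; apply Hd, Hy].
  - intros [d [Hd H]]; exists (mkposreal d Hd); intros y Hy; apply H, Hy.
Qed.

Lemma continuous_Cmod (f : C -> C) (z : C) :
  continuous f z <->
  forall e : R, (0 < e)%R -> exists d : R, (0 < d)%R /\
    forall y : C, (Cmod (y - z) < d)%R -> (Cmod (f y - f z) < e)%R.
Proof.
  split.
  - intros H e He.
    apply (locally_Cmod z (fun y => (Cmod (f y - f z) < e)%R)).
    apply (H (fun w => (Cmod (w - f z) < e)%R)).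
    apply locally_Cmod; exists e; split; auto.
  - intros H P HP.
    apply locally_Cmod in HP; destruct HP as [e [He HP]].
    destruct (H e He) as [d [Hd Hy]].
    apply locally_Cmod; exists d; split; auto.
Qed.

Lemma is_derive_Cmod (f : C -> C) (z l : C) :
  is_derive f z l <->
  forall e : R, (0 < e)%R -> exists d : R, (0 < d)%R /\
    forall y : C, (Cmod (y - z) < d)%R ->
      (Cmod (f y - f z - l * (y - z)) <= e * Cmod (y - z))%R.
Proof.
  split.
  - intros [_ H] e He.
    specialize (H z (fun P HP => HP) (mkposreal e He)).
    destruct H as [d Hd]; exists d; split; [apply cond_pos|].
    intros y Hy; specialize (Hd y Hy).
    change (norm (minus (minus (f y) (f z)) (scal (minus y z) l)))
      with (Cmod ((f y - f z) - (y - z) * l)) in Hd.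
    replace (f y - f z - l * (y - z)) with (f y - f z - (y - z) * l) by ring.
    exact Hd.
  - intros H; split; [apply is_linear_scal_l|].
    intros x Hx.
    pose proof (@is_filter_lim_locally_unique C_AbsRing (AbsRing_NormedModule C_AbsRing) z x Hx) as E.
    change (z = x) in E; subst x.
    intros e; destruct (H e (cond_pos e)) as [d [Hd Hy]].
    exists (mkposreal d Hd); intros y Hyz; specialize (Hy y Hyz).
    replace (f y - f z - l * (y - z)) with (f y - f z - (y - z) * l) in Hy by ring.
    exact Hy.
Qed.

Lemma Cmod_tri3 (a b c : C) : (Cmod (a - c) <= Cmod (a - b) + Cmod (b - c))%R.
Proof.
  replace (a - c) with ((a - b) + (b - c)) by ring; apply Cmod_triangle.
Qed.

Lemma Cmod_minus_sym (a b : C) : Cmod (a - b) = Cmod (b - a).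
Proof. replace (a - b) with (- (b - a)) by ring; apply Cmod_opp. Qed.

Lemma Cmod_tri_inv (a b : C) : (Cmod a - Cmod b <= Cmod (a - b))%R.
Proof.
  pose proof (Cmod_triangle (a - b) b) as H.
  replace (a - b + b) with a in H by ring; lra.
Qed.

Lemma Cmod_minus_le (a b : C) : (Cmod (a - b) <= Cmod a + Cmod b)%R.
Proof. rewrite <- (Cmod_opp b); apply Cmod_triangle. Qed.

(** With the derivative seen as a slope function continuous at the base point,
    the product and chain rules are algebraic identities between slopes. *)
Lemma is_derive_slope (f : C -> C) (z l : C) :
  is_derive f z l <->
  exists q : C -> C, continuous q z /\ q z = l /\
    forall y, f y = f z + q y * (y - z).
Proof.
  rewrite is_derive_Cmod; split.
  - intros H.
    exists (fun y => if Ceq_dec y z then l else (f y - f z) / (y - z)).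
    split; [|split].
    + apply continuous_Cmod; intros e He.
      destruct (H (e / 2)%R) as [d [Hd Hy]]; [lra|].
      exists d; split; auto; intros y Hyz.
      destruct (Ceq_dec z z) as [_|n]; [|now contradiction n].
      destruct (Ceq_dec y z) as [E|n].
      * replace (l - l) with (RtoC 0) by ring; rewrite Cmod_0; lra.
      * assert (n' : y - z <> 0).
        { intros E; apply n; replace y with (y - z + z) by ring; rewrite E; ring. }
        replace ((f y - f z) / (y - z) - l)
          with ((f y - f z - l * (y - z)) / (y - z)) by (field; auto).
        rewrite Cmod_div by auto.
        apply Cmod_gt_0 in n'.
        apply Rle_lt_trans with (e / 2)%R; [|lra].
        apply Rle_div_l; auto.
    + destruct (Ceq_dec z z) as [_|n]; [reflexivity | now contradiction n].
    + intros y; destruct (Ceq_dec y z) as [E|n].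
      * subst y; ring.
      * field; intros E; apply n; replace y with (y - z + z) by ring; rewrite E; ring.
  - intros [q [Hq [E H]]] e He.
    rewrite continuous_Cmod in Hq; destruct (Hq e He) as [d [Hd Hy]].
    exists d; split; auto; intros y Hyz.
    rewrite (H y), <- E.
    replace (f z + q y * (y - z) - f z - q z * (y - z))
      with ((q y - q z) * (y - z)) by ring.
    rewrite Cmod_mult; apply Rmult_le_compat_r; [apply Cmod_ge_0|].
    left; auto.
Qed.

Lemma continuous_Cplus (f g : C -> C) (z : C) :
  continuous f z -> continuous g z -> continuous (fun y => f y + g y) z.
Proof. intros Hf Hg; exact (continuous_plus (V := C_NormedModule) f g z Hf Hg). Qed.

Lemma continuous_Cminus (f g : C -> C) (z : C) :
  continuous f z -> continuous g z -> continuous (fun y => f y - g y) z.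
Proof. intros Hf Hg; exact (continuous_minus (V := C_NormedModule) f g z Hf Hg). Qed.

Lemma continuous_Cmult (f g : C -> C) (z : C) :
  continuous f z -> continuous g z -> continuous (fun y => f y * g y) z.
Proof.
  rewrite !continuous_Cmod; intros Hf Hg e He.
  set (M := (1 + Cmod (f z) + Cmod (g z))%R).
  assert (HM : (1 <= M)%R).
  { unfold M; pose proof (Cmod_ge_0 (f z)); pose proof (Cmod_ge_0 (g z)); lra. }
  assert (He' : (0 < Rmin 1 (e / (2 * M)))%R).
  { apply Rmin_pos; [lra|]; apply Rdiv_lt_0_compat; lra. }
  destruct (Hf _ He') as [d1 [Hd1 H1]]; destruct (Hg _ He') as [d2 [Hd2 H2]].
  exists (Rmin d1 d2); split; [now apply Rmin_pos|]; intros y Hy.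
  assert (Hy1 : (Cmod (y - z) < d1)%R) by (eapply Rlt_le_trans; [apply Hy | apply Rmin_l]).
  assert (Hy2 : (Cmod (y - z) < d2)%R) by (eapply Rlt_le_trans; [apply Hy | apply Rmin_r]).
  specialize (H1 y Hy1); specialize (H2 y Hy2).
  pose proof (Rmin_l 1 (e / (2 * M))) as E1; pose proof (Rmin_r 1 (e / (2 * M))) as E2.
  set (k := Rmin 1 (e / (2 * M))) in *.
  replace (f y * g y - f z * g z)
    with ((f y - f z) * (g y - g z) + f z * (g y - g z) + (f y - f z) * g z) by ring.
  eapply Rle_lt_trans; [apply Cmod_triangle|].
  eapply Rle_lt_trans; [apply Rplus_le_compat_r, Cmod_triangle|].
  rewrite !Cmod_mult.
  assert (Hk : (k * M <= e / 2)%R).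
  { apply Rle_trans with (e / (2 * M) * M)%R; [apply Rmult_le_compat_r; lra|].
    right; field; lra. }
  unfold M in Hk.
  pose proof (Cmod_ge_0 (f z)); pose proof (Cmod_ge_0 (g z)).
  pose proof (Cmod_ge_0 (f y - f z)); pose proof (Cmod_ge_0 (g y - g z)).
  nra.
Qed.

Lemma continuous_Cinv (f : C -> C) (z : C) :
  continuous f z -> f z <> 0 -> continuous (fun y => / f y) z.
Proof.
  rewrite !continuous_Cmod; intros Hf Hz e He.
  pose proof (proj1 (Cmod_gt_0 _) Hz) as Hm.
  set (m := Cmod (f z)) in *.
  destruct (Hf (Rmin (m / 2) (e * m * m / 2))%R) as [d [Hd H]].
  { apply Rmin_pos; [lra|]; assert (0 < e * m * m)%R by (repeat apply Rmult_lt_0_compat; lra); lra. }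
  exists d; split; auto; intros y Hy; specialize (H y Hy).
  pose proof (Rmin_l (m / 2) (e * m * m / 2)) as E1; pose proof (Rmin_r (m / 2) (e * m * m / 2)) as E2.
  assert (Hfy : (m / 2 < Cmod (f y))%R).
  { pose proof (Cmod_tri_inv (f z) (f y)) as T; rewrite Cmod_minus_sym in T; fold m in T; lra. }
  assert (Hy0 : f y <> 0) by (apply Cmod_gt_0; lra).
  replace (/ f y - / f z) with (- (f y - f z) / (f y * f z)) by (field; auto).
  rewrite Cmod_div, Cmod_opp, Cmod_mult by (apply Cmult_neq_0; auto); fold m.
  apply Rlt_div_l; [nra|].
  assert (0 < e * m)%R by nra.
  nra.
Qed.

Lemma ex_derive_Ccontinuous (f : C -> C) (z : C) : ex_derive f z -> continuous f z.
Proof.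
  intros [l H]; apply is_derive_slope in H; destruct H as [q [Hq [E H]]].
  apply continuous_ext with (fun y => f z + q y * (y - z)); [intros; now rewrite <- H|].
  apply continuous_Cplus; [apply continuous_const|].
  apply continuous_Cmult; [exact Hq|].
  apply continuous_Cminus; [apply continuous_id | apply continuous_const].
Qed.

Lemma is_derive_Cconst (c z : C) : is_derive (fun _ : C => c) z (RtoC 0).
Proof.
  apply is_derive_slope; exists (fun _ => RtoC 0); split; [apply continuous_const|].
  split; [reflexivity | intros; ring].
Qed.

Lemma is_derive_Cid (z : C) : is_derive (fun y : C => y) z (RtoC 1).
Proof.
  apply is_derive_slope; exists (fun _ => RtoC 1); split; [apply continuous_const|].
  split; [reflexivity | intros; ring].
Qed.

Lemma is_derive_Cplus (f g : C -> C) (z lf lg : C) :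
  is_derive f z lf -> is_derive g z lg -> is_derive (fun y => f y + g y) z (lf + lg).
Proof. intros Hf Hg; exact (is_derive_plus f g z lf lg Hf Hg). Qed.

Lemma is_derive_Cminus (f g : C -> C) (z lf lg : C) :
  is_derive f z lf -> is_derive g z lg -> is_derive (fun y => f y - g y) z (lf - lg).
Proof. intros Hf Hg; exact (is_derive_minus f g z lf lg Hf Hg). Qed.

Lemma is_derive_Cmult (f g : C -> C) (z lf lg : C) :
  is_derive f z lf -> is_derive g z lg ->
  is_derive (fun y => f y * g y) z (lf * g z + f z * lg).
Proof.
  intros Hf Hg; pose proof (ex_derive_Ccontinuous g z (ex_intro _ _ Hg)) as Cg.
  apply is_derive_slope in Hf; apply is_derive_slope in Hg; apply is_derive_slope.
  destruct Hf as [p [Hp [Ep Hf]]]; destruct Hg as [q [Hq [Eq Hg]]].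
  exists (fun y => p y * g y + f z * q y); split; [|split].
  - apply continuous_Cplus; apply continuous_Cmult; auto; apply continuous_const.
  - now rewrite Ep, Eq.
  - intros y; rewrite (Hf y), (Hg y); ring.
Qed.

Lemma is_derive_Cinv (f : C -> C) (z l : C) :
  is_derive f z l -> f z <> 0 -> is_derive (fun y => / f y) z (- l / (f z * f z)).
Proof.
  intros Hf Hz; pose proof (ex_derive_Ccontinuous f z (ex_intro _ _ Hf)) as Cf.
  pose proof (continuous_Cinv f z Cf Hz) as Ci.
  apply is_derive_Cmod; intros e He.
  apply is_derive_slope in Hf; destruct Hf as [q [Hq [E Hf]]].
  (* [k] is the slope of [1 / f] where [f] does not vanish, hence near [z] *)
  set (k := fun y => (0 - q y) * (/ f y * / f z)).
  assert (Ck : continuous k z).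
  { apply continuous_Cmult.
    - apply continuous_Cminus; [apply continuous_const | exact Hq].
    - apply continuous_Cmult; [exact Ci | apply continuous_const]. }
  rewrite continuous_Cmod in Ck, Cf.
  destruct (Ck e He) as [d1 [Hd1 H1]].
  destruct (Cf (Cmod (f z))) as [d2 [Hd2 H2]]; [now apply Cmod_gt_0|].
  exists (Rmin d1 d2); split; [now apply Rmin_pos|]; intros y Hy.
  assert (Hy1 : (Cmod (y - z) < d1)%R) by (eapply Rlt_le_trans; [apply Hy | apply Rmin_l]).
  assert (Hy2 : (Cmod (y - z) < d2)%R) by (eapply Rlt_le_trans; [apply Hy | apply Rmin_r]).
  assert (Hy0 : f y <> 0).
  { intros E0; specialize (H2 y Hy2); rewrite E0 in H2.
    replace (0 - f z) with (- f z) in H2 by ring; rewrite Cmod_opp in H2; lra. }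
  replace (/ f y - / f z - - l / (f z * f z) * (y - z)) with ((k y - k z) * (y - z)).
  - rewrite Cmod_mult; apply Rmult_le_compat_r; [apply Cmod_ge_0|].
    left; auto.
  - unfold k; rewrite E.
    replace (/ f y - / f z) with (- (f y - f z) * / f y * / f z) by (field; auto).
    replace (f y - f z) with (q y * (y - z)) by (rewrite (Hf y); ring).
    field; auto.
Qed.

Lemma is_derive_Ccomp (f g : C -> C) (z lf lg : C) :
  is_derive f (g z) lf -> is_derive g z lg ->
  is_derive (fun y => f (g y)) z (lf * lg).
Proof.
  intros Hf Hg; pose proof (ex_derive_Ccontinuous g z (ex_intro _ _ Hg)) as Cg.
  apply is_derive_slope in Hf; apply is_derive_slope in Hg; apply is_derive_slope.
  destruct Hf as [p [Hp [Ep Hf]]]; destruct Hg as [q [Hq [Eq Hg]]].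
  exists (fun y => p (g y) * q y); split; [|split].
  - apply continuous_Cmult; auto; now apply continuous_comp.
  - now rewrite Ep, Eq.
  - intros y; rewrite (Hf (g y)).
    replace (g y - g z) with (q y * (y - z)) by (rewrite (Hg y); ring); ring.
Qed.

Lemma is_derive_C_unique (f : C -> C) (z l1 l2 : C) :
  is_derive f z l1 -> is_derive f z l2 -> l1 = l2.
Proof.
  intros H1 H2; now rewrite <- (is_C_derive_unique f z l1 H1), <- (is_C_derive_unique f z l2 H2).
Qed.

Lemma is_derive_C_derive (f : C -> C) (z : C) :
  ex_derive f z -> is_derive f z (C_derive f z).
Proof. exact (C_derive_correct f z 0). Qed.

Lemma ex_derive_Cplus (f g : C -> C) (z : C) :
  ex_derive f z -> ex_derive g z -> ex_derive (fun y => f y + g y) z.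
Proof. intros [a Ha] [b Hb]; eexists; eapply is_derive_Cplus; eauto. Qed.

Lemma ex_derive_Cminus (f g : C -> C) (z : C) :
  ex_derive f z -> ex_derive g z -> ex_derive (fun y => f y - g y) z.
Proof. intros [a Ha] [b Hb]; eexists; eapply is_derive_Cminus; eauto. Qed.

Lemma ex_derive_Cmult (f g : C -> C) (z : C) :
  ex_derive f z -> ex_derive g z -> ex_derive (fun y => f y * g y) z.
Proof. intros [a Ha] [b Hb]; eexists; eapply is_derive_Cmult; eauto. Qed.

Lemma ex_derive_Cinv (f : C -> C) (z : C) :
  ex_derive f z -> f z <> 0 -> ex_derive (fun y => / f y) z.
Proof. intros [a Ha] Hz; eexists; eapply is_derive_Cinv; eauto. Qed.

Lemma ex_derive_Cdiv (f g : C -> C) (z : C) :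
  ex_derive f z -> ex_derive g z -> g z <> 0 -> ex_derive (fun y => f y / g y) z.
Proof.
  intros Hf [b Hb] Hz; apply ex_derive_Cmult; auto.
  eexists; eapply is_derive_Cinv; eauto.
Qed.

Lemma ex_derive_Ccomp (f g : C -> C) (z : C) :
  ex_derive f (g z) -> ex_derive g z -> ex_derive (fun y => f (g y)) z.
Proof. intros [a Ha] [b Hb]; eexists; eapply is_derive_Ccomp; eauto. Qed.

Lemma ex_derive_Cconst (c z : C) : ex_derive (fun _ : C => c) z.
Proof. eexists; apply is_derive_Cconst. Qed.

Lemma ex_derive_Cid (z : C) : ex_derive (fun y : C => y) z.
Proof. eexists; apply is_derive_Cid. Qed.

(** The rules are selected by matching on the head operation: unifying them
    with the goal would unfold complex arithmetic into pairs of reals. *)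
Ltac cderive :=
  repeat (try assumption; lazymatch goal with
  | |- ex_derive (fun y => Cplus (@?f y) (@?g y)) _ => apply (ex_derive_Cplus f g)
  | |- ex_derive (fun y => Cminus (@?f y) (@?g y)) _ => apply (ex_derive_Cminus f g)
  | |- ex_derive (fun y => Cmult (@?f y) (@?g y)) _ => apply (ex_derive_Cmult f g)
  | |- ex_derive (fun y => Cdiv (@?f y) (@?g y)) _ => apply (ex_derive_Cdiv f g)
  | |- ex_derive (fun y => Cinv (@?f y)) _ => apply (ex_derive_Cinv f)
  | |- ex_derive (fun y => y) _ => apply ex_derive_Cid
  | |- ex_derive (fun _ => ?c) _ => apply (ex_derive_Cconst c)
  end).

Lemma is_derive_C_ext_loc (f g : C -> C) (z l : C) (d : R) :
  (0 < d)%R -> (forall y, (Cmod (y - z) < d)%R -> f y = g y) ->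
  is_derive f z l -> is_derive g z l.
Proof.
  intros Hd H Hf.
  rewrite is_derive_Cmod in Hf |- *; intros e He.
  destruct (Hf e He) as [d' [Hd' H']].
  exists (Rmin d d'); split; [now apply Rmin_pos|]; intros y Hy.
  rewrite <- (H y), <- (H z).
  - apply H'; eapply Rlt_le_trans; [apply Hy | apply Rmin_r].
  - replace (z - z) with (RtoC 0) by ring; now rewrite Cmod_0.
  - eapply Rlt_le_trans; [apply Hy | apply Rmin_l].
Qed.

Lemma ex_derive_C_ext_loc (f g : C -> C) (z : C) (d : R) :
  (0 < d)%R -> (forall y, (Cmod (y - z) < d)%R -> f y = g y) ->
  ex_derive f z -> ex_derive g z.
Proof. intros Hd H [l Hl]; exists l; eapply is_derive_C_ext_loc; eauto. Qed.

(** * Circle means of holomorphic functions *)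

Lemma nested_intervals (u h : nat -> R) :
  (forall n, 0 <= h n)%R ->
  (forall n, u n <= u (S n) /\ u (S n) + h (S n) <= u n + h n)%R ->
  exists l : R, forall n, (u n <= l <= u n + h n)%R.
Proof.
  intros Hh Hu.
  assert (Hle : forall m n, (u m <= u n + h n)%R).
  { assert (Hup : forall n k, (u n <= u (n + k)%nat)%R).
    { intros n k; induction k as [|k IH]; [rewrite Nat.add_0_r; lra|].
      rewrite Nat.add_succ_r; destruct (Hu (n + k)%nat); lra. }
    assert (Hdn : forall n k, (u (n + k)%nat + h (n + k)%nat <= u n + h n)%R).
    { intros n k; induction k as [|k IH]; [rewrite Nat.add_0_r; lra|].
      rewrite Nat.add_succ_r; destruct (Hu (n + k)%nat); lra. }
    intros m n; destruct (Nat.le_ge_cases m n) as [L|L].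
    - replace n with (m + (n - m))%nat by lia.
      pose proof (Hup m (n - m)%nat); pose proof (Hh (m + (n - m))%nat); lra.
    - replace m with (n + (m - n))%nat by lia.
      pose proof (Hdn n (m - n)%nat); pose proof (Hh (n + (m - n))%nat); lra. }
  destruct (completeness (fun x => exists m, x = u m)) as [l [Hub Hlub]].
  - exists (u 0%nat + h 0%nat)%R; intros x [m ->]; apply Hle.
  - exists (u 0%nat), 0%nat; reflexivity.
  - exists l; intros n; split.
    + apply Hub; exists n; reflexivity.
    + apply Hlub; intros x [m ->]; apply Hle.
Qed.

(** Goursat's bisection, isolated from integrals: the local hypothesis is only
    required of squares that contain the given point, which is what a
    derivative at that point can control. *)
Lemma square_bisection (P : R -> R -> R -> Prop) (x y h : R) :
  (0 < h)%R ->
  (forall x y h, 0 < h -> P x y (h / 2) -> P (x + h / 2) y (h / 2) ->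
     P x (y + h / 2) (h / 2) -> P (x + h / 2) (y + h / 2) (h / 2) -> P x y h)%R ->
  (forall u v, x <= u <= x + h -> y <= v <= y + h ->
     exists d, 0 < d /\ forall x' y' h', 0 < h' < d ->
       x' <= u <= x' + h' -> y' <= v <= y' + h' -> P x' y' h')%R ->
  P x y h.
Proof.
  intros Hh Hsplit Hloc; apply NNPP; intros HP.
  set (next := fun (k : R) (q : R * R) =>
    let (a, b) := q in
    if excluded_middle_informative (P a b (k / 2)%R) then
      if excluded_middle_informative (P (a + k / 2) b (k / 2))%R then
        if excluded_middle_informative (P a (b + k / 2) (k / 2))%R
        then (a + k / 2, b + k / 2)%R else (a, b + k / 2)%R
      else (a + k / 2, b)%R
    else (a, b)).
  set (k := fun n : nat => (h * (/ 2) ^ n)%R).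
  set (sq := fix sq (n : nat) : R * R :=
    match n with O => (x, y) | S m => next (k m) (sq m) end).
  assert (Hk : forall n, (0 < k n)%R).
  { intros n; apply Rmult_lt_0_compat; auto; apply pow_lt; lra. }
  assert (HkS : forall n, k (S n) = (k n / 2)%R).
  { intros n; unfold k; simpl; field. }
  assert (Hnot : forall n, ~ P (fst (sq n)) (snd (sq n)) (k n)).
  { induction n as [|n IH].
    - simpl; unfold k; simpl; rewrite Rmult_1_r; exact HP.
    - rewrite HkS; simpl; destruct (sq n) as [a b]; simpl in IH |- *.
      repeat destruct excluded_middle_informative; simpl; auto. }
  assert (Hstep : forall n,
    (fst (sq n) <= fst (sq (S n)) <= fst (sq n) + k n / 2 /\
     snd (sq n) <= snd (sq (S n)) <= snd (sq n) + k n / 2)%R).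
  { intros n; specialize (Hk n); simpl; destruct (sq n) as [a b]; simpl.
    repeat destruct excluded_middle_informative; simpl; lra. }
  destruct (nested_intervals (fun n => fst (sq n)) k) as [u Hu].
  { intros n; specialize (Hk n); lra. }
  { intros n; rewrite HkS; specialize (Hstep n); lra. }
  destruct (nested_intervals (fun n => snd (sq n)) k) as [v Hv].
  { intros n; specialize (Hk n); lra. }
  { intros n; rewrite HkS; specialize (Hstep n); lra. }
  destruct (Hloc u v) as [d [Hd H]].
  { specialize (Hu 0%nat); simpl in Hu; unfold k in Hu; simpl in Hu; lra. }
  { specialize (Hv 0%nat); simpl in Hv; unfold k in Hv; simpl in Hv; lra. }
  destruct (pow_lt_1_zero (/ 2) ) with (y := (d / h)%R) as [n Hn].
  { rewrite Rabs_pos_eq; lra. }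
  { apply Rdiv_lt_0_compat; auto. }
  specialize (Hn n (le_n n)).
  rewrite Rabs_pos_eq in Hn by (apply pow_le; lra).
  apply Rlt_div_r in Hn; auto.
  apply (Hnot n), H; auto.
  split; auto; unfold k; lra.
Qed.

Definition polar (s t : R) : C := (s * cos t, s * sin t)%R.

Lemma Cmod_polar (s t : R) : (0 <= s)%R -> Cmod (polar s t) = s.
Proof.
  intros Hs; unfold Cmod, polar; simpl.
  replace (_ + _)%R with (s * s)%R.
  - apply sqrt_square; auto.
  - pose proof (sin2_cos2 t) as E; unfold Rsqr in E.
    transitivity (s * s * (sin t * sin t + cos t * cos t))%R; [rewrite E|]; ring.
Qed.

Lemma Cmod_le_abs (x y : R) : (Cmod (x, y) <= Rabs x + Rabs y)%R.
Proof.
  replace ((x, y) : C) with (RtoC x + Ci * RtoC y).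
  - eapply Rle_trans; [apply Cmod_triangle|].
    rewrite Cmod_mult, Cmod_Ci, !Cmod_R; lra.
  - unfold Cplus, Cmult, Ci, RtoC; simpl; f_equal; ring.
Qed.

Lemma Re_le_Cmod (z : C) : (Re z <= Cmod z)%R.
Proof. eapply Rle_trans; [apply Rle_abs | apply re_le_Cmod]. Qed.

Lemma Rabs_Im_le_Cmod (z : C) : (Rabs (Im z) <= Cmod z)%R.
Proof. eapply Rle_trans; [|apply Rmax_Cmod]; apply Rmax_r. Qed.

Lemma Rabs_sub_sin (a b : R) : (Rabs (sin a - sin b) <= Rabs (a - b))%R.
Proof.
  destruct (MVT_gen sin b a cos) as [c [_ E]].
  - intros; apply is_derive_sin.
  - intros; apply continuity_sin.
  - rewrite E, Rabs_mult; pose proof (COS_bound c).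
    rewrite <- (Rmult_1_l (Rabs (a - b))) at 2.
    apply Rmult_le_compat_r; [apply Rabs_pos | apply Rabs_le; lra].
Qed.

Lemma Rabs_sub_cos (a b : R) : (Rabs (cos a - cos b) <= Rabs (a - b))%R.
Proof.
  rewrite !cos_sin; eapply Rle_trans; [apply Rabs_sub_sin|].
  right; f_equal; ring.
Qed.

Lemma polar_lipschitz (s s' t t' : R) :
  (Cmod (polar s t - polar s' t') <= 2 * Rabs (s - s') + 2 * Rabs s' * Rabs (t - t'))%R.
Proof.
  replace (polar s t - polar s' t')
    with (((s - s') * cos t + s' * (cos t - cos t'),
           (s - s') * sin t + s' * (sin t - sin t'))%R : C).
  2: { unfold polar, Cminus, Cplus, Copp; simpl; f_equal; ring. }
  eapply Rle_trans; [apply Cmod_le_abs|].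
  pose proof (Rabs_triang ((s - s') * cos t) (s' * (cos t - cos t'))) as T1.
  pose proof (Rabs_triang ((s - s') * sin t) (s' * (sin t - sin t'))) as T2.
  rewrite !Rabs_mult in T1, T2.
  pose proof (Rabs_sub_cos t t'); pose proof (Rabs_sub_sin t t').
  assert (Rabs (cos t) <= 1)%R by (apply Rabs_le, COS_bound).
  assert (Rabs (sin t) <= 1)%R by (apply Rabs_le, SIN_bound).
  pose proof (Rabs_pos (s - s')); pose proof (Rabs_pos s').
  nra.
Qed.

Lemma lipschitz_continuous (F : R -> C) (t L : R) :
  (forall t', Cmod (F t' - F t) <= L * Rabs (t' - t))%R -> continuous F t.
Proof.
  intros H P HP; apply locally_Cmod in HP; destruct HP as [e [He HP]].
  assert (Hd : (0 < e / (Rabs L + 1))%R).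
  { apply Rdiv_lt_0_compat; auto; pose proof (Rabs_pos L); lra. }
  exists (mkposreal _ Hd); intros t' Ht; apply HP.
  change (Rabs (t' - t) < e / (Rabs L + 1))%R in Ht.
  apply Rlt_div_r in Ht; [|pose proof (Rabs_pos L); lra].
  specialize (H t'); pose proof (Rle_abs L); pose proof (Rabs_pos (t' - t)); nra.
Qed.

Lemma continuous_polar_t (s t : R) : continuous (fun t => polar s t : C) t.
Proof.
  apply lipschitz_continuous with (2 * Rabs s)%R; intros t'.
  eapply Rle_trans; [apply polar_lipschitz|].
  rewrite Rminus_diag, Rabs_R0; lra.
Qed.

Lemma continuous_polar_s (s t : R) : continuous (fun s => polar s t : C) s.
Proof.
  apply lipschitz_continuous with 2%R; intros s'.
  eapply Rle_trans; [apply polar_lipschitz|].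
  rewrite Rminus_diag, Rabs_R0; lra.
Qed.

Lemma continuous_Re_comp (F : R -> C) (t : R) :
  continuous F t -> continuous (fun t => Re (F t)) t.
Proof. intros H; apply (continuous_comp F fst); auto; apply continuous_fst. Qed.

Lemma continuous_Im_comp (F : R -> C) (t : R) :
  continuous F t -> continuous (fun t => Im (F t)) t.
Proof. intros H; apply (continuous_comp F snd); auto; apply continuous_snd. Qed.

(** The real part of the integral of [f z / (i z)] along the boundary of the
    polar rectangle [a <= s <= b], [c <= t <= d]. *)
Definition polar_boundary (f : C -> C) (a b c d : R) : R :=
  (RInt (fun t => Re (f (polar b t)) - Re (f (polar a t))) c d -
   RInt (fun s => (Im (f (polar s d)) - Im (f (polar s c))) / s) a b)%R.

Section PolarGoursat.

Variables (f : C -> C) (s1 s2 : R).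
Hypothesis Hs : (0 < s1 <= s2)%R.
Hypothesis Hf : forall z, (s1 <= Cmod z <= s2)%R -> ex_derive f z.

Lemma annulus_continuous (s t : R) : (s1 <= s <= s2)%R -> continuous f (polar s t).
Proof.
  intros H; apply ex_derive_Ccontinuous, Hf; rewrite Cmod_polar; lra.
Qed.

Lemma arc_integrable (s c d : R) :
  (s1 <= s <= s2)%R -> ex_RInt (fun t => Re (f (polar s t))) c d.
Proof.
  intros H; apply (@ex_RInt_continuous R_CompleteNormedModule); intros t _.
  apply continuous_Re_comp, (continuous_comp (fun t => polar s t : C) f).
  - apply continuous_polar_t.
  - now apply annulus_continuous.
Qed.

Lemma arc_diff_integrable (a b c d : R) :
  (s1 <= a <= s2)%R -> (s1 <= b <= s2)%R ->
  ex_RInt (fun t => Re (f (polar b t)) - Re (f (polar a t)))%R c d.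
Proof.
  intros Ha Hb.
  apply (@ex_RInt_minus R_NormedModule (fun t => Re (f (polar b t))) (fun t => Re (f (polar a t))));
    now apply arc_integrable.
Qed.

Lemma ray_diff_integrable (a b c d : R) :
  (s1 <= a <= s2)%R -> (s1 <= b <= s2)%R ->
  ex_RInt (fun s => (Im (f (polar s d)) - Im (f (polar s c))) / s)%R a b.
Proof.
  intros Ha Hb; apply (@ex_RInt_continuous R_CompleteNormedModule); intros s Hss.
  assert (Hs' : (s1 <= s <= s2)%R).
  { split; [apply Rle_trans with (Rmin a b); [apply Rmin_glb; lra | lra]
           |apply Rle_trans with (Rmax a b); [lra | apply Rmax_lub; lra]]. }
  apply (continuous_mult (fun s => Im (f (polar s d)) - Im (f (polar s c)))%R (fun s => / s)%R).
  - apply (continuous_minus (fun s => Im (f (polar s d))) (fun s => Im (f (polar s c))));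
      apply continuous_Im_comp;
      (eapply (continuous_comp (fun s => polar s _ : C) f);
        [apply continuous_polar_s | now apply annulus_continuous]).
  - apply continuous_Rinv; lra.
Qed.

Lemma polar_boundary_split_s (a m b c d : R) :
  (s1 <= a <= s2)%R -> (s1 <= m <= s2)%R -> (s1 <= b <= s2)%R ->
  polar_boundary f a b c d = (polar_boundary f a m c d + polar_boundary f m b c d)%R.
Proof.
  intros Ha Hm Hb; unfold polar_boundary.
  rewrite <- (RInt_Chasles _ a m b) by (now apply ray_diff_integrable).
  change plus with Rplus.
  assert (E : forall x y, (s1 <= x <= s2)%R -> (s1 <= y <= s2)%R ->
    RInt (fun t => Re (f (polar y t)) - Re (f (polar x t)))%R c d =
    (RInt (fun t => Re (f (polar y t))) c d - RInt (fun t => Re (f (polar x t))) c d)%R).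
  { intros x y Hx Hy.
    apply (RInt_minus (V := R_CompleteNormedModule)
             (fun t => Re (f (polar y t))) (fun t => Re (f (polar x t))));
      now apply arc_integrable. }
  rewrite !E by auto; lra.
Qed.

Lemma polar_boundary_split_t (a b c m d : R) :
  (s1 <= a <= s2)%R -> (s1 <= b <= s2)%R ->
  polar_boundary f a b c d = (polar_boundary f a b c m + polar_boundary f a b m d)%R.
Proof.
  intros Ha Hb; unfold polar_boundary.
  rewrite <- (RInt_Chasles _ c m d) by (now apply arc_diff_integrable).
  change plus with Rplus.
  rewrite (RInt_ext (fun s => (Im (f (polar s d)) - Im (f (polar s c))) / s)%R
     (fun s => plus ((Im (f (polar s m)) - Im (f (polar s c))) / s)%R
                    ((Im (f (polar s d)) - Im (f (polar s m))) / s)%R)).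
  - rewrite (RInt_plus (V := R_CompleteNormedModule)) by (now apply ray_diff_integrable).
    change plus with Rplus; lra.
  - intros s _; change ((Im (f (polar s d)) - Im (f (polar s c))) / s =
      (Im (f (polar s m)) - Im (f (polar s c))) / s +
      (Im (f (polar s d)) - Im (f (polar s m))) / s)%R; unfold Rdiv; ring.
Qed.

Lemma RInt_close (F G : R -> R) (a b X M : R) :
  (a <= b)%R -> ex_RInt F a b -> is_RInt G a b X ->
  (forall t, a <= t <= b -> Rabs (F t - G t) <= M)%R ->
  (Rabs (RInt F a b - X) <= (b - a) * M)%R.
Proof.
  intros Hab HF HG HM.
  pose proof (is_RInt_minus _ _ _ _ _ _ (RInt_correct (V := R_CompleteNormedModule) F a b HF) HG) as H.
  exact (norm_RInt_le_const (V := R_NormedModule) _ a b _ M Hab HM H).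
Qed.

(** An affine function has zero boundary integral, because both arcs and both
    rays contribute the increment of [s (l1 sin t + l2 cos t)]; the error of the
    affine approximation at a point of the rectangle is of second order. *)
Lemma polar_boundary_small (z0 l : C) (a b c d M : R) :
  (s1 <= a)%R -> (a <= b)%R -> (b <= s2)%R -> (c <= d)%R ->
  (forall s t, a <= s <= b -> c <= t <= d ->
     Cmod (f (polar s t) - f z0 - l * (polar s t - z0)) <= M)%R ->
  (Rabs (polar_boundary f a b c d) <= 2 * M * ((d - c) + (b - a) / s1))%R.
Proof.
  intros Ha Hab Hb Hcd HM.
  assert (HM0 : (0 <= M)%R).
  { eapply Rle_trans; [apply Cmod_ge_0 | apply (HM a c); lra]. }
  set (e := fun s t => f (polar s t) - f z0 - l * (polar s t - z0)).
  set (X := ((b - a) * ((Re l * sin d + Im l * cos d) - (Re l * sin c + Im l * cos c)))%R).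
  unfold polar_boundary.
  assert (E1 : (Rabs (RInt (fun t => Re (f (polar b t)) - Re (f (polar a t))) c d - X)
    <= (d - c) * (2 * M))%R).
  { apply RInt_close with (fun t => (b - a) * (Re l * cos t - Im l * sin t))%R; auto.
    - apply arc_diff_integrable; lra.
    - unfold X.
      apply (is_RInt_scal (V := R_NormedModule)).
      apply (is_RInt_derive (V := R_CompleteNormedModule)
        (fun t => Re l * sin t + Im l * cos t)%R).
      + intros t _; auto_derive; auto; ring.
      + intros t _; apply (ex_derive_continuous (V := R_NormedModule)); auto_derive; auto.
    - intros t Ht.
      replace (_ - _ - _)%R with (Re (e b t) - Re (e a t))%R.
      + pose proof (re_le_Cmod (e b t)); pose proof (re_le_Cmod (e a t)).
        assert (Cmod (e b t) <= M)%R by (apply HM; lra).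
        assert (Cmod (e a t) <= M)%R by (apply HM; lra).
        eapply Rle_trans; [apply Rabs_triang|]; rewrite Rabs_Ropp; lra.
      + unfold e, polar, Cminus, Cplus, Copp, Cmult; simpl.
        unfold Re, Im; simpl; ring. }
  assert (E2 : (Rabs (RInt (fun s => (Im (f (polar s d)) - Im (f (polar s c))) / s) a b - X)
    <= (b - a) * (2 * M / s1))%R).
  { apply RInt_close with
      (fun _ => ((Re l * sin d + Im l * cos d) - (Re l * sin c + Im l * cos c)))%R; auto.
    - apply ray_diff_integrable; lra.
    - apply (is_RInt_const (V := R_NormedModule)).
    - intros s Hss.
      replace (_ - _)%R with ((Im (e s d) - Im (e s c)) / s)%R.
      + pose proof (Rabs_Im_le_Cmod (e s d)); pose proof (Rabs_Im_le_Cmod (e s c)).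
        assert (Cmod (e s d) <= M)%R by (apply HM; lra).
        assert (Cmod (e s c) <= M)%R by (apply HM; lra).
        unfold Rdiv; rewrite Rabs_mult, (Rabs_pos_eq (/ s))
          by (left; apply Rinv_0_lt_compat; lra).
        apply Rmult_le_compat; try apply Rabs_pos.
        * left; apply Rinv_0_lt_compat; lra.
        * eapply Rle_trans; [apply Rabs_triang|]; rewrite Rabs_Ropp; lra.
        * apply Rinv_le_contravar; lra.
      + unfold e, polar, Cminus, Cplus, Copp, Cmult; simpl.
        unfold Re, Im; simpl; field; lra. }
  replace (_ - _)%R with
    ((RInt (fun t => Re (f (polar b t)) - Re (f (polar a t))) c d - X) -
     (RInt (fun s => (Im (f (polar s d)) - Im (f (polar s c))) / s) a b - X))%R by ring.
  eapply Rle_trans; [apply Rabs_triang|]; rewrite Rabs_Ropp.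
  eapply Rle_trans; [apply Rplus_le_compat; [apply E1 | apply E2]|].
  right; field; lra.
Qed.

Lemma polar_boundary_zero : polar_boundary f s1 s2 0 (2 * PI) = 0%R.
Proof.
  assert (HPI := PI_RGT_0).
  set (a := (s2 - s1)%R).
  set (J := fun x y h =>
    polar_boundary f (s1 + a * x) (s1 + a * (x + h)) (2 * PI * y) (2 * PI * (y + h))).
  enough (Hsmall : forall e, (0 < e)%R -> (Rabs (J 0 0 1)%R <= e)%R).
  { unfold J in Hsmall.
    replace (s1 + a * 0)%R with s1 in Hsmall by ring.
    replace (s1 + a * (0 + 1))%R with s2 in Hsmall by (unfold a; ring).
    replace (2 * PI * 0)%R with 0%R in Hsmall by ring.
    replace (2 * PI * (0 + 1))%R with (2 * PI)%R in Hsmall by ring.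
    apply Rabs_eq_0, Rle_antisym; [|apply Rabs_pos].
    apply le_epsilon; intros e He; rewrite Rplus_0_l; auto. }
  intros e He.
  set (P := fun x y h => (0 <= x -> 0 <= y -> x + h <= 1 -> y + h <= 1 ->
     Rabs (J x y h) <= e * h ^ 2)%R).
  assert (Ha : (0 <= a)%R) by (unfold a; lra).
  assert (Hin : forall x, (0 <= x <= 1)%R -> (s1 <= s1 + a * x <= s2)%R).
  { intros x Hx; unfold a in *; nra. }
  enough (HP : P 0%R 0%R 1%R).
  { replace e with (e * 1 ^ 2)%R by ring; apply HP; lra. }
  apply square_bisection; [lra| |].
  - intros x y h Hh P1 P2 P3 P4 Hx Hy Hxh Hyh.
    assert (E : J x y h = (J x y (h / 2) + J (x + h / 2) y (h / 2) +
      (J x (y + h / 2) (h / 2) + J (x + h / 2) (y + h / 2) (h / 2)))%R).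
    { unfold J.
      replace (x + h / 2 + h / 2)%R with (x + h)%R by field.
      replace (y + h / 2 + h / 2)%R with (y + h)%R by field.
      rewrite (polar_boundary_split_t _ _ (2 * PI * y) (2 * PI * (y + h / 2)))
        by (apply Hin; lra).
      f_equal; apply polar_boundary_split_s; apply Hin; lra. }
    unfold P in P1, P2, P3, P4; rewrite E.
    assert (A1 := P1 ltac:(lra) ltac:(lra) ltac:(lra) ltac:(lra)).
    assert (A2 := P2 ltac:(lra) ltac:(lra) ltac:(lra) ltac:(lra)).
    assert (A3 := P3 ltac:(lra) ltac:(lra) ltac:(lra) ltac:(lra)).
    assert (A4 := P4 ltac:(lra) ltac:(lra) ltac:(lra) ltac:(lra)).
    eapply Rle_trans; [apply Rabs_triang|].
    eapply Rle_trans; [apply Rplus_le_compat; apply Rabs_triang|]; nra.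
  - intros x y Hx Hy; rewrite Rplus_0_l in Hx, Hy.
    set (z0 := polar (s1 + a * x) (2 * PI * y)).
    destruct (Hf z0) as [l Hl].
    { unfold z0; rewrite Cmod_polar; [apply Hin; lra | specialize (Hin x Hx); lra]. }
    rewrite is_derive_Cmod in Hl.
    (* [D * h] bounds the distance to [z0] inside a square of side [h] *)
    set (D := (2 * a + 4 * PI * s2 + 1)%R).
    assert (HD : (0 < D)%R) by (unfold D; nra).
    set (K := (2 * D * (2 * PI + a / s1))%R).
    assert (Has : (0 <= a / s1)%R) by (apply Rdiv_le_0_compat; lra).
    assert (HK : (0 < K)%R) by (unfold K; nra).
    destruct (Hl (e / K)%R) as [r [Hr Hrz]]; [now apply Rdiv_lt_0_compat|].
    exists (r / D)%R; split; [now apply Rdiv_lt_0_compat|].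
    intros x' y' h' [Hh' Hhr] Hx' Hy' B1 B2 B3 B4.
    apply Rlt_div_r in Hhr; auto.
    unfold J.
    replace (e * h' ^ 2)%R with
      (2 * (e / K * (D * h')) * ((2 * PI * (y' + h') - 2 * PI * y')
        + (s1 + a * (x' + h') - (s1 + a * x')) / s1))%R
      by (unfold K; field; split; [lra|]; unfold K in HK; nra).
    pose proof (Hin x' ltac:(lra)); pose proof (Hin (x' + h')%R ltac:(lra)).
    apply polar_boundary_small with z0 l; try nra.
    intros s t Hss Htt.
    assert (Hz : (Cmod (polar s t - z0) <= D * h' - h')%R).
    { unfold z0; eapply Rle_trans; [apply polar_lipschitz|].
      specialize (Hin x Hx).
      rewrite (Rabs_pos_eq (s1 + a * x)) by lra.
      assert (Rabs (s - (s1 + a * x)) <= a * h')%R by (apply Rabs_le; nra).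
      assert (Rabs (t - 2 * PI * y) <= 2 * PI * h')%R by (apply Rabs_le; nra).
      assert ((s1 + a * x) * Rabs (t - 2 * PI * y) <= s2 * (2 * PI * h'))%R.
      { apply Rmult_le_compat; try lra; apply Rabs_pos. }
      unfold D; lra. }
    eapply Rle_trans; [apply Hrz; lra|].
    apply Rmult_le_compat_l; [left; now apply Rdiv_lt_0_compat | lra].
Qed.

End PolarGoursat.

(** Cauchy's theorem in an annulus: over the full turn the two rays of the
    polar rectangle coincide and only the circles remain. *)
Lemma circle_integral_const (f : C -> C) (s1 s2 : R) :
  (0 < s1 <= s2)%R -> (forall z, (s1 <= Cmod z <= s2)%R -> ex_derive f z) ->
  RInt (fun t => Re (f (polar s1 t))) 0 (2 * PI) =
  RInt (fun t => Re (f (polar s2 t))) 0 (2 * PI).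
Proof.
  intros Hs Hf; pose proof (polar_boundary_zero f s1 s2 Hs Hf) as H.
  unfold polar_boundary in H.
  rewrite (RInt_ext (fun s => (Im (f (polar s (2 * PI))) - Im (f (polar s 0))) / s)%R
    (fun _ => 0%R)) in H.
  2: { intros s _; unfold polar; rewrite cos_2PI, sin_2PI, cos_0, sin_0.
       rewrite Rminus_diag; apply Rmult_0_l. }
  rewrite (RInt_const (V := R_CompleteNormedModule)) in H.
  rewrite (RInt_minus (V := R_CompleteNormedModule)
    (fun t => Re (f (polar s2 t))) (fun t => Re (f (polar s1 t)))) in H
    by (apply (arc_integrable f s1 s2 Hs Hf); lra).
  unfold minus, plus, opp, scal in H; simpl in H; unfold mult in H; simpl in H; lra.
Qed.

Lemma circle_continuous (f : C -> C) (s t : R) :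
  continuous f (polar s t) -> continuous (fun t => f (polar s t)) t.
Proof. apply (continuous_comp (fun t => polar s t : C) f), continuous_polar_t. Qed.

Lemma circle_integral_continuous (f : C -> C) (r s0 : R) :
  (0 <= s0 <= r)%R -> (forall z, (Cmod z <= r)%R -> continuous f z) ->
  forall e : R, (0 < e)%R -> exists d, (0 < d)%R /\
    forall s, (0 <= s <= r)%R -> (Rabs (s - s0) < d)%R ->
    (Rabs (RInt (fun t => Re (f (polar s t))) 0 (2 * PI) -
           RInt (fun t => Re (f (polar s0 t))) 0 (2 * PI)) <= e)%R.
Proof.
  intros Hs0 Hf e He; assert (HPI := PI_RGT_0).
  assert (Hcont : forall s, (0 <= s <= r)%R ->
    ex_RInt (fun t => Re (f (polar s t))) 0 (2 * PI)).
  { intros s Hs; apply (@ex_RInt_continuous R_CompleteNormedModule); intros t _.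
    apply continuous_Re_comp, circle_continuous, Hf; rewrite Cmod_polar; lra. }
  assert (He' : (0 < e / (2 * PI))%R) by (apply Rdiv_lt_0_compat; lra).
  destruct (uniform_continuity_2d_1d (fun t s => Re (f (polar s t))) 0 (2 * PI) s0)
    with (eps := mkposreal _ He') as [d Hd].
  { intros t _ e'.
    assert (Cf : continuous f (polar s0 t)) by (apply Hf; rewrite Cmod_polar; lra).
    rewrite continuous_Cmod in Cf; destruct (Cf e' (cond_pos e')) as [k [Hk Hfk]].
    assert (Hq : (0 < k / (2 + 2 * s0))%R) by (apply Rdiv_lt_0_compat; lra).
    exists (mkposreal _ Hq); simpl; intros t' s' Ht' Hs'.
    apply Rlt_div_r in Ht'; [|lra]; apply Rlt_div_r in Hs'; [|lra].
    replace (Re (f (polar s' t')) - Re (f (polar s0 t)))%R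
      with (Re (f (polar s' t') - f (polar s0 t)))
      by (unfold Cminus, Cplus, Copp, Re; simpl; ring).
    eapply Rle_lt_trans; [apply re_le_Cmod|]; apply Hfk.
    eapply Rle_lt_trans; [apply polar_lipschitz|]; rewrite (Rabs_pos_eq s0) by lra.
    pose proof (Rabs_pos (t' - t)); pose proof (Rabs_pos (s' - s0)); nra. }
  exists d; split; [apply cond_pos|]; intros s Hs Hsd.
  replace (_ - _)%R with
    (RInt (fun t => minus (Re (f (polar s t))) (Re (f (polar s0 t)))) 0 (2 * PI)).
  2: { rewrite (RInt_minus (V := R_CompleteNormedModule)
         (fun t => Re (f (polar s t))) (fun t => Re (f (polar s0 t)))); auto. }
  replace e with ((2 * PI - 0) * (e / (2 * PI)))%R by (field; lra).
  apply abs_RInt_le_const; [lra| |].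
  - apply (@ex_RInt_minus R_NormedModule (fun t => Re (f (polar s t)))
      (fun t => Re (f (polar s0 t)))); auto.
  - intros t Ht; left; unfold minus, plus, opp; simpl.
    pose proof (cond_pos d); apply Rabs_def2 in Hsd.
    apply (Hd t s0 t s); try lra.
    rewrite Rminus_diag, Rabs_R0; lra.
Qed.

(** The mean value property survives an exceptional centre and an exceptional
    circle: the integral over the circle of radius [s] is locally constant
    away from them and continuous in [s]. *)
Lemma circle_integral_center (f : C -> C) (r k : R) :
  (0 < r)%R -> (forall z, (Cmod z <= r)%R -> continuous f z) ->
  (forall z : C, z <> 0 -> Cmod z <> k -> (Cmod z <= r)%R -> ex_derive f z) ->
  (RInt (fun t => Re (f (polar r t))) 0 (2 * PI) = 2 * PI * Re (f 0))%R.
Proof.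
  intros Hr Hc Hd.
  set (I := fun s => RInt (fun t => Re (f (polar s t))) 0 (2 * PI)).
  assert (Hlim : forall s0 X, (0 <= s0 <= r)%R ->
    (forall d, 0 < d -> exists s, 0 <= s <= r /\ Rabs (s - s0) < d /\ I s = X)%R ->
    I s0 = X).
  { intros s0 X Hs0 H; apply Rminus_diag_uniq, Rabs_eq_0, Rle_antisym; [|apply Rabs_pos].
    apply le_epsilon; intros e He; rewrite Rplus_0_l.
    destruct (circle_integral_continuous f r s0 Hs0 Hc e He) as [d [Hd' HI]].
    destruct (H d Hd') as [s [Hs [Hss <-]]].
    rewrite Rabs_minus_sym; apply HI; auto. }
  assert (Hconst : forall s s', (0 < s <= s')%R -> (s' <= r)%R ->
    (forall x, s <= x <= s' -> x <> k)%R -> I s = I s').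
  { intros s s' Hs Hs' Hk; apply circle_integral_const; auto.
    intros z Hz; apply Hd; [|apply Hk; lra|lra].
    apply Cmod_gt_0; lra. }
  assert (I0 : I 0%R = (2 * PI * Re (f 0))%R).
  { unfold I; rewrite (RInt_ext _ (fun _ => Re (f 0))).
    - rewrite (RInt_const (V := R_CompleteNormedModule)).
      unfold scal; simpl; unfold mult; simpl; ring.
    - intros t _; unfold polar; rewrite !Rmult_0_l; reflexivity. }
  assert (Hin : forall s, (0 < s <= r)%R -> (s < k \/ k <= 0 \/ r < k)%R -> I s = I 0%R).
  { intros s Hs Hk; symmetry; apply Hlim; [lra|]; intros d Hd'.
    exists (Rmin s (d / 2)); assert (0 < Rmin s (d / 2))%R by (apply Rmin_pos; lra).
    pose proof (Rmin_l s (d / 2)); pose proof (Rmin_r s (d / 2)).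
    split; [lra|]; split.
    - rewrite Rminus_0_r, Rabs_pos_eq; lra.
    - apply Hconst; try lra; intros x Hx ->; lra. }
  change (I r = 2 * PI * Re (f 0))%R; rewrite <- I0.
  destruct (Rlt_dec 0 k) as [Hk|Hk]; [|apply Hin; lra].
  destruct (Rlt_dec r k) as [Hk'|Hk']; [apply Hin; lra|].
  assert (Ik : I k = I 0%R).
  { apply Hlim; [lra|]; intros d Hd'.
    exists (Rmax (k / 2) (k - d / 2)).
    assert (k / 2 <= Rmax (k / 2) (k - d / 2) < k)%R
      by (split; [apply Rmax_l | apply Rmax_lub_lt; lra]).
    pose proof (Rmax_r (k / 2) (k - d / 2)).
    split; [lra|]; split; [rewrite Rabs_left; lra|].
    apply Hin; lra. }
  destruct (Req_dec k r) as [->|Hkr]; [exact Ik|].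
  rewrite <- Ik; symmetry; apply Hlim; [lra|]; intros d Hd'.
  exists (Rmin r (k + d / 2)).
  assert (k < Rmin r (k + d / 2) <= r)%R
    by (split; [apply Rmin_glb_lt; lra | apply Rmin_l]).
  pose proof (Rmin_r r (k + d / 2)).
  split; [lra|]; split; [rewrite Rabs_pos_eq; lra|].
  apply Hconst; try lra; intros x Hx; lra.
Qed.

Definition turn_mean (F : R -> C) : C :=
  ((RInt (fun t => Re (F t)) 0 (2 * PI) / (2 * PI))%R,
   (RInt (fun t => Im (F t)) 0 (2 * PI) / (2 * PI))%R).

Lemma C_eq (z w : C) : Re z = Re w -> Im z = Im w -> z = w.
Proof. destruct z, w; simpl; intros -> ->; reflexivity. Qed.

Lemma Re_plus (z w : C) : Re (z + w) = (Re z + Re w)%R.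
Proof. reflexivity. Qed.
Lemma Im_plus (z w : C) : Im (z + w) = (Im z + Im w)%R.
Proof. reflexivity. Qed.
Lemma Re_minus (z w : C) : Re (z - w) = (Re z - Re w)%R.
Proof. reflexivity. Qed.
Lemma Re_mult (z w : C) : Re (z * w) = (Re z * Re w - Im z * Im w)%R.
Proof. reflexivity. Qed.

Lemma turn_mean_ext (F G : R -> C) :
  (forall t, F t = G t) -> turn_mean F = turn_mean G.
Proof.
  intros H; unfold turn_mean; f_equal; f_equal; apply RInt_ext;
    intros t _; now rewrite H.
Qed.

Lemma Re_integrable (F : R -> C) :
  (forall t, continuous F t) -> ex_RInt (fun t => Re (F t)) 0 (2 * PI).
Proof.
  intros H; apply (@ex_RInt_continuous R_CompleteNormedModule); intros t _.
  now apply continuous_Re_comp.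
Qed.

Lemma Im_integrable (F : R -> C) :
  (forall t, continuous F t) -> ex_RInt (fun t => Im (F t)) 0 (2 * PI).
Proof.
  intros H; apply (@ex_RInt_continuous R_CompleteNormedModule); intros t _.
  now apply continuous_Im_comp.
Qed.

Lemma turn_mean_plus (F G : R -> C) :
  (forall t, continuous F t) -> (forall t, continuous G t) ->
  turn_mean (fun t => F t + G t) = turn_mean F + turn_mean G.
Proof.
  intros HF HG; assert (HPI := PI_RGT_0); apply C_eq; simpl.
  - rewrite (RInt_plus (V := R_CompleteNormedModule) (fun t => Re (F t)) (fun t => Re (G t)))
      by now apply Re_integrable.
    unfold plus; simpl; field; lra.
  - rewrite (RInt_plus (V := R_CompleteNormedModule) (fun t => Im (F t)) (fun t => Im (G t)))
      by now apply Im_integrable.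
    unfold plus; simpl; field; lra.
Qed.

Lemma turn_mean_scal (c : C) (F : R -> C) :
  (forall t, continuous F t) ->
  turn_mean (fun t => c * F t) = c * turn_mean F.
Proof.
  intros HF; assert (HPI := PI_RGT_0).
  assert (HR := Re_integrable F HF); assert (HI := Im_integrable F HF).
  assert (Hlin : forall a b, RInt (fun t => a * Re (F t) + b * Im (F t))%R 0 (2 * PI) =
    (a * RInt (fun t => Re (F t)) 0 (2 * PI) + b * RInt (fun t => Im (F t)) 0 (2 * PI))%R).
  { intros a b.
    rewrite (RInt_plus (V := R_CompleteNormedModule)
      (fun t => scal a (Re (F t))) (fun t => scal b (Im (F t)))).
    - rewrite !(RInt_scal (V := R_CompleteNormedModule)); auto.
    - now apply (ex_RInt_scal (V := R_NormedModule)).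
    - now apply (ex_RInt_scal (V := R_NormedModule)). }
  apply C_eq; simpl.
  - rewrite (RInt_ext _ (fun t => Re c * Re (F t) + (- Im c) * Im (F t))%R).
    + rewrite Hlin; unfold Re, Im; field; lra.
    + intros t _.
      change (Re c * Re (F t) - Im c * Im (F t) = Re c * Re (F t) + - Im c * Im (F t))%R; ring.
  - rewrite (RInt_ext _ (fun t => Im c * Re (F t) + Re c * Im (F t))%R).
    + rewrite Hlin; unfold Re, Im; field; lra.
    + intros t _.
      change (Re c * Im (F t) + Im c * Re (F t) = Im c * Re (F t) + Re c * Im (F t))%R; ring.
Qed.

Lemma turn_mean_minus (F G : R -> C) :
  (forall t, continuous F t) -> (forall t, continuous G t) ->
  turn_mean (fun t => F t - G t) = turn_mean F - turn_mean G.
Proof.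
  intros HF HG.
  rewrite (turn_mean_ext _ (fun t => F t + RtoC (-1) * G t)) by (intros; ring).
  rewrite turn_mean_plus; auto.
  - rewrite turn_mean_scal by auto; ring.
  - intros t; apply (continuous_scal_r (RtoC (-1)) (V := C_NormedModule) G t (HG t)).
Qed.

Lemma turn_mean_const (c : C) : turn_mean (fun _ => c) = c.
Proof.
  assert (HPI := PI_RGT_0); apply C_eq; simpl;
    rewrite (RInt_const (V := R_CompleteNormedModule));
    unfold scal; simpl; unfold mult; simpl; field; lra.
Qed.

Lemma turn_mean_bound (F : R -> C) (M : R) :
  (forall t, continuous F t) -> (forall t, 0 <= t <= 2 * PI -> Cmod (F t) <= M)%R ->
  (Cmod (turn_mean F) <= 2 * M)%R.
Proof.
  intros HF HM; assert (HPI := PI_RGT_0).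
  eapply Rle_trans; [apply Cmod_le_abs|].
  assert (H : forall G, ex_RInt G 0 (2 * PI) -> (forall t, Rabs (G t) <= Cmod (F t))%R ->
    (Rabs (RInt G 0 (2 * PI) / (2 * PI)) <= M)%R).
  { intros G HG HGF; unfold Rdiv; rewrite Rabs_mult, (Rabs_pos_eq (/ _))
      by (left; apply Rinv_0_lt_compat; lra).
    apply Rle_div_l; [lra|].
    replace (M * (2 * PI))%R with ((2 * PI - 0) * M)%R by ring.
    apply abs_RInt_le_const; auto; [lra|]; intros t Ht.
    eapply Rle_trans; eauto. }
  assert (A := H (fun t => Re (F t)) (Re_integrable F HF) (fun t => re_le_Cmod (F t))).
  assert (B := H (fun t => Im (F t)) (Im_integrable F HF) (fun t => Rabs_Im_le_Cmod (F t))).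
  lra.
Qed.

Lemma turn_mean_center (f : C -> C) (r k : R) :
  (0 < r)%R -> (forall z, (Cmod z <= r)%R -> continuous f z) ->
  (forall z : C, z <> 0 -> Cmod z <> k -> (Cmod z <= r)%R -> ex_derive f z) ->
  turn_mean (fun t => f (polar r t)) = f 0.
Proof.
  intros Hr Hc Hd; assert (HPI := PI_RGT_0).
  apply C_eq; simpl.
  - rewrite (circle_integral_center f r k) by auto; field; lra.
  - rewrite (RInt_ext _ (fun t => Re ((- Ci) * f (polar r t)))).
    + rewrite (circle_integral_center (fun z => (- Ci) * f z) r k); auto.
      * rewrite Re_mult; simpl; field; lra.
      * intros z Hz; apply continuous_Cmult; [apply continuous_const | auto].
      * intros z H1 H2 H3; apply ex_derive_Cmult; [apply ex_derive_Cconst | auto].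
    + intros t _; unfold Re, Im, Ci, Copp, Cmult; simpl.
      match goal with |- ?a = ?b => change (a = b :> R) end; ring.
Qed.

(** * Cauchy's formula and regularity *)

Lemma polar_surjective (w : C) :
  exists t, (0 <= t <= 2 * PI)%R /\ w = polar (Cmod w) t.
Proof.
  assert (HPI := PI_RGT_0).
  destruct (Ceq_dec w 0) as [->|Hw].
  { exists 0%R; split; [lra|]; rewrite Cmod_0; unfold polar; rewrite !Rmult_0_l; reflexivity. }
  apply Cmod_gt_0 in Hw; set (r := Cmod w) in *; destruct w as [x y].
  assert (E : (x * x + y * y = r * r)%R).
  { unfold r, Cmod; simpl; rewrite sqrt_sqrt; [ring | nra]. }
  assert (Hx : (-1 <= x / r <= 1)%R).
  { split; [apply Rle_div_r | apply Rle_div_l]; auto; nra. }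
  pose proof (acos_bound (x / r)) as Hb.
  assert (Hs : (sqrt (1 - (x / r)²) = Rabs y / r)%R).
  { replace (1 - (x / r)²)%R with ((Rabs y / r)²)%R.
    - apply sqrt_Rsqr, Rdiv_le_0_compat; [apply Rabs_pos | auto].
    - unfold Rsqr; replace (Rabs y / r * (Rabs y / r))%R
        with (Rabs y * Rabs y / (r * r))%R by (field; lra).
      rewrite <- Rabs_mult, Rabs_pos_eq by nra.
      replace (y * y)%R with (r * r - x * x)%R by lra; field; lra. }
  destruct (Rle_dec 0 y) as [Hy|Hy].
  - exists (acos (x / r)); split; [lra|]; unfold polar.
    rewrite cos_acos, sin_acos, Hs, Rabs_pos_eq by auto.
    f_equal; field; lra.
  - exists (2 * PI - acos (x / r))%R; split; [lra|]; unfold polar.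
    rewrite <- (cos_period _ 1), <- (sin_period _ 1) at 1.
    replace (2 * PI - acos (x / r) + 2 * INR 1 * PI)%R
      with (- acos (x / r) + 2 * INR 2 * PI)%R by (simpl; ring).
    rewrite cos_period, sin_period, cos_neg, sin_neg, cos_acos, sin_acos, Hs, Rabs_left by lra.
    f_equal; field; lra.
Qed.

Lemma continuous_Cmod_comp (F : R -> C) (t : R) :
  continuous F t -> continuous (fun t => Cmod (F t)) t.
Proof.
  intros H; apply (continuous_comp F Cmod); auto.
  intros P [e He]; apply locally_Cmod; exists e; split; [apply cond_pos|].
  intros w Hw; apply He.
  change (Rabs (Cmod w - Cmod (F t)) < e)%R.
  pose proof (Cmod_tri_inv w (F t)); pose proof (Cmod_tri_inv (F t) w) as T.
  rewrite (Cmod_minus_sym (F t) w) in T; apply Rabs_def1; lra.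
Qed.

Lemma circle_bounded (f : C -> C) (r : R) :
  (0 <= r)%R -> (forall w, Cmod w = r -> continuous f w) ->
  exists M : R, (0 < M)%R /\ forall w, Cmod w = r -> (Cmod (f w) <= M)%R.
Proof.
  intros Hr Hf; assert (HPI := PI_RGT_0).
  destruct (continuity_ab_maj (fun t => Cmod (f (polar r t))) 0 (2 * PI)) as [m [Hm _]]; [lra| |].
  { intros t _; apply continuity_pt_filterlim.
    apply continuous_Cmod_comp, circle_continuous, Hf; now apply Cmod_polar. }
  exists (Cmod (f (polar r m)) + 1)%R; split.
  - pose proof (Cmod_ge_0 (f (polar r m))); lra.
  - intros w Hw; destruct (polar_surjective w) as [t [Ht ->]]; rewrite Hw.
    specialize (Hm t Ht); simpl in Hm; lra.
Qed.

Lemma circle_away_from_zero (f : C -> C) (r : R) :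
  (0 <= r)%R -> (forall w, Cmod w = r -> continuous f w) ->
  (forall w, Cmod w = r -> f w <> 0) ->
  exists m : R, (0 < m)%R /\ forall w, Cmod w = r -> (m <= Cmod (f w))%R.
Proof.
  intros Hr Hf H0.
  destruct (circle_bounded (fun w => / f w) r Hr) as [M [HM H]].
  { intros w Hw; apply continuous_Cinv; auto. }
  exists (/ M)%R; split; [now apply Rinv_0_lt_compat|]; intros w Hw.
  specialize (H w Hw); rewrite Cmod_inv in H by auto.
  assert (P : (0 < Cmod (f w))%R) by (apply Cmod_gt_0; auto).
  rewrite <- (Rinv_inv (Cmod (f w))); apply Rinv_le_contravar; auto.
  now apply Rinv_0_lt_compat.
Qed.

(** Differentiation under the integral sign, with a second order error that is
    uniform over the circle in place of a continuous derivative of the kernel. *)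
Lemma circle_mean_is_derive (r : R) (k : C -> C -> C) (k' : C -> C) (z : C) (d B : R) :
  (0 <= r)%R -> (0 < d)%R ->
  (forall w y, Cmod w = r -> (Cmod (y - z) < d)%R -> continuous (fun w => k w y) w) ->
  (forall w, Cmod w = r -> continuous k' w) ->
  (forall w y, Cmod w = r -> (Cmod (y - z) < d)%R ->
     (Cmod (k w y - k w z - k' w * (y - z)) <= B * (Cmod (y - z) * Cmod (y - z)))%R) ->
  is_derive (fun y => turn_mean (fun t => k (polar r t) y)) z
    (turn_mean (fun t => k' (polar r t))).
Proof.
  intros Hr Hd Hk Hk' HB; apply is_derive_Cmod; intros e He.
  assert (Hq : (0 < e / (2 * (Rabs B + 1)))%R).
  { apply Rdiv_lt_0_compat; auto; pose proof (Rabs_pos B); lra. }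
  exists (Rmin d (e / (2 * (Rabs B + 1)))); split; [now apply Rmin_pos|]; intros y Hy.
  assert (Hyd : (Cmod (y - z) < d)%R) by (eapply Rlt_le_trans; [apply Hy | apply Rmin_l]).
  assert (Hye : (Cmod (y - z) < e / (2 * (Rabs B + 1)))%R)
    by (eapply Rlt_le_trans; [apply Hy | apply Rmin_r]).
  apply Rlt_div_r in Hye; [|pose proof (Rabs_pos B); lra].
  assert (Hz : (Cmod (z - z) < d)%R).
  { replace (z - z) with (RtoC 0) by ring; now rewrite Cmod_0. }
  assert (C1 : forall t, continuous (fun t => k (polar r t) y) t).
  { intros t; apply (circle_continuous (fun w => k w y)), Hk; auto; now apply Cmod_polar. }
  assert (C2 : forall t, continuous (fun t => k (polar r t) z) t).
  { intros t; apply (circle_continuous (fun w => k w z)), Hk; auto; now apply Cmod_polar. }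
  assert (C3 : forall t, continuous (fun t => (y - z) * k' (polar r t)) t).
  { intros t; apply (circle_continuous (fun w => (y - z) * k' w)), continuous_Cmult;
      [apply continuous_const | apply Hk'; now apply Cmod_polar]. }
  assert (C4 : forall t, continuous (fun t => k' (polar r t)) t).
  { intros t; apply circle_continuous, Hk'; now apply Cmod_polar. }
  assert (C5 : forall t, continuous (fun t => k (polar r t) y - k (polar r t) z) t).
  { intros t; apply (circle_continuous (fun w => k w y - k w z)), continuous_Cminus;
      apply Hk; auto; now apply Cmod_polar. }
  rewrite (Cmult_comm (turn_mean _)), <- turn_mean_scal, <- !turn_mean_minus by auto.
  eapply Rle_trans; [apply (turn_mean_bound _ (Rabs B * (Cmod (y - z) * Cmod (y - z)))%R)|].
  - intros t; apply (circle_continuous (fun w => k w y - k w z - (y - z) * k' w)).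
    assert (Hw := Cmod_polar r t Hr).
    apply continuous_Cminus; [apply continuous_Cminus; now apply Hk|].
    apply continuous_Cmult; [apply continuous_const | now apply Hk'].
  - intros t _; rewrite (Cmult_comm (y - z)).
    eapply Rle_trans; [apply HB; auto; now apply Cmod_polar|].
    apply Rmult_le_compat_r; [|apply Rle_abs].
    pose proof (Cmod_ge_0 (y - z)); nra.
  - pose proof (Cmod_ge_0 (y - z)); nra.
Qed.

(** For [a = / (w - y)], [b = / (w - z)] and [h = y - z] the hypothesis is the
    resolvent identity, and the bounds are the errors of the first order
    expansions of [/ (w - y)] and of its square. *)
Lemma inv_second_order (a b h : C) (A : R) :
  (Cmod a <= A)%R -> (Cmod b <= A)%R -> a - b = h * a * b ->
  (Cmod (a - b - b * b * h) <= A * A * A * (Cmod h * Cmod h) /\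
   Cmod (a * a - b * b - 2 * (b * b * b) * h) <= 3 * A * A * A * A * (Cmod h * Cmod h))%R.
Proof.
  intros Ha Hb E.
  assert (E1 : a - b - b * b * h = h * h * (a * b * b)).
  { replace (a - b - b * b * h) with (h * a * b - b * b * h) by (rewrite <- E; ring).
    replace (h * a * b - b * b * h) with (h * b * (a - b)) by ring; rewrite E; ring. }
  assert (E2 : a * a - b * b - 2 * (b * b * b) * h = h * h * (a * b * b * (a + 2 * b))).
  { replace (a * a - b * b - 2 * (b * b * b) * h)
      with ((a - b) * (a + b) - 2 * (b * b * b) * h) by ring.
    rewrite E.
    replace (h * a * b * (a + b) - 2 * (b * b * b) * h)
      with (h * b * ((a - b) * (a + 2 * b))) by ring.
    rewrite E; ring. }
  pose proof (Cmod_ge_0 a); pose proof (Cmod_ge_0 b); pose proof (Cmod_ge_0 h).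
  assert (Hab : (Cmod a * Cmod b * Cmod b <= A * A * A)%R).
  { repeat apply Rmult_le_compat; auto; apply Rmult_le_pos; auto. }
  assert (Hsum : (Cmod (a + 2 * b) <= 3 * A)%R).
  { eapply Rle_trans; [apply Cmod_triangle|].
    rewrite Cmod_mult, Cmod_R, Rabs_pos_eq by lra; lra. }
  rewrite E1, E2, !Cmod_mult; split.
  - rewrite Rmult_comm; apply Rmult_le_compat_r; [apply Rmult_le_pos; auto | exact Hab].
  - rewrite Rmult_comm; apply Rmult_le_compat_r; [apply Rmult_le_pos; auto|].
    replace (3 * A * A * A * A)%R with (A * A * A * (3 * A))%R by ring.
    apply Rmult_le_compat; auto; [|apply Cmod_ge_0].
    repeat apply Rmult_le_pos; auto.
Qed.

(** The second conclusion is about the derivative in the first one, so a Cauchy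
    integral is twice differentiable. *)
Lemma cauchy_transform_is_derive (phi : C -> C) (r : R) (z : C) :
  (forall w, Cmod w = r -> continuous phi w) -> (Cmod z < r)%R ->
  is_derive (fun y => turn_mean (fun t => phi (polar r t) * / (polar r t - y))) z
    (turn_mean (fun t => phi (polar r t) * (/ (polar r t - z) * / (polar r t - z)))) /\
  ex_derive (fun y => turn_mean (fun t =>
    phi (polar r t) * (/ (polar r t - y) * / (polar r t - y)))) z.
Proof.
  intros Hphi Hz; assert (Hr : (0 <= r)%R) by (pose proof (Cmod_ge_0 z); lra).
  destruct (circle_bounded phi r Hr Hphi) as [M [HM HMb]].
  set (d := ((r - Cmod z) / 2)%R); assert (Hd : (0 < d)%R) by (unfold d; lra).
  assert (Hfar : forall w y, Cmod w = r -> (Cmod (y - z) < d)%R -> (d <= Cmod (w - y))%R).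
  { intros w y Hw Hy; pose proof (Cmod_tri_inv w (w - z)) as T.
    replace (w - (w - z)) with z in T by ring.
    pose proof (Cmod_tri3 w y z) as T2; pose proof (Cmod_tri_inv w z) as T3.
    unfold d in *; lra. }
  assert (Hnz : forall w y, Cmod w = r -> (Cmod (y - z) < d)%R -> w - y <> 0).
  { intros w y Hw Hy; apply Cmod_gt_0; specialize (Hfar w y Hw Hy); lra. }
  assert (Hinv : forall w y, Cmod w = r -> (Cmod (y - z) < d)%R -> (Cmod (/ (w - y)) <= / d)%R).
  { intros w y Hw Hy; rewrite Cmod_inv by auto; apply Rinv_le_contravar; auto. }
  assert (Hzz : (Cmod (z - z) < d)%R).
  { replace (z - z) with (RtoC 0) by ring; now rewrite Cmod_0. }
  assert (Hci : forall w y, Cmod w = r -> (Cmod (y - z) < d)%R ->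
    continuous (fun w => / (w - y)) w).
  { intros w y Hw Hy; apply continuous_Cinv; [|auto].
    apply continuous_Cminus; [apply continuous_id | apply continuous_const]. }
  assert (Hdiff : forall w y, Cmod w = r -> (Cmod (y - z) < d)%R ->
    / (w - y) - / (w - z) = (y - z) * / (w - y) * / (w - z)).
  { intros w y Hw Hy; field; split; auto. }
  split.
  - apply (circle_mean_is_derive r (fun w y => phi w * / (w - y))
      (fun w => phi w * (/ (w - z) * / (w - z))) z d (M * (/ d * / d * / d))); auto.
    + intros w y Hw Hy; apply continuous_Cmult; auto.
    + intros w Hw; apply continuous_Cmult; [auto|].
      apply continuous_Cmult; auto.
    + intros w y Hw Hy.
      replace (_ - _ - _) with (phi w * (/ (w - y) - / (w - z) - / (w - z) * / (w - z) * (y - z))) by ring.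
      rewrite Cmod_mult, Rmult_assoc.
      apply Rmult_le_compat; auto; try apply Cmod_ge_0.
      apply inv_second_order; auto.
  - exists (turn_mean (fun t => (fun w => phi w * (2 * (/ (w - z) * / (w - z) * / (w - z)))) (polar r t))).
    apply (circle_mean_is_derive r (fun w y => phi w * (/ (w - y) * / (w - y)))
      (fun w => phi w * (2 * (/ (w - z) * / (w - z) * / (w - z)))) z d
      (M * (3 * / d * / d * / d * / d))); auto.
    + intros w y Hw Hy; apply continuous_Cmult; [auto|].
      apply continuous_Cmult; auto.
    + intros w Hw; apply continuous_Cmult; [auto|].
      apply continuous_Cmult; [apply continuous_const|].
      apply continuous_Cmult; [apply continuous_Cmult|]; auto.
    + intros w y Hw Hy.
      replace (_ - _ - _) with (phi w * (/ (w - y) * / (w - y) - / (w - z) * / (w - z)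
        - 2 * (/ (w - z) * / (w - z) * / (w - z)) * (y - z))) by ring.
      rewrite Cmod_mult, Rmult_assoc.
      apply Rmult_le_compat; auto; try apply Cmod_ge_0.
      apply inv_second_order; auto.
Qed.

Lemma turn_mean_annulus (f : C -> C) (s1 s2 : R) :
  (0 < s1 <= s2)%R -> (forall z, (s1 <= Cmod z <= s2)%R -> ex_derive f z) ->
  turn_mean (fun t => f (polar s1 t)) = turn_mean (fun t => f (polar s2 t)).
Proof.
  intros Hs Hf.
  assert (E : forall s, RInt (fun t => Im (f (polar s t))) 0 (2 * PI) =
    RInt (fun t => Re ((- Ci) * f (polar s t))) 0 (2 * PI)).
  { intros s; apply RInt_ext; intros t _; unfold Re, Im, Ci, Copp, Cmult; simpl.
    match goal with |- ?a = ?b => change (a = b :> R) end; ring. }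
  unfold turn_mean; rewrite !E; f_equal; f_equal.
  - now apply circle_integral_const.
  - apply (circle_integral_const (fun z => (- Ci) * f z)); auto.
    intros z Hz; apply ex_derive_Cmult; [apply ex_derive_Cconst | auto].
Qed.

Lemma Cminus_neq_0 (a b : C) : a <> b -> a - b <> 0.
Proof. intros H E; apply H; replace a with (a - b + b) by ring; rewrite E; ring. Qed.

Lemma Cinv_neq_0 (z : C) : z <> 0 -> / z <> 0.
Proof.
  intros Hz; apply Cmod_gt_0; rewrite Cmod_inv by auto.
  now apply Rinv_0_lt_compat, Cmod_gt_0.
Qed.

Lemma Cmod_lt_neq (a b : C) : (Cmod a < Cmod b)%R -> b - a <> 0.
Proof. intros H; apply Cminus_neq_0; intros ->; lra. Qed.

(** By Cauchy's theorem in an annulus a larger circle gives the same mean, and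
    [w / (w - z)] tends to 1 as the radius grows. *)
Lemma turn_mean_cauchy_kernel (r : R) (z : C) :
  (Cmod z < r)%R -> turn_mean (fun t => polar r t * / (polar r t - z)) = 1.
Proof.
  intros Hz; pose proof (Cmod_ge_0 z) as Hz0.
  set (k := fun w => w * / (w - z)).
  assert (Hk : forall w, (r <= Cmod w)%R -> ex_derive k w).
  { intros w Hw; unfold k; cderive; apply Cmod_lt_neq; lra. }
  set (X := turn_mean (fun t => polar r t * / (polar r t - z))).
  assert (Hs : forall s, (r < s)%R -> (Cmod (X - 1) <= 2 * (Cmod z / (s - Cmod z)))%R).
  { intros s Hs.
    assert (E : X = turn_mean (fun t => k (polar s t))).
    { apply (turn_mean_annulus k); [lra|]; intros w Hw; apply Hk; lra. }
    assert (Hck : forall t, continuous (fun t => k (polar s t)) t).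
    { intros t; apply circle_continuous, ex_derive_Ccontinuous, Hk; rewrite Cmod_polar; lra. }
    rewrite E, <- (turn_mean_const 1), <- turn_mean_minus; auto; [|intros; apply continuous_const].
    apply turn_mean_bound.
    - intros t; apply (circle_continuous (fun w => k w - 1)), continuous_Cminus;
        [apply ex_derive_Ccontinuous, Hk; rewrite Cmod_polar; lra | apply continuous_const].
    - intros t _; set (w := polar s t).
      assert (Hw : Cmod w = s) by (apply Cmod_polar; lra).
      assert (Hn : w - z <> 0) by (apply Cmod_lt_neq; lra).
      unfold k; replace (w * / (w - z) - 1) with (z * / (w - z)) by (field; auto).
      rewrite Cmod_mult, Cmod_inv by auto.
      apply Rmult_le_compat_l; auto; apply Rinv_le_contravar; [lra|].
      pose proof (Cmod_tri_inv w z); lra. }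
  assert (HX : (Cmod (X - 1) = 0)%R).
  { apply Rle_antisym; [|apply Cmod_ge_0].
    apply le_epsilon; intros e He; rewrite Rplus_0_l.
    eapply Rle_trans; [apply (Hs (r + Cmod z + 2 * Cmod z / e + 1)%R)|].
    - assert (0 <= 2 * Cmod z / e)%R by (apply Rdiv_le_0_compat; lra); lra.
    - assert (0 <= 2 * Cmod z / e)%R by (apply Rdiv_le_0_compat; lra).
      replace (2 * (Cmod z / (r + Cmod z + 2 * Cmod z / e + 1 - Cmod z)))%R
        with (2 * Cmod z / (r + 2 * Cmod z / e + 1))%R
        by (unfold Rdiv at 1 3; rewrite Rmult_assoc; do 3 f_equal; ring).
      apply Rle_div_l; [lra|].
      replace (2 * Cmod z)%R with (e * (2 * Cmod z / e))%R at 1 by (field; lra).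
      apply Rmult_le_compat_l; lra. }
  apply Cmod_eq_0 in HX; replace X with (X - 1 + 1) by ring; rewrite HX; ring.
Qed.

(** At [z] the difference quotient of [f] is only known to be continuous, so the
    mean value property is needed with the exceptional circle through [z]. *)
Lemma cauchy_formula (f : C -> C) (r : R) (z : C) :
  (forall w, (Cmod w <= r)%R -> continuous f w) ->
  (forall w : C, w <> 0 -> (Cmod w <= r)%R -> ex_derive f w) ->
  (Cmod z < r)%R ->
  f z = turn_mean (fun t => f (polar r t) * polar r t * / (polar r t - z)).
Proof.
  intros Hc Hd Hz; assert (Hr : (0 < r)%R) by (pose proof (Cmod_ge_0 z); lra).
  assert (Hw : forall t, Cmod (polar r t) = r) by (intros; apply Cmod_polar; lra).
  destruct (Ceq_dec z 0) as [->|Hz0].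
  { rewrite <- (turn_mean_center f r (-1)); auto.
    apply turn_mean_ext; intros t; field.
    replace (polar r t - 0) with (polar r t) by ring.
    apply Cmod_gt_0; rewrite Hw; auto. }
  destruct (Hd z Hz0) as [l Hl]; [lra|].
  apply is_derive_slope in Hl; destruct Hl as [p [Hp [_ E]]].
  assert (Ep : forall w, w <> z -> (f w - f z) / (w - z) = p w).
  { intros w Hwz; rewrite (E w); field; now apply Cminus_neq_0. }
  assert (Dp : forall w : C, w <> 0 -> w <> z -> (Cmod w <= r)%R -> ex_derive p w).
  { intros w Hw0 Hwz Hwr.
    apply (ex_derive_C_ext_loc (fun w => (f w - f z) / (w - z)) p w (Cmod (w - z))).
    - now apply Cmod_gt_0, Cminus_neq_0.
    - intros y Hy; apply Ep; intros ->; rewrite Cmod_minus_sym in Hy; lra.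
    - cderive; auto; now apply Cminus_neq_0. }
  (* [w * p w] is continuous, and holomorphic off [0] and [z] *)
  assert (M : turn_mean (fun t => polar r t * p (polar r t)) = 0).
  { rewrite (turn_mean_center (fun w => w * p w) r (Cmod z)); auto; [ring| |].
    - intros w Hwr; destruct (Ceq_dec w z) as [->|Hwz].
      + apply continuous_Cmult; auto; apply continuous_id.
      + apply (continuous_Cmod (fun w => w * p w)); intros e He.
        assert (Cq : continuous (fun w => w * ((f w - f z) / (w - z))) w).
        { apply continuous_Cmult; [apply continuous_id|].
          apply continuous_Cmult.
          - apply continuous_Cminus; [auto | apply continuous_const].
          - apply continuous_Cinv; [|now apply Cminus_neq_0].
            apply continuous_Cminus; [apply continuous_id | apply continuous_const]. }
        rewrite continuous_Cmod in Cq; destruct (Cq e He) as [d [Hd' Hy]].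
        exists (Rmin d (Cmod (w - z))); split.
        { apply Rmin_pos; auto; now apply Cmod_gt_0, Cminus_neq_0. }
        intros y Hyw; rewrite <- (Ep w), <- (Ep y); auto.
        * apply Hy; eapply Rlt_le_trans; [apply Hyw | apply Rmin_l].
        * intros ->; rewrite Cmod_minus_sym in Hyw.
          pose proof (Rmin_r d (Cmod (w - z))); lra.
    - intros w Hw0 Hwk Hwr; apply ex_derive_Cmult; [apply ex_derive_Cid|].
      apply Dp; auto; intros ->; auto. }
  assert (Hn : forall t, polar r t - z <> 0) by (intros t; apply Cmod_lt_neq; rewrite Hw; lra).
  rewrite (turn_mean_ext _ (fun t => polar r t * p (polar r t) +
    f z * (polar r t * / (polar r t - z)))).
  2: { intros t; rewrite <- Ep; [field; auto|].
       intros Ez; apply (Hn t); rewrite Ez; ring. }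
  assert (Ck : forall w, Cmod w = r -> continuous (fun w => w * / (w - z)) w).
  { intros w Hwr; apply ex_derive_Ccontinuous; cderive.
    apply Cmod_lt_neq; lra. }
  assert (C1 : forall t, continuous (fun t => polar r t * / (polar r t - z)) t).
  { intros t; apply (circle_continuous (fun w => w * / (w - z))), Ck, Hw. }
  rewrite turn_mean_plus.
  - rewrite turn_mean_scal, M, turn_mean_cauchy_kernel by auto; ring.
  - intros t; apply (circle_continuous (fun w => w * p w)), continuous_Cmult;
      [apply continuous_id|].
    apply ex_derive_Ccontinuous, Dp.
    + apply Cmod_gt_0; rewrite Hw; lra.
    + intros Ez; apply (Hn t); rewrite Ez; ring.
    + rewrite Hw; lra.
  - intros t; apply (circle_continuous (fun w => f z * (w * / (w - z)))), continuous_Cmult;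
      [apply continuous_const | apply Ck, Hw].
Qed.

(** The right-hand side of Cauchy's formula is twice differentiable also at the
    exceptional point. *)
Lemma removable_at_center (f : C -> C) (r : R) :
  (forall w, (Cmod w <= r)%R -> continuous f w) ->
  (forall w : C, w <> 0 -> (Cmod w <= r)%R -> ex_derive f w) ->
  forall z, (Cmod z < r)%R -> ex_derive f z /\ ex_derive (C_derive f) z.
Proof.
  intros Hc Hd.
  set (T := fun z => turn_mean (fun t =>
    (f (polar r t) * polar r t) * (/ (polar r t - z) * / (polar r t - z)))).
  assert (H : forall z, (Cmod z < r)%R -> is_derive f z (T z) /\ ex_derive T z).
  { intros z Hz.
    destruct (cauchy_transform_is_derive (fun w => f w * w) r z) as [H1 H2]; auto.
    { intros w Hw; apply continuous_Cmult; [apply Hc; lra | apply continuous_id]. }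
    split; auto.
    eapply is_derive_C_ext_loc; [|intros y Hy; symmetry; apply cauchy_formula; eauto|exact H1].
    - instantiate (1 := (r - Cmod z)%R); lra.
    - pose proof (Cmod_tri_inv y (y - z)) as T1.
      replace (y - (y - z)) with z in T1 by ring; lra. }
  intros z Hz; destruct (H z Hz) as [H1 H2]; split; [eexists; eauto|].
  apply (ex_derive_C_ext_loc T (C_derive f) z (r - Cmod z)); auto; [lra|].
  intros y Hy; symmetry; apply is_C_derive_unique, H.
  pose proof (Cmod_tri_inv y (y - z)) as T1.
  replace (y - (y - z)) with z in T1 by ring; lra.
Qed.

Lemma ex_derive_translate (f : C -> C) (a z : C) :
  ex_derive f (a + z) -> ex_derive (fun y => f (a + y)) z.
Proof.
  intros H; apply (ex_derive_Ccomp f (fun y => a + y)); auto; cderive.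
Qed.

Lemma ex_derive_translate_inv (f : C -> C) (a z : C) :
  ex_derive (fun y => f (a + y)) (z - a) -> ex_derive f z.
Proof.
  intros H.
  apply (ex_derive_C_ext_loc (fun y => f (a + (y - a))) f z 1); [lra| |].
  - intros y _; f_equal; ring.
  - apply (ex_derive_Ccomp (fun y => f (a + y)) (fun y => y - a)); auto; cderive.
Qed.

(** Riemann's theorem for a continuous singularity. *)
Lemma removable (f : C -> C) (a : C) (r : R) :
  (0 < r)%R -> continuous f a ->
  (forall w, w <> a -> (Cmod (w - a) <= r)%R -> ex_derive f w) -> ex_derive f a.
Proof.
  intros Hr Ha Hd; apply (ex_derive_translate_inv f a).
  replace (a - a) with (RtoC 0) by ring.
  assert (Hd' : forall w : C, w <> 0 -> (Cmod w <= r)%R -> ex_derive (fun y => f (a + y)) w).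
  { intros w Hw Hwr; apply ex_derive_translate, Hd.
    - intros E; apply Hw; replace w with (a + w - a) by ring; rewrite E; ring.
    - replace (a + w - a) with w by ring; auto. }
  refine (proj1 (removable_at_center (fun y => f (a + y)) r _ Hd' 0 _));
    [|rewrite Cmod_0; exact Hr].
  intros w Hw; destruct (Ceq_dec w 0) as [->|Hw0].
  - apply (continuous_comp (fun y => a + y) f).
    + apply continuous_Cplus; [apply continuous_const | apply continuous_id].
    + replace (a + 0) with a by ring; auto.
  - apply ex_derive_Ccontinuous; auto.
Qed.

Lemma derive_holomorphic (f : C -> C) (a : C) (r : R) :
  (0 < r)%R -> (forall w, (Cmod (w - a) < r)%R -> ex_derive f w) ->
  ex_derive (C_derive f) a.
Proof.
  intros Hr Hd; apply (ex_derive_translate_inv (C_derive f) a).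
  replace (a - a) with (RtoC 0) by ring.
  assert (Hd' : forall w, (Cmod w < r)%R -> is_derive (fun y => f (a + y)) w (C_derive f (a + w))).
  { intros w Hwr; replace (C_derive f (a + w)) with (C_derive f (a + w) * (0 + 1)) by ring.
    apply (is_derive_Ccomp f (fun y => a + y)).
    - apply is_derive_C_derive, Hd; replace (a + w - a) with w by ring; auto.
    - apply is_derive_Cplus; [apply is_derive_Cconst | apply is_derive_Cid]. }
  apply (ex_derive_C_ext_loc (C_derive (fun y => f (a + y))) _ _ r); auto.
  - intros y Hy; apply is_C_derive_unique, Hd'.
    replace (y - 0) with y in Hy by ring; auto.
  - refine (proj2 (removable_at_center (fun y => f (a + y)) (r / 2) _ _ 0 _)).
    + intros w Hw; apply ex_derive_Ccontinuous; eexists; apply Hd'; lra.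
    + intros w _ Hw; eexists; apply Hd'; lra.
    + rewrite Cmod_0; lra.
Qed.

(** The difference quotient is continuous at [a], where its singularity is
    therefore removable. *)
Lemma holomorphic_quotient (f : C -> C) (r : R) (a : C) :
  (forall z, (Cmod z < r)%R -> ex_derive f z) -> (Cmod a < r)%R ->
  exists q : C -> C, (forall z, (Cmod z < r)%R -> ex_derive q z) /\
    q a = C_derive f a /\ forall z, f z = f a + q z * (z - a).
Proof.
  intros Hf Ha; pose proof (is_derive_C_derive f a (Hf a Ha)) as Hl.
  apply is_derive_slope in Hl; destruct Hl as [q [Hq [Ea E]]].
  exists q; split; auto.
  assert (Hoff : forall z, z <> a -> (Cmod z < r)%R -> ex_derive q z).
  { intros z Hza Hz.
    apply (ex_derive_C_ext_loc (fun w => (f w - f a) / (w - a)) q z (Cmod (z - a))).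
    - now apply Cmod_gt_0, Cminus_neq_0.
    - intros y Hy; rewrite (E y); field; apply Cminus_neq_0.
      intros ->; rewrite Cmod_minus_sym in Hy; lra.
    - cderive; auto; now apply Cminus_neq_0. }
  intros z Hz; destruct (Ceq_dec z a) as [->|Hza]; auto.
  apply removable with ((r - Cmod a) / 2)%R; auto; [lra|].
  intros w Hw Hwr; apply Hoff; auto.
  pose proof (Cmod_tri_inv w (w - a)) as T.
  pose proof (Cmod_triangle a (w - a)) as T2; replace (a + (w - a)) with w in T2 by ring; lra.
Qed.

(** * The maximum principle and the Schwarz lemma *)

Definition moebius (a u : C) : C := (u + a) / (1 + Cconj a * u).

Lemma Cmod_sqr (z : C) : (Cmod z * Cmod z = Re z * Re z + Im z * Im z)%R.
Proof. pose proof (Cmod2_alt z) as H; simpl in H; lra. Qed.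

(** The reason why [moebius a] preserves the disc and its boundary. *)
Lemma moebius_defect (a u : C) :
  (Cmod (1 + Cconj a * u) * Cmod (1 + Cconj a * u) - Cmod (u + a) * Cmod (u + a) =
   (1 - Cmod a * Cmod a) * (1 - Cmod u * Cmod u))%R.
Proof. rewrite !Cmod_sqr; destruct a, u; simpl; ring. Qed.

Lemma moebius_denominator (a u : C) :
  (Cmod a < 1)%R -> (Cmod u <= 1)%R -> 1 + Cconj a * u <> 0.
Proof.
  intros Ha Hu E.
  assert (E' : Cconj a * u = - (1)).
  { replace (Cconj a * u) with (1 + Cconj a * u - 1) by ring; rewrite E; ring. }
  assert (E2 : Cmod (Cconj a * u) = 1%R) by (rewrite E', Cmod_opp; apply Cmod_1).
  rewrite Cmod_mult, Cmod_conj in E2.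
  pose proof (Cmod_ge_0 a); pose proof (Cmod_ge_0 u); nra.
Qed.

Lemma Cmod_moebius (a u : C) :
  (Cmod a < 1)%R -> (Cmod u <= 1)%R ->
  (Cmod (moebius a u) <= 1 /\ (Cmod u < 1 -> Cmod (moebius a u) < 1) /\
   (Cmod u = 1 -> Cmod (moebius a u) = 1))%R.
Proof.
  intros Ha Hu; pose proof (moebius_denominator a u Ha Hu) as Hn.
  pose proof (moebius_defect a u) as E.
  unfold moebius; rewrite Cmod_div by auto.
  apply Cmod_gt_0 in Hn.
  pose proof (Cmod_ge_0 a); pose proof (Cmod_ge_0 u); pose proof (Cmod_ge_0 (u + a)).
  set (N := Cmod (u + a)) in *; set (D := Cmod (1 + Cconj a * u)) in *.
  assert (0 < 1 - Cmod a * Cmod a)%R by nra.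
  split; [|split].
  - apply Rle_div_l; auto; assert (0 <= 1 - Cmod u * Cmod u)%R by nra; nra.
  - intros Hu'; apply Rlt_div_l; auto; assert (0 < 1 - Cmod u * Cmod u)%R by nra; nra.
  - intros Hu'; rewrite Hu' in E; replace N with D by nra; field; lra.
Qed.

Lemma ex_derive_moebius (a u : C) :
  (Cmod a < 1)%R -> (Cmod u <= 1)%R -> ex_derive (moebius a) u.
Proof.
  intros Ha Hu; unfold moebius; cderive; now apply moebius_denominator.
Qed.

Lemma moebius_center (a : C) : moebius a 0 = a.
Proof. unfold moebius; replace (1 + Cconj a * 0) with (RtoC 1) by ring; field. Qed.

Lemma moebius_inverse (a z : C) :
  (Cmod a < 1)%R -> (Cmod z <= 1)%R -> moebius a (moebius (- a) z) = z.
Proof.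
  intros Ha Hz; assert (Ha' : (Cmod (- a) < 1)%R) by now rewrite Cmod_opp.
  assert (H1 := moebius_denominator (- a) z Ha' Hz).
  assert (H2 := moebius_denominator a (moebius (- a) z) Ha (proj1 (Cmod_moebius (- a) z Ha' Hz))).
  assert (E : Cconj (- a) = - Cconj a) by (destruct a; reflexivity).
  rewrite E in H1.
  unfold moebius in H2 |- *; rewrite E in H2 |- *.
  assert (H3 : (1 + - Cconj a * z) + Cconj a * (z + - a) <> 0).
  { intros E3; apply H2.
    replace (1 + Cconj a * ((z + - a) / (1 + - Cconj a * z)))
      with (((1 + - Cconj a * z) + Cconj a * (z + - a)) / (1 + - Cconj a * z)) by (field; auto).
    rewrite E3; field; auto. }
  field; split; auto.
Qed.

(** The point [t = 0] of the circle is excluded so that the bound may be checked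
    where the integrand is given by a quotient singular at [polar r 0]. *)
Lemma center_re_le (f : C -> C) (r m : R) :
  (0 < r)%R -> (forall z, (Cmod z <= r)%R -> ex_derive f z) ->
  (forall t, 0 < t < 2 * PI -> Re (f (polar r t)) <= m)%R -> (Re (f 0) <= m)%R.
Proof.
  intros Hr Hf Hm; assert (HPI := PI_RGT_0).
  assert (Hc : forall z, (Cmod z <= r)%R -> continuous f z)
    by (intros; apply ex_derive_Ccontinuous; auto).
  assert (E := circle_integral_center f r (-1) Hr Hc (fun z _ _ Hz => Hf z Hz)).
  assert (L : (RInt (fun t => Re (f (polar r t))) 0 (2 * PI) <= RInt (fun _ => m) 0 (2 * PI))%R).
  { apply RInt_le; [lra| | |exact Hm].
    - apply Re_integrable; intros t; apply circle_continuous, Hc; rewrite Cmod_polar; lra.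
    - apply (ex_RInt_const (V := R_NormedModule)). }
  rewrite (RInt_const (V := R_CompleteNormedModule)) in L.
  unfold scal in L; simpl in L; unfold mult in L; simpl in L; nra.
Qed.

(** A disc automorphism carries the mean value inequality from the centre to
    any other point. *)
Lemma maximum_re (f : C -> C) (r m : R) :
  (0 < r)%R -> (forall z, (Cmod z <= r)%R -> ex_derive f z) ->
  (forall z, Cmod z = r -> Re (f z) <= m)%R ->
  forall z, (Cmod z <= r)%R -> (Re (f z) <= m)%R.
Proof.
  intros Hr Hf Hm z Hz.
  destruct (Req_dec (Cmod z) r) as [E|E]; [auto|].
  assert (Hr0 : RtoC r <> 0) by (intros E0; apply RtoC_inj in E0; lra).
  assert (HrC : Cmod r = r) by (rewrite Cmod_R, Rabs_pos_eq; lra).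
  set (a := z / r).
  assert (Ha : (Cmod a < 1)%R).
  { unfold a; rewrite Cmod_div, HrC by auto; apply Rlt_div_l; lra. }
  assert (Hmod : forall u, Cmod (r * moebius a u) = (r * Cmod (moebius a u))%R)
    by (intros; rewrite Cmod_mult, HrC; auto).
  replace (f z) with (f (r * moebius a 0)).
  2: { f_equal; rewrite moebius_center; unfold a; field; auto. }
  apply (center_re_le (fun u => f (r * moebius a u)) 1); [lra| |].
  - intros u Hu; pose proof (proj1 (Cmod_moebius a u Ha Hu)).
    apply (ex_derive_Ccomp f (fun u => r * moebius a u)).
    + apply Hf; rewrite Hmod; nra.
    + apply ex_derive_Cmult; [apply ex_derive_Cconst | now apply ex_derive_moebius].
  - intros t _; apply Hm; rewrite Hmod.
    assert (Hp : Cmod (polar 1 t) = 1%R) by (apply Cmod_polar; lra).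
    rewrite (proj2 (proj2 (Cmod_moebius a (polar 1 t) Ha ltac:(lra))) Hp); ring.
Qed.

Lemma exists_rotation (w : C) : exists c : C, Cmod c = 1%R /\ Re (c * w) = Cmod w.
Proof.
  destruct (Ceq_dec w 0) as [->|Hw].
  - exists 1; split; [apply Cmod_1|]; rewrite Cmod_0, Cmult_0_r; reflexivity.
  - assert (Hm : (0 < Cmod w)%R) by now apply Cmod_gt_0.
    assert (Hm0 : RtoC (Cmod w) <> 0) by (intros E0; apply RtoC_inj in E0; lra).
    exists (Cconj w / Cmod w); split.
    + rewrite Cmod_div, Cmod_conj, Cmod_R, Rabs_pos_eq by (auto; lra); field; lra.
    + replace (Cconj w / Cmod w * w) with (RtoC (Cmod w)); [reflexivity|].
      pose proof (Cmod2_conj w) as E.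
      replace (Cconj w / Cmod w * w) with (w * Cconj w / Cmod w) by (field; auto).
      rewrite <- E, RtoC_pow; field; auto.
Qed.

Lemma maximum_modulus (f : C -> C) (r M : R) :
  (0 < r)%R -> (forall z, (Cmod z <= r)%R -> ex_derive f z) ->
  (forall z, Cmod z = r -> Cmod (f z) <= M)%R ->
  forall z, (Cmod z <= r)%R -> (Cmod (f z) <= M)%R.
Proof.
  intros Hr Hf HM z Hz; destruct (exists_rotation (f z)) as [c [Hc <-]].
  apply (maximum_re (fun z => c * f z) r); auto.
  - intros y Hy; apply ex_derive_Cmult; [apply ex_derive_Cconst | auto].
  - intros y Hy; eapply Rle_trans; [apply Re_le_Cmod|].
    rewrite Cmod_mult, Hc, Rmult_1_l; auto.
Qed.

(** On the circle of radius [k < 1] division by [z] costs a factor [1 / k], which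
    tends to 1. *)
Lemma maximum_modulus_quotient (q : C -> C) (M : R) :
  (forall z, (Cmod z < 1)%R -> ex_derive q z) ->
  (forall z, (Cmod z < 1)%R -> Cmod (q z * z) <= M)%R ->
  forall z, (Cmod z < 1)%R -> (Cmod (q z) <= M)%R.
Proof.
  intros Hq HM z Hz; pose proof (Cmod_ge_0 z) as Hz0.
  assert (HM0 : (0 <= M)%R) by (eapply Rle_trans; [apply Cmod_ge_0 | apply (HM z Hz)]).
  assert (Hk : forall k, (Cmod z < k < 1)%R -> (Cmod (q z) * k <= M)%R).
  { intros k Hk; apply Rle_div_r; [lra|].
    apply (maximum_modulus q k); try lra; [intros; apply Hq; lra|].
    intros y Hy; apply Rle_div_r; [lra|]; rewrite <- Hy, <- Cmod_mult; apply HM; lra. }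
  (* let [k] tend to 1 *)
  apply Rnot_lt_le; intros Hlt.
  set (k := Rmax ((1 + Cmod z) / 2) ((M + Cmod (q z)) / 2 / Cmod (q z))).
  assert (k1 : (Cmod z < k)%R).
  { eapply Rlt_le_trans; [|apply Rmax_l]; lra. }
  assert (k2 : (k < 1)%R).
  { apply Rmax_lub_lt; [lra|]; apply Rlt_div_l; lra. }
  specialize (Hk k (conj k1 k2)).
  assert (k3 : ((M + Cmod (q z)) / 2 / Cmod (q z) <= k)%R) by apply Rmax_r.
  apply Rle_div_l in k3; lra.
Qed.

Lemma schwarz (f : C -> C) :
  (forall z, (Cmod z < 1)%R -> ex_derive f z) -> f 0 = 0 ->
  (forall z, (Cmod z < 1)%R -> Cmod (f z) <= 1)%R ->
  forall z, (Cmod z < 1)%R -> (Cmod (f z) <= Cmod z)%R.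
Proof.
  intros Hf H0 H1 z Hz.
  destruct (holomorphic_quotient f 1 0 Hf) as [q [Hq [_ E]]]; [rewrite Cmod_0; lra|].
  assert (E' : forall y, f y = q y * y) by (intros y; rewrite (E y), H0; ring).
  rewrite (E' z), Cmod_mult.
  rewrite <- (Rmult_1_l (Cmod z)) at 2; apply Rmult_le_compat_r; [apply Cmod_ge_0|].
  apply maximum_modulus_quotient; auto.
  intros y Hy; rewrite <- E'; auto.
Qed.

(** The Schwarz lemma applied to the Cayley transforms [u / (u + 2 e)], as [e]
    tends to 0. *)
Lemma re_nonneg_rigid (u : C -> C) :
  (forall z, (Cmod z < 1)%R -> ex_derive u z) -> u 0 = 0 ->
  (forall z, (Cmod z < 1)%R -> 0 <= Re (u z))%R ->
  forall z, (Cmod z < 1)%R -> u z = 0.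
Proof.
  intros Hu H0 Hre z Hz; apply Cmod_eq_0, Rle_antisym; [|apply Cmod_ge_0].
  pose proof (Cmod_ge_0 z) as Hz0.
  assert (He : forall e, (0 < e)%R -> (Cmod (u z) * (1 - Cmod z) <= 2 * e)%R).
  { intros e He.
    assert (Hsq : forall y, (Cmod y < 1)%R ->
      (Cmod (u y) <= Cmod (u y + RtoC (2 * e)) /\ 0 < Cmod (u y + RtoC (2 * e)))%R).
    { intros y Hy; specialize (Hre y Hy).
      pose proof (Cmod_sqr (u y)) as E1; pose proof (Cmod_sqr (u y + RtoC (2 * e))) as E2.
      rewrite Re_plus, Im_plus in E2; simpl in E2.
      pose proof (Cmod_ge_0 (u y)); pose proof (Cmod_ge_0 (u y + RtoC (2 * e))).
      assert (H3 : (Re (u y) * Re (u y) + Im (u y) * Im (u y) + 4 * e * e <=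
        Cmod (u y + RtoC (2 * e)) * Cmod (u y + RtoC (2 * e)))%R) by (unfold Re, Im in *; nra).
      split; nra. }
    assert (Hn : forall y, (Cmod y < 1)%R -> u y + RtoC (2 * e) <> 0)
      by (intros y Hy; apply Cmod_gt_0, Hsq, Hy).
    assert (S := schwarz (fun y => u y / (u y + RtoC (2 * e)))).
    specialize (S ltac:(intros y Hy; cderive; auto)).
    specialize (S ltac:(cbv beta; rewrite H0; unfold Cdiv; ring)).
    specialize (S ltac:(intros y Hy; cbv beta; rewrite Cmod_div by auto; apply Rle_div_l;
      [apply Hsq, Hy | rewrite Rmult_1_l; apply Hsq, Hy]) z Hz).
    simpl in S; rewrite Cmod_div in S by auto; apply Rle_div_l in S; [|apply Hsq, Hz].
    pose proof (Cmod_triangle (u z) (RtoC (2 * e))) as T.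
    rewrite Cmod_R, Rabs_pos_eq in T by lra; nra. }
  apply Rnot_lt_le; intros Hlt.
  specialize (He (Cmod (u z) * (1 - Cmod z) / 4)%R).
  assert (0 < Cmod (u z) * (1 - Cmod z))%R by (apply Rmult_lt_0_compat; lra).
  lra.
Qed.

(** [moebius a] moves [a] to the centre, where [re_nonneg_rigid] applies to
    [1 - f]. *)
Lemma strong_maximum (f : C -> C) (a : C) :
  (forall z, (Cmod z < 1)%R -> ex_derive f z) ->
  (forall z, (Cmod z < 1)%R -> Re (f z) <= 1)%R -> (Cmod a < 1)%R -> f a = 1 ->
  forall z, (Cmod z < 1)%R -> f z = 1.
Proof.
  intros Hf Hre Ha Hfa z Hz.
  assert (Ha' : (Cmod (- a) < 1)%R) by now rewrite Cmod_opp.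
  rewrite <- (moebius_inverse a z) by lra.
  set (u := moebius (- a) z).
  assert (Hu : (Cmod u < 1)%R) by (apply Cmod_moebius; auto; lra).
  enough (E : 1 - f (moebius a u) = 0).
  { replace (f (moebius a u)) with (1 - (1 - f (moebius a u))) by ring; rewrite E; ring. }
  apply (re_nonneg_rigid (fun u => 1 - f (moebius a u))); auto.
  - intros y Hy; apply ex_derive_Cminus; [apply ex_derive_Cconst|].
    apply (ex_derive_Ccomp f (moebius a)).
    + apply Hf; apply Cmod_moebius; auto; lra.
    + apply ex_derive_moebius; auto; lra.
  - rewrite moebius_center, Hfa; ring.
  - intros y Hy; rewrite Re_minus; change (Re 1) with 1%R.
    assert (Re (f (moebius a y)) <= 1)%R by (apply Hre, Cmod_moebius; auto; lra); lra.
Qed.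

(** * Injective holomorphic functions *)

(** If [w] were omitted on the disc, the maximum principle for [1 / (f - w)]
    would bound the distance from [w] to [f a] from below. *)
Lemma open_mapping (f : C -> C) (a w : C) (r d : R) :
  (0 < r)%R -> (0 < d)%R ->
  (forall z, (Cmod (z - a) <= r)%R -> ex_derive f z) ->
  (forall z, Cmod (z - a) = r -> (d <= Cmod (f z - f a))%R) ->
  (Cmod (w - f a) < d / 2)%R ->
  exists z, (Cmod (z - a) < r)%R /\ f z = w.
Proof.
  intros Hr Hd Hf Hcirc Hw; apply NNPP; intros Hno.
  assert (Hfar : forall u, Cmod u = r -> (d / 2 <= Cmod (f (a + u)%C - w))%R).
  { intros u Hu; assert (A := Hcirc (a + u)).
    replace (a + u - a) with u in A by ring; specialize (A Hu).
    pose proof (Cmod_tri3 (f (a + u)) w (f a)); lra. }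
  assert (Hn : forall u, (Cmod u <= r)%R -> f (a + u) - w <> 0).
  { intros u Hu; destruct (Req_dec (Cmod u) r) as [E|E].
    - apply Cmod_gt_0; specialize (Hfar u E); lra.
    - apply Cminus_neq_0; intros E2; apply Hno; exists (a + u); split; auto.
      replace (a + u - a) with u by ring; lra. }
  assert (M := maximum_modulus (fun u => / (f (a + u) - w)) r (/ (d / 2)) Hr).
  assert (M0 := M ltac:(intros u Hu; cderive;
    [apply ex_derive_translate, Hf; replace (a + u - a) with u by ring; auto | auto])
    ltac:(intros u Hu; cbv beta; rewrite Cmod_inv by (apply Hn; lra);
      apply Rinv_le_contravar; [lra | auto]) 0 ltac:(rewrite Cmod_0; lra)).
  simpl in M0; rewrite Cmod_inv in M0 by (apply Hn; rewrite Cmod_0; lra).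
  replace (a + 0) with a in M0 by ring.
  rewrite Cmod_minus_sym in Hw.
  assert (P : (0 < Cmod (f a - w))%R).
  { apply Cmod_gt_0; replace a with (a + 0) by ring; apply Hn; rewrite Cmod_0; lra. }
  apply Rinv_lt_contravar in Hw; [lra|].
  apply Rmult_lt_0_compat; lra.
Qed.

(** A holomorphic function with a zero of infinite order is bounded by
    [M (2 |z| / r) ^ n] for every [n]. *)
Lemma zero_isolated (f : C -> C) (r : R) :
  (0 < r)%R -> (forall z, (Cmod z < r)%R -> ex_derive f z) ->
  (exists d, (0 < d)%R /\ forall z : C, z <> 0 -> (Cmod z < d)%R -> f z <> 0) \/
  (forall z, (Cmod z < r / 2)%R -> f z = 0).
Proof.
  intros Hr Hf.
  destruct (classic (exists d, (0 < d)%R /\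
    forall z : C, z <> 0 -> (Cmod z < d)%R -> f z <> 0)) as [H|H]; [now left|right].
  assert (Hpow : forall n, exists q : C -> C,
    (forall z, (Cmod z < r)%R -> ex_derive q z) /\ forall z, f z = q z * z ^ n).
  { induction n as [|n [q [Hq E]]].
    - exists f; split; auto; intros z; simpl; ring.
    - destruct (holomorphic_quotient q r 0 Hq) as [s [Hs [_ Es]]]; [rewrite Cmod_0; lra|].
      destruct (Ceq_dec (q 0) 0) as [H0|H0].
      + exists s; split; auto; intros z; rewrite (E z), (Es z), H0; simpl; ring.
      + exfalso; apply H.
        assert (Cq := ex_derive_Ccontinuous q 0 (Hq 0 ltac:(rewrite Cmod_0; lra))).
        rewrite continuous_Cmod in Cq; destruct (Cq (Cmod (q 0))) as [d [Hd Hqd]].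
        { now apply Cmod_gt_0. }
        exists d; split; auto; intros z Hz Hzd.
        rewrite (E z); apply Cmult_neq_0; [|now apply Cpow_nz].
        intros E0; specialize (Hqd z); rewrite E0 in Hqd.
        replace (z - 0) with z in Hqd by ring; specialize (Hqd Hzd).
        replace (0 - q 0) with (- q 0) in Hqd by ring; rewrite Cmod_opp in Hqd; lra. }
  destruct (circle_bounded f (r / 2)) as [M [HM HMb]]; [lra| |].
  { intros w Hw; apply ex_derive_Ccontinuous, Hf; lra. }
  intros z Hz; apply Cmod_eq_0, Rle_antisym; [|apply Cmod_ge_0].
  pose proof (Cmod_ge_0 z) as Hz0.
  set (x := (Cmod z / (r / 2))%R).
  assert (Hx : (0 <= x < 1)%R).
  { unfold x; split; [apply Rdiv_le_0_compat; lra | apply Rlt_div_l; lra]. }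
  assert (Hbound : forall n, (Cmod (f z) <= M * x ^ n)%R).
  { intros n; destruct (Hpow n) as [q [Hq E]].
    assert (Hk : (0 < (r / 2) ^ n)%R) by (apply pow_lt; lra).
    assert (Hqz : (Cmod (q z) <= M / (r / 2) ^ n)%R).
    { apply (maximum_modulus q (r / 2)); try lra; [intros; apply Hq; lra|].
      intros y Hy; apply Rle_div_r; auto; rewrite <- Hy, <- Cmod_pow, <- Cmod_mult, <- E; auto. }
    rewrite (E z), Cmod_mult, Cmod_pow; unfold x, Rdiv.
    rewrite Rpow_mult_distr, pow_inv.
    replace (M * (Cmod z ^ n * / (r * / 2) ^ n))%R
      with (M / (r / 2) ^ n * Cmod z ^ n)%R by (unfold Rdiv; ring).
    apply Rmult_le_compat_r; auto; apply pow_le; auto. }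
  apply le_epsilon; intros e He; rewrite Rplus_0_l.
  destruct (pow_lt_1_zero x) with (y := (e / M)%R) as [n Hn].
  - rewrite Rabs_pos_eq; lra.
  - now apply Rdiv_lt_0_compat.
  - specialize (Hn n (le_n n)); rewrite Rabs_pos_eq in Hn by (apply pow_le; lra).
    apply Rlt_div_r in Hn; auto; specialize (Hbound n); lra.
Qed.

Lemma segment_mean_value (f f' : C -> C) (a u : C) :
  (forall t, (0 <= t <= 1)%R -> is_derive f (a + RtoC t * u) (f' (a + RtoC t * u))) ->
  exists t, (0 <= t <= 1)%R /\
    Re (f (a + u) - f a) = Re (f' (a + RtoC t * u) * u).
Proof.
  intros Hf.
  assert (Hd : forall t, (0 <= t <= 1)%R ->
    is_derive (fun t : R => Re (f (a + RtoC t * u))) t (Re (f' (a + RtoC t * u) * u))).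
  { intros t Ht; specialize (Hf t Ht); rewrite is_derive_Cmod in Hf.
    apply is_derive_Reals; intros e He.
    destruct (Hf (e / (2 * (Cmod u + 1)))%R) as [d [Hd Hy]].
    { apply Rdiv_lt_0_compat; auto; pose proof (Cmod_ge_0 u); lra. }
    assert (Hd' : (0 < d / (Cmod u + 1))%R).
    { apply Rdiv_lt_0_compat; auto; pose proof (Cmod_ge_0 u); lra. }
    exists (mkposreal _ Hd'); simpl; intros h Hh Hhd.
    apply Rlt_div_r in Hhd; [|pose proof (Cmod_ge_0 u); lra].
    assert (Hm : forall x : R, Cmod (RtoC x * u) = (Rabs x * Cmod u)%R)
      by (intros; rewrite Cmod_mult, Cmod_R; auto).
    set (y := a + RtoC (t + h) * u); set (z := a + RtoC t * u) in *.
    assert (Eyz : y - z = RtoC h * u) by (unfold y, z; rewrite RtoC_plus; ring).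
    specialize (Hy y); rewrite Eyz, Hm in Hy.
    pose proof (Cmod_ge_0 u) as Hu; pose proof (Rabs_pos_lt h Hh) as Hh0.
    specialize (Hy ltac:(nra)).
    change (Rabs ((Re (f y) - Re (f z)) / h - Re (f' z * u)) < e)%R.
    replace ((Re (f y) - Re (f z)) / h - Re (f' z * u))%R
      with (Re (f y - f z - f' z * (RtoC h * u)) / h)%R.
    2: { rewrite !Re_minus.
         replace (f' z * (RtoC h * u)) with (RtoC h * (f' z * u)) by ring.
         rewrite (Re_mult (RtoC h)); simpl; field; auto. }
    unfold Rdiv; rewrite Rabs_mult, Rabs_inv; apply Rlt_div_l; auto.
    eapply Rle_lt_trans; [apply re_le_Cmod|].
    eapply Rle_lt_trans; [apply Hy|].
    replace (e / (2 * (Cmod u + 1)) * (Rabs h * Cmod u))%R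
      with (e * Rabs h * (Cmod u / (2 * (Cmod u + 1))))%R by (field; lra).
    rewrite <- (Rmult_1_r (e * Rabs h)) at 2.
    apply Rmult_lt_compat_l; [nra|]; apply Rlt_div_l; lra. }
  destruct (MVT_gen (fun t : R => Re (f (a + RtoC t * u))) 0 1
    (fun t => Re (f' (a + RtoC t * u) * u))) as [t [Ht E]].
  - rewrite Rmin_left, Rmax_right by lra; intros t Ht; apply Hd; lra.
  - rewrite Rmin_left, Rmax_right by lra; intros t Ht.
    apply continuity_pt_filterlim, (ex_derive_continuous (V := R_NormedModule)).
    eexists; apply Hd; lra.
  - rewrite Rmin_left, Rmax_right in Ht by lra.
    exists t; split; auto; rewrite Re_minus.
    replace (a + RtoC 1 * u) with (a + u) in E by ring.
    replace (a + RtoC 0 * u) with a in E by ring; lra.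
Qed.

Lemma segment_increment_le (f f' : C -> C) (a u : C) (M : R) :
  (forall t, (0 <= t <= 1)%R -> is_derive f (a + RtoC t * u) (f' (a + RtoC t * u))) ->
  (forall t, (0 <= t <= 1)%R -> Cmod (f' (a + RtoC t * u)%C) <= M)%R ->
  (Cmod (f (a + u)%C - f a) <= M * Cmod u)%R.
Proof.
  intros Hf HM; destruct (exists_rotation (f (a + u) - f a)) as [c [Hc <-]].
  destruct (segment_mean_value (fun z => c * f z) (fun z => c * f' z) a u) as [t [Ht E]].
  { intros t Ht.
    replace (c * f' (a + RtoC t * u)) with (0 * f (a + RtoC t * u) + c * f' (a + RtoC t * u)) by ring.
    apply (is_derive_Cmult (fun _ => c) f); [apply is_derive_Cconst | auto]. }
  replace (c * (f (a + u) - f a)) with (c * f (a + u) - c * f a) by ring.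
  rewrite E; eapply Rle_trans; [apply Re_le_Cmod|].
  rewrite !Cmod_mult, Hc, Rmult_1_l.
  apply Rmult_le_compat_r; [apply Cmod_ge_0 | auto].
Qed.

Section InjectiveInverse.

Variables (f g : C -> C).
Hypothesis Hf : forall z, (Cmod z < 1)%R -> ex_derive f z.
Hypothesis Hg : forall z, (Cmod z < 1)%R -> g (f z) = z.

Lemma disc_neighbourhood (a z : C) :
  (Cmod (z - a) < 1 - Cmod a)%R -> (Cmod z < 1)%R.
Proof.
  intros H; pose proof (Cmod_triangle a (z - a)) as T.
  replace (a + (z - a)) with z in T by ring; lra.
Qed.

(** Injectivity keeps [f] away from [f a] on small circles around [a], which is
    what [open_mapping] requires. *)
Lemma injective_open (a : C) (e : R) :
  (Cmod a < 1)%R -> (0 < e)%R ->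
  exists d, (0 < d)%R /\ forall w, (Cmod (w - f a) < d)%R ->
    exists z, (Cmod (z - a) < e)%R /\ (Cmod z < 1)%R /\ f z = w.
Proof.
  intros Ha He.
  set (r := Rmin e ((1 - Cmod a) / 2)).
  assert (Hr : (0 < r)%R) by (apply Rmin_pos; lra).
  assert (Hr1 : (r <= e)%R) by apply Rmin_l.
  assert (Hr2 : (r <= (1 - Cmod a) / 2)%R) by apply Rmin_r.
  assert (Hin : forall z, (Cmod (z - a) <= r)%R -> (Cmod z < 1)%R).
  { intros z Hz; apply (disc_neighbourhood a); lra. }
  assert (Hshift : forall u, a + u - a = u) by (intros; ring).
  destruct (circle_away_from_zero (fun u => f (a + u) - f a) r) as [d [Hd Hdz]]; [lra| | |].
  - intros u Hu; apply ex_derive_Ccontinuous; cderive.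
    apply ex_derive_translate, Hf, Hin; rewrite Hshift; lra.
  - intros u Hu; apply Cminus_neq_0; intros E.
    assert (E2 : a + u = a).
    { rewrite <- (Hg (a + u)) by (apply Hin; rewrite Hshift; lra).
      rewrite E; auto. }
    rewrite <- (Hshift u), E2 in Hu.
    replace (a - a) with (RtoC 0) in Hu by ring; rewrite Cmod_0 in Hu; lra.
  - exists (d / 2)%R; split; [lra|]; intros w Hw.
    destruct (open_mapping f a w r d) as [z [Hz Ez]]; auto.
    + intros z Hz; apply Hdz in Hz; replace (a + (z - a)) with z in Hz by ring; auto.
    + exists z; split; [lra|]; split; auto; apply Hin; lra.
Qed.

Lemma inverse_continuous (a : C) : (Cmod a < 1)%R -> continuous g (f a).
Proof.
  intros Ha; apply continuous_Cmod; intros e He.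
  destruct (injective_open a e Ha He) as [d [Hd H]].
  exists d; split; auto; intros w Hw; destruct (H w Hw) as [z [Hz [Hz1 <-]]].
  rewrite !Hg; auto.
Qed.

Lemma inverse_is_derive (a : C) :
  (Cmod a < 1)%R -> C_derive f a <> 0 -> is_derive g (f a) (/ C_derive f a).
Proof.
  intros Ha Hn; assert (Hl := is_derive_C_derive f a (Hf a Ha)).
  apply is_derive_slope in Hl; destruct Hl as [q [Hq [Eq E]]].
  assert (Hga := Hg a Ha); assert (Cg := inverse_continuous a Ha).
  assert (Cqg : continuous (fun w => q (g w)) (f a)).
  { apply continuous_comp; auto; rewrite Hga; auto. }
  destruct (injective_open a 1 Ha) as [d1 [Hd1 H1]]; [lra|].
  assert (Cqg' := Cqg); rewrite continuous_Cmod in Cqg'.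
  destruct (Cqg' (Cmod (C_derive f a))) as [d2 [Hd2 H2]]; [now apply Cmod_gt_0|].
  rewrite Hga, Eq in H2.
  apply (is_derive_C_ext_loc (fun w => a + / q (g w) * (w - f a)) g (f a) _ (Rmin d1 d2)).
  - now apply Rmin_pos.
  - intros w Hw.
    destruct (H1 w) as [z [_ [Hz <-]]]; [eapply Rlt_le_trans; [apply Hw | apply Rmin_l]|].
    assert (Hqz : q z <> 0).
    { assert (A := H2 (f z) ltac:(eapply Rlt_le_trans; [apply Hw | apply Rmin_r])).
      rewrite Hg in A by auto; intros E0; rewrite E0 in A.
      replace (0 - C_derive f a) with (- C_derive f a) in A by ring.
      rewrite Cmod_opp in A; lra. }
    rewrite Hg, (E z) by auto; field; auto.
  - apply is_derive_slope; exists (fun w => / q (g w)); split; [|split].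
    + apply continuous_Cinv; auto; rewrite Hga, Eq; auto.
    + rewrite Hga, Eq; auto.
    + intros y; ring.
Qed.

(** Near a critical point [a] the inverse would be continuous, and
    holomorphic off [f a] since the zeros of the derivative are isolated;
    Riemann's theorem makes it differentiable at [f a], which contradicts the
    chain rule. *)
Lemma injective_derive_neq_0 (a : C) : (Cmod a < 1)%R -> C_derive f a <> 0.
Proof.
  intros Ha.
  assert (Dg : ex_derive g (f a) -> C_derive f a <> 0).
  { intros [l Hl] E.
    assert (H1 : is_derive (fun z => g (f z)) a (l * C_derive f a)).
    { apply is_derive_Ccomp; auto; apply is_derive_C_derive; auto. }
    assert (H2 : is_derive (fun z => g (f z)) a (RtoC 1)).
    { apply (is_derive_C_ext_loc (fun z => z) _ a 1 (1 - Cmod a)); [lra| |apply is_derive_Cid].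
      intros z Hz; symmetry; apply Hg, (disc_neighbourhood a), Hz. }
    assert (E2 := is_derive_C_unique _ _ _ _ H1 H2); rewrite E, Cmult_0_r in E2.
    apply RtoC_inj in E2; lra. }
  apply Dg.
  destruct (zero_isolated (fun u => C_derive f (a + u)) (1 - Cmod a)) as [[d [Hd Hnz]]|Hz]; [lra| | |].
  - intros u Hu; apply ex_derive_translate.
    apply (derive_holomorphic f _ (1 - Cmod a - Cmod u)); [lra|].
    intros w Hw; apply Hf, (disc_neighbourhood a).
    pose proof (Cmod_tri3 w (a + u) a) as T; replace (a + u - a) with u in T by ring; lra.
  - destruct (injective_open a d Ha Hd) as [k [Hk Hopen]].
    apply removable with (k / 2)%R; [lra | now apply inverse_continuous|].
    intros w Hw Hwk; destruct (Hopen w) as [z [Hzd [Hz1 <-]]]; [lra|].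
    eexists; apply inverse_is_derive; auto.
    replace z with (a + (z - a)) by ring; apply Hnz; auto.
    apply Cminus_neq_0; intros ->; auto.
  - exfalso.
    set (u := RtoC ((1 - Cmod a) / 4)).
    assert (Hu : Cmod u = ((1 - Cmod a) / 4)%R) by (unfold u; rewrite Cmod_R, Rabs_pos_eq; lra).
    assert (Htu : forall t, (0 <= t <= 1)%R -> (Cmod (RtoC t * u) <= (1 - Cmod a) / 4)%R).
    { intros t Ht; rewrite Cmod_mult, Cmod_R, Rabs_pos_eq, Hu by lra; nra. }
    assert (E : (Cmod (f (a + u)%C - f a) <= 0 * Cmod u)%R).
    { apply segment_increment_le with (C_derive f).
      - intros t Ht; apply is_derive_C_derive, Hf, (disc_neighbourhood a).
        replace (a + RtoC t * u - a) with (RtoC t * u) by ring.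
        specialize (Htu t Ht); lra.
      - intros t Ht; rewrite Hz; [rewrite Cmod_0; lra|]; specialize (Htu t Ht); lra. }
    assert (E2 : f (a + u) - f a = 0).
    { apply Cmod_eq_0, Rle_antisym; [lra | apply Cmod_ge_0]. }
    assert (Hin : (Cmod (a + u) < 1)%R).
    { apply (disc_neighbourhood a); replace (a + u - a) with u by ring; lra. }
    assert (E3 : a + u = a).
    { rewrite <- (Hg (a + u)) by auto.
      replace (f (a + u)) with (f (a + u) - f a + f a) by ring; rewrite E2.
      replace (0 + f a) with (f a) by ring; auto. }
    assert (E4 : u = 0) by (replace u with (a + u - a) by ring; rewrite E3; ring).
    rewrite E4, Cmod_0 in Hu; lra.
Qed.

End InjectiveInverse.

(** * Concave functions with pole at the origin *)

(** To first order [g (t * w)] is [g w - (1 - t) (w l)], which is longer than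
    [g w] when the inner product with [w l] is negative. *)
Lemma radial_derivative (g : C -> C) (w l : C) :
  is_derive g w l ->
  (forall t, (0 < t < 1)%R -> (Cmod (g (RtoC t * w)%C) <= Cmod (g w))%R) ->
  (0 <= Re (Cconj (g w) * (w * l)))%R.
Proof.
  intros Hl Ht; apply Rnot_lt_le; intros Hneg.
  set (z := g w) in *; set (D := w * l) in *; set (k := (- Re (Cconj z * D))%R).
  assert (Hk : (0 < k)%R) by (unfold k; lra).
  pose proof (Cmod_ge_0 w) as Hw; pose proof (Cmod_ge_0 z) as Hz.
  set (e := (Rmin 1 (k / (2 * (Cmod w * Cmod z + Cmod w * Cmod w + 1))))%R).
  assert (Hq : (0 < 2 * (Cmod w * Cmod z + Cmod w * Cmod w + 1))%R) by nra.
  assert (He : (0 < e)%R) by (apply Rmin_pos; [lra | now apply Rdiv_lt_0_compat]).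
  assert (He1 : (e <= 1)%R) by apply Rmin_l.
  assert (He2 : (e * (2 * (Cmod w * Cmod z + Cmod w * Cmod w + 1)) <= k)%R).
  { apply Rle_div_r; auto; apply Rmin_r. }
  rewrite is_derive_Cmod in Hl; destruct (Hl e He) as [d [Hd Hy]].
  set (s := Rmin (1 / 2) (d / (2 * (Cmod w + 1)))).
  assert (Hs : (0 < s)%R).
  { apply Rmin_pos; [lra|]; apply Rdiv_lt_0_compat; lra. }
  assert (Hs1 : (s <= 1 / 2)%R) by apply Rmin_l.
  assert (Hs2 : (s * (2 * (Cmod w + 1)) <= d)%R).
  { apply Rle_div_r; [lra | apply Rmin_r]. }
  set (y := RtoC (1 - s) * w).
  assert (Ey : y - w = - (RtoC s * w)) by (unfold y; rewrite RtoC_minus; ring).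
  assert (Hyw : Cmod (y - w) = (s * Cmod w)%R).
  { rewrite Ey, Cmod_opp, Cmod_mult, Cmod_R, Rabs_pos_eq; lra. }
  specialize (Hy y ltac:(rewrite Hyw; nra)); rewrite Hyw in Hy.
  specialize (Ht (1 - s)%R ltac:(lra)); fold y z in Ht.
  fold z in Hy; replace (l * (y - w)) with (- (RtoC s * D)) in Hy
    by (rewrite Ey; unfold D; ring).
  assert (H1 : (Cmod (z - RtoC s * D) <= Cmod z + e * (s * Cmod w))%R).
  { pose proof (Cmod_tri_inv (z - RtoC s * D) (z - RtoC s * D - g y)) as T.
    replace (z - RtoC s * D - (z - RtoC s * D - g y)) with (g y) in T by ring.
    rewrite <- (Cmod_opp (z - RtoC s * D - g y)) in T.
    replace (- (z - RtoC s * D - g y)) with (g y - z - - (RtoC s * D)) in T by ring.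
    lra. }
  assert (H2 : (Cmod (z - RtoC s * D) * Cmod (z - RtoC s * D) >=
    Cmod z * Cmod z + 2 * s * k)%R).
  { rewrite !Cmod_sqr; unfold k; destruct z as [z1 z2], D as [D1 D2]; simpl.
    assert (0 <= s * s * (D1 * D1 + D2 * D2))%R by nra; nra. }
  pose proof (Cmod_ge_0 (z - RtoC s * D)).
  assert (H3 : (Cmod z * Cmod z + 2 * s * k <=
    (Cmod z + e * (s * Cmod w)) * (Cmod z + e * (s * Cmod w)))%R) by nra.
  assert (H4 : (2 * s * k <= s * (e * (2 * (Cmod w * Cmod z + Cmod w * Cmod w))))%R).
  { assert (e * s * (Cmod w * Cmod w) <= 1 * (Cmod w * Cmod w))%R
      by (apply Rmult_le_compat_r; nra).
    assert (0 <= e * s)%R by nra.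
    assert ((e * s) * (e * s * (Cmod w * Cmod w)) <= (e * s) * (1 * (Cmod w * Cmod w)))%R
      by (apply Rmult_le_compat_l; auto).
    nra. }
  assert (H5 : (2 * k <= e * (2 * (Cmod w * Cmod z + Cmod w * Cmod w)))%R) by nra.
  nra.
Qed.

Lemma Re_div_real (z : C) (x : R) : (x <> 0)%R -> Re (z / RtoC x) = (Re z / x)%R.
Proof.
  intros Hx; unfold Cdiv; rewrite <- RtoC_inv by auto.
  rewrite Re_mult; simpl; field; auto.
Qed.

Lemma Re_scal (x : R) (z : C) : Re (RtoC x * z) = (x * Re z)%R.
Proof. rewrite Re_mult; simpl; ring. Qed.

Section Concave.

(** [g] stands for the function [h z = g z / z] with a simple pole at [0]. That
    [h] is injective and that [w] is omitted by [h] are stated with denominators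
    cleared, so that they make sense at the pole. *)
Variable g : C -> C.
Hypothesis Hg : forall z, (Cmod z < 1)%R -> ex_derive g z.
Hypothesis Hg0 : g 0 <> 0.
Hypothesis Hinj : forall z x, (Cmod z < 1)%R -> (Cmod x < 1)%R -> z <> x ->
  x * g z <> z * g x.
Let K (w : C) : Prop := forall z, (Cmod z < 1)%R -> g z - w * z <> 0.
Hypothesis Hconv : forall (u v : C) (t : R), (0 <= t <= 1)%R -> K u -> K v ->
  K (t * u + (1 - t) * v).

(** [N = - z^2 h'], free of the pole. *)
Let N (z : C) : C := g z - z * C_derive g z.

Lemma zero_in_disc : (Cmod 0 < 1)%R.
Proof. rewrite Cmod_0; lra. Qed.

Lemma scaled_derivative_holomorphic (z : C) : (Cmod z < 1)%R -> ex_derive N z.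
Proof.
  intros Hz; unfold N; cderive; [auto|].
  apply (derive_holomorphic g z (1 - Cmod z)); [lra|].
  intros w Hw; apply Hg, (disc_neighbourhood z), Hw.
Qed.

(** [z / (g z - w z) = 1 / (h z - w)] is starlike: convexity of [K] makes the
    complement of [K] invariant under dilation from [w]. *)
Lemma omitted_value_starlike (w z : C) :
  K w -> (Cmod z < 1)%R -> N z <> 0 /\ (0 <= Re ((g z - w * z) / N z))%R.
Proof.
  intros Kw Hz.
  set (F := fun z => z / (g z - w * z)).
  assert (HF : forall x, (Cmod x < 1)%R -> ex_derive F x).
  { intros x Hx; unfold F; cderive; auto. }
  assert (F0 : F 0 = 0) by (unfold F, Cdiv; ring).
  assert (Finj : forall x y, (Cmod x < 1)%R -> (Cmod y < 1)%R -> F x = F y -> x = y).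
  { intros x y Hx Hy E; apply NNPP; intros Hxy; apply (Hinj x y Hx Hy Hxy).
    assert (E2 : x * (g y - w * y) = y * (g x - w * x)).
    { replace x with (F x * (g x - w * x)) at 1 by (unfold F; field; auto).
      rewrite E; unfold F; field; auto. }
    replace (x * g y) with (x * (g y - w * y) + w * x * y) by ring; rewrite E2; ring. }
  set (G := fun v => epsilon (inhabits (RtoC 0)) (fun x => (Cmod x < 1)%R /\ F x = v)).
  assert (HG : forall x, (Cmod x < 1)%R -> G (F x) = x).
  { intros x Hx.
    destruct (epsilon_spec (inhabits (RtoC 0)) (fun y => (Cmod y < 1)%R /\ F y = F x)) as [H1 H2].
    { exists x; auto. }
    apply Finj; auto. }
  (* the preimage of [t * F x] is where [h] takes the value [w + (h x - w) / t] *)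
  assert (Hstar : forall t x, (0 < t < 1)%R -> (Cmod x < 1)%R ->
    exists y, (Cmod y < 1)%R /\ F y = RtoC t * F x).
  { intros t x Ht Hx.
    destruct (Ceq_dec x 0) as [->|Hx0].
    { exists 0; split; [apply zero_in_disc | rewrite F0; ring]. }
    assert (Ht0 : RtoC t <> 0) by (intros E0; apply RtoC_inj in E0; lra).
    set (v := w + (g x / x - w) / RtoC t).
    assert (Kv : ~ K v).
    { intros Kv; apply (Hconv v w t ltac:(lra) Kv Kw x Hx).
      unfold v; field; auto. }
    apply not_all_ex_not in Kv; destruct Kv as [y Hy].
    apply imply_to_and in Hy; destruct Hy as [Hy Ey]; apply NNPP in Ey.
    exists y; split; auto.
    assert (Hd := Kw x Hx).
    assert (Hy0 : y <> 0).
    { intros ->; apply Hg0; replace (g 0) with (g 0 - v * 0) by ring; exact Ey. }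
    assert (Egy : g y - w * y = y * ((g x - w * x) / x / RtoC t)).
    { replace (g y) with (g y - v * y + v * y) by ring; rewrite Ey; unfold v; field; auto. }
    assert (Hd' := Kw y Hy).
    unfold F; rewrite Egy; field; repeat split; auto. }
  assert (HdF := injective_derive_neq_0 F G HF HG z Hz).
  assert (HN : forall x, (Cmod x < 1)%R ->
    C_derive F x = N x / ((g x - w * x) * (g x - w * x))).
  { intros x Hx; apply is_C_derive_unique.
    assert (Hd := Kw x Hx).
    replace (N x / _) with (1 * / (g x - w * x) + x * (- (C_derive g x - (0 * x + w * 1))
       / ((g x - w * x) * (g x - w * x)))) by (unfold N; field; auto).
    apply (is_derive_Cmult (fun y => y) (fun y => / (g y - w * y))); [apply is_derive_Cid|].
    apply (is_derive_Cinv (fun y => g y - w * y)); auto.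
    apply (is_derive_Cminus g (fun y => w * y)); [apply is_derive_C_derive; auto|].
    apply (is_derive_Cmult (fun _ => w) (fun y => y)); [apply is_derive_Cconst | apply is_derive_Cid]. }
  assert (HNz : N z <> 0).
  { intros E; apply HdF; rewrite (HN z Hz), E; unfold Cdiv; ring. }
  split; auto.
  destruct (Ceq_dec z 0) as [->|Hz0].
  { unfold N; replace ((g 0 - w * 0) / (g 0 - 0 * C_derive g 0)) with (RtoC 1).
    - simpl; lra.
    - field; exact Hg0. }
  assert (Hschwarz : forall t, (0 < t < 1)%R -> (Cmod (G (RtoC t * F z)%C) <= Cmod z)%R).
  { intros t Ht; apply (schwarz (fun z => G (RtoC t * F z))); auto.
    - intros x Hx; destruct (Hstar t x Ht Hx) as [y [Hy Ey]].
      apply (ex_derive_Ccomp G (fun x => RtoC t * F x)).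
      + rewrite <- Ey; eexists; apply (inverse_is_derive F G HF HG y Hy).
        apply (injective_derive_neq_0 F G); auto.
      + apply ex_derive_Cmult; [apply ex_derive_Cconst | auto].
    - rewrite F0; replace (RtoC t * 0) with (F 0) by (rewrite F0; ring).
      apply HG, zero_in_disc.
    - intros x Hx; destruct (Hstar t x Ht Hx) as [y [Hy Ey]].
      rewrite <- Ey, HG by auto; lra. }
  assert (Hrad := radial_derivative G (F z) (/ C_derive F z)
    (inverse_is_derive F G HF HG z Hz HdF)).
  rewrite HG in Hrad by auto; specialize (Hrad Hschwarz).
  assert (Hd := Kw z Hz).
  rewrite (HN z Hz) in Hrad; unfold F in Hrad.
  replace (Cconj z * (z / (g z - w * z) * / (N z / ((g z - w * z) * (g z - w * z)))))
    with (RtoC (Cmod z * Cmod z) * ((g z - w * z) / N z)) in Hrad.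
  - rewrite Re_scal in Hrad.
    apply Cmod_gt_0 in Hz0.
    assert (0 < Cmod z * Cmod z)%R by nra.
    nra.
  - replace (RtoC (Cmod z * Cmod z)) with (z * Cconj z)
      by (rewrite <- Cmod2_conj; f_equal; ring).
    field; auto.
Qed.

(** Near its pole [h] covers a neighbourhood of infinity, which by injectivity
    contains no value taken elsewhere. *)
Lemma bounded_near_boundary :
  exists r B : R, (0 < r < 1)%R /\
    forall x, (r <= Cmod x < 1)%R -> (Cmod (g x / x) <= B)%R.
Proof.
  assert (Cg := ex_derive_Ccontinuous g 0 (Hg 0 zero_in_disc)).
  rewrite continuous_Cmod in Cg; destruct (Cg (Cmod (g 0))) as [e [He Hge]].
  { now apply Cmod_gt_0. }
  set (r := Rmin (e / 2) (1 / 2)).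
  assert (Hr : (0 < r)%R) by (apply Rmin_pos; lra).
  assert (Hr1 : (r <= e / 2)%R) by apply Rmin_l.
  assert (Hr2 : (r <= 1 / 2)%R) by apply Rmin_r.
  assert (Hgn : forall z, (Cmod z <= r)%R -> g z <> 0).
  { intros z Hz E; specialize (Hge z); replace (z - 0) with z in Hge by ring.
    specialize (Hge ltac:(lra)); rewrite E in Hge.
    replace (0 - g 0) with (- g 0) in Hge by ring; rewrite Cmod_opp in Hge; lra. }
  set (F := fun z => z / g z).
  assert (F0 : F 0 = 0) by (unfold F, Cdiv; ring).
  assert (HF : forall z, (Cmod z <= r)%R -> ex_derive F z).
  { intros z Hz; unfold F; cderive; auto; apply Hg; lra. }
  destruct (circle_away_from_zero F r) as [d [Hd Hdz]]; [lra| | |].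
  - intros w Hw; apply ex_derive_Ccontinuous, HF; lra.
  - intros w Hw; unfold F, Cdiv; apply Cmult_neq_0; [apply Cmod_gt_0; lra|].
    apply Cinv_neq_0, Hgn; lra.
  - exists r, (2 / d)%R; split; [lra|]; intros x Hx.
    assert (Hx0 : x <> 0) by (apply Cmod_gt_0; lra).
    destruct (Ceq_dec (g x) 0) as [E|Hgx].
    { rewrite E; unfold Cdiv; rewrite Cmult_0_l, Cmod_0.
      apply Rdiv_le_0_compat; lra. }
    rewrite Cmod_div by auto.
    assert (Hgm : (0 < Cmod (g x))%R) by now apply Cmod_gt_0.
    apply Rnot_lt_le; intros Hlt.
    assert (Hv : (Cmod (x / g x - F 0) < d / 2)%R).
    { rewrite F0; replace (x / g x - 0) with (x / g x) by ring.
      rewrite Cmod_div by auto; apply Rlt_div_l; auto.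
      apply Rlt_div_r in Hlt; [|lra].
      replace (2 / d * Cmod x)%R with (2 * Cmod x / d)%R in Hlt by (field; lra).
      apply Rlt_div_l in Hlt; lra. }
    assert (Hsub : forall z, z - 0 = z) by (intros; ring).
    destruct (open_mapping F 0 (x / g x) r d Hr Hd) as [z [Hz Ez]]; auto.
    + intros z; rewrite Hsub; auto.
    + intros z; rewrite Hsub, F0, Hsub; auto.
    + rewrite Hsub in Hz; unfold F in Ez.
      apply (Hinj x z); [lra|lra| |].
      * intros ->; lra.
      * assert (Hgz := Hgn z ltac:(lra)).
        replace (x * g z) with (x / g x * (g x * g z)) by (field; auto).
        rewrite <- Ez; field; auto.
Qed.

(** A value [w = h y] is taken near [y] together with a neighbourhood, so by
    injectivity [h] avoids this neighbourhood outside a smaller disc. *)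
Lemma near_omitted_or_avoided (w : C) (e : R) : (0 < e)%R ->
  exists d : R, (0 < d)%R /\
    ((K w /\ (d <= e)%R) \/
     (forall x, (1 - d < Cmod x < 1)%R -> (d <= Cmod (g x / x - w))%R)).
Proof.
  intros He; destruct (classic (K w)) as [Kw|Kw].
  { exists e; split; auto; left; split; auto; lra. }
  apply not_all_ex_not in Kw; destruct Kw as [y Hy].
  apply imply_to_and in Hy; destruct Hy as [Hy Ey]; apply NNPP in Ey.
  assert (Hy0 : y <> 0).
  { intros ->; apply Hg0; replace (g 0) with (g 0 - w * 0) by ring; exact Ey. }
  assert (Hym : (0 < Cmod y)%R) by now apply Cmod_gt_0.
  set (F := fun z => g z / z).
  assert (Fy : F y = w).
  { unfold F; replace (g y) with (g y - w * y + w * y) by ring; rewrite Ey; field; auto. }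
  set (r := Rmin (Cmod y / 2) ((1 - Cmod y) / 2)).
  assert (Hr : (0 < r)%R) by (apply Rmin_pos; lra).
  assert (Hr1 : (r <= Cmod y / 2)%R) by apply Rmin_l.
  assert (Hr2 : (r <= (1 - Cmod y) / 2)%R) by apply Rmin_r.
  assert (Hin : forall z, (Cmod (z - y) <= r)%R -> (Cmod z <= Cmod y + r)%R /\ z <> 0).
  { intros z Hz; split.
    - pose proof (Cmod_triangle y (z - y)) as T; replace (y + (z - y)) with z in T by ring; lra.
    - intros ->; replace (0 - y) with (- y) in Hz by ring; rewrite Cmod_opp in Hz; lra. }
  assert (HF : forall z, (Cmod (z - y) <= r)%R -> ex_derive F z).
  { intros z Hz; destruct (Hin z Hz); unfold F; cderive; auto; apply Hg; lra. }
  assert (Hshift : forall u, y + u - y = u) by (intros; ring).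
  assert (Finj : forall z x : C, z <> 0 -> x <> 0 -> (Cmod z < 1)%R -> (Cmod x < 1)%R ->
    F z = F x -> z = x).
  { intros z x Hz0 Hx0 Hz Hx E; apply NNPP; intros Hzx.
    apply (Hinj z x Hz Hx Hzx).
    replace (g x) with (F x * x) by (unfold F; field; auto).
    rewrite <- E; unfold F; field; auto. }
  destruct (circle_away_from_zero (fun u => F (y + u) - F y) r) as [d [Hd Hdz]]; [lra| | |].
  - intros u Hu; apply ex_derive_Ccontinuous; cderive.
    apply ex_derive_translate, HF; rewrite Hshift; lra.
  - intros u Hu; apply Cminus_neq_0; intros E.
    destruct (Hin (y + u)) as [H1 H2]; [rewrite Hshift; lra|].
    apply Finj in E; auto; try lra.
    rewrite <- (Hshift u), E in Hu.
    replace (y - y) with (RtoC 0) in Hu by ring; rewrite Cmod_0 in Hu; lra.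
  - exists (Rmin (d / 2) (1 - Cmod y - r)); split; [apply Rmin_pos; lra|]; right.
    intros x Hx; pose proof (Rmin_l (d / 2) (1 - Cmod y - r)).
    pose proof (Rmin_r (d / 2) (1 - Cmod y - r)).
    eapply Rle_trans; [apply Rmin_l|]; apply Rnot_lt_le; intros Hlt.
    rewrite <- Fy in Hlt.
    destruct (open_mapping F y (F x) r d Hr Hd HF) as [z [Hz Ez]]; auto.
    + intros z Hz; apply Hdz in Hz; replace (y + (z - y)) with z in Hz by ring; auto.
    + destruct (Hin z) as [H1 H2]; [lra|].
      assert (Hx0 : x <> 0) by (apply Cmod_gt_0; lra).
      apply Finj in Ez; auto; try lra; subst x; lra.
Qed.

(** The boundary values of [h] lie in [K]: a finite cover of a large square of
    values turns the local alternative into a uniform one. *)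
Lemma boundary_values_omitted (e : R) : (0 < e)%R ->
  exists r : R, (0 < r < 1)%R /\
    forall x, (r < Cmod x < 1)%R -> exists w, K w /\ (Cmod (g x / x - w) < e)%R.
Proof.
  intros He; destruct bounded_near_boundary as [r0 [B [Hr0 HB]]].
  set (Q := fun (w : C) (d : R) => (0 < d)%R /\
    ((K w /\ (d <= e / 2)%R) \/
     (forall x, (1 - d < Cmod x < 1)%R -> (d <= Cmod (g x / x - w))%R))).
  assert (HQ : forall w, exists d, Q w d) by (intros; apply near_omitted_or_avoided; lra).
  set (d := fun w => epsilon (inhabits 0%R) (Q w)).
  assert (Hd : forall w, Q w (d w)) by (intros w; apply epsilon_spec, HQ).
  assert (Hdpos : forall w, (0 < d w / 2)%R) by (intros w; destruct (Hd w); lra).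
  destruct (compactness_value_2d (- B) B (- B) B
    (fun u v => mkposreal _ (Hdpos (u, v)))) as [k Hk].
  assert (Hkpos := cond_pos k).
  exists (Rmax r0 (1 - k / 2)).
  assert (A1 : (Rmax r0 (1 - k / 2) < 1)%R) by (apply Rmax_lub_lt; lra).
  assert (A2 := Rmax_l r0 (1 - k / 2)); assert (A3 := Rmax_r r0 (1 - k / 2)).
  split; [lra|]; intros x Hx.
  assert (Hb := HB x ltac:(lra)); set (w := g x / x) in *.
  assert (H1 := re_le_Cmod w); assert (H2 := Rabs_Im_le_Cmod w).
  assert (Hre : (- B <= Re w <= B)%R) by (apply Rabs_le_between; lra).
  assert (Him : (- B <= Im w <= B)%R) by (apply Rabs_le_between; lra).
  destruct (NNPP _ (Hk (Re w) (Im w) Hre Him)) as [u [v [_ [_ [Hu [Hv Hkd]]]]]].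
  cbn [pos] in Hu, Hv, Hkd.
  assert (Hdist : (Cmod (w - (u, v)) < d (u, v))%R).
  { replace (w - (u, v)) with ((Re w - u, Im w - v)%R : C) by reflexivity.
    eapply Rle_lt_trans; [apply Cmod_le_abs|]; lra. }
  destruct (Hd (u, v)) as [_ [[Kuv Hde]|Hfar]].
  - exists (u, v); split; auto; lra.
  - exfalso; specialize (Hfar x ltac:(lra)); fold w in Hfar; lra.
Qed.

Lemma scaled_derivative_neq_0 (z : C) : (Cmod z < 1)%R -> N z <> 0.
Proof.
  intros Hz; destruct (boundary_values_omitted 1) as [r [Hr H]]; [lra|].
  destruct (H (RtoC ((1 + r) / 2))) as [w [Kw _]].
  - rewrite Cmod_R, Rabs_pos_eq; lra.
  - now apply (omitted_value_starlike w z).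
Qed.

(** Convexity of the level curves of [h]: for fixed [l] the quotient is holomorphic
    in [z], and as [|z|] tends to [1 / |l|] the value [h (l z)] approaches [K]. *)
Lemma level_convex_outside (l z : C) :
  (1 < Cmod l)%R -> (Cmod (l * z) < 1)%R ->
  (0 <= Re ((g z - g (l * z)%C / l) / N z))%R.
Proof.
  intros Hl Hlz; rewrite Cmod_mult in Hlz.
  assert (Hl0 : l <> 0) by (apply Cmod_gt_0; lra).
  set (p := (/ Cmod l)%R).
  assert (Hp : (0 < p < 1)%R).
  { unfold p; split; [apply Rinv_0_lt_compat; lra|].
    rewrite <- Rinv_1; apply Rinv_lt_contravar; lra. }
  assert (Hpl : (p * Cmod l = 1)%R) by (unfold p; field; lra).
  assert (Hzp : (Cmod z < p)%R) by nra.
  assert (HN : forall y, (Cmod y <= p)%R -> ex_derive (fun y => y / N y) y).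
  { intros y Hy; cderive; [apply scaled_derivative_holomorphic; lra | apply scaled_derivative_neq_0; lra]. }
  destruct (circle_bounded (fun y => y / N y) p) as [M [HM HMc]]; [lra| |].
  { intros y Hy; apply ex_derive_Ccontinuous, HN; lra. }
  assert (HMd : forall y, (Cmod y <= p)%R -> (Cmod (y / N y) <= M)%R).
  { intros y Hy; apply (maximum_modulus (fun y => y / N y) p); auto; lra. }
  apply Rnot_lt_le; intros Hneg.
  set (G := fun z => (g z - g (l * z) / l) / N z).
  fold (G z) in Hneg.
  set (e := (- Re (G z) / (2 * M))%R).
  assert (He : (0 < e)%R) by (apply Rdiv_lt_0_compat; lra).
  assert (HeM : (e * M = - Re (G z) / 2)%R) by (unfold e; field; lra).
  destruct (boundary_values_omitted e He) as [r [Hr Hnear]].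
  set (k := Rmax (Cmod z) (p * ((1 + r) / 2))).
  assert (Hk1 : (Cmod z <= k)%R) by apply Rmax_l.
  assert (Hk2 : (p * ((1 + r) / 2) <= k)%R) by apply Rmax_r.
  assert (Hk3 : (k < p)%R) by (apply Rmax_lub_lt; [auto | nra]).
  assert (Hk4 : (0 < k)%R) by nra.
  enough (Hbound : (Re (0 - G z) <= e * M)%R).
  { rewrite Re_minus in Hbound; change (Re 0) with 0%R in Hbound; lra. }
  apply (maximum_re (fun z => 0 - G z) k); auto.
  - intros y Hy; unfold G; cderive; auto.
    + apply Hg; lra.
    + apply (ex_derive_Ccomp g (fun y => l * y)); cderive.
      apply Hg; rewrite Cmod_mult; nra.
    + apply scaled_derivative_holomorphic; lra.
    + apply scaled_derivative_neq_0; lra.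
  - intros y Hy.
    assert (Hy0 : y <> 0) by (apply Cmod_gt_0; lra).
    destruct (Hnear (l * y)) as [w [Kw Hw]]; [rewrite Cmod_mult, Hy; nra|].
    destruct (omitted_value_starlike w y Kw) as [HNy Hst]; [lra|].
    replace (0 - G y) with ((g (l * y) / (l * y) - w) * (y / N y) - (g y - w * y) / N y)
      by (unfold G; field; auto).
    rewrite Re_minus.
    assert (Hterm : (Re ((g (l * y)%C / (l * y) - w) * (y / N y)) <= e * M)%R).
    { eapply Rle_trans; [apply Re_le_Cmod|]; rewrite Cmod_mult.
      apply Rmult_le_compat; try apply Cmod_ge_0; [lra|]; apply HMd; lra. }
    lra.
Qed.

Lemma level_convex (l z : C) :
  Cmod l = 1%R -> (Cmod z < 1)%R -> (0 <= Re ((g z - g (l * z)%C / l) / N z))%R.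
Proof.
  intros Hl Hz; apply Rnot_lt_le; intros Hneg.
  assert (Hl0 : l <> 0) by (apply Cmod_gt_0; lra).
  set (G := fun l => (g z - g (l * z) / l) / N z).
  assert (HG : continuous G l).
  { apply ex_derive_Ccontinuous; unfold G; cderive; auto; [|now apply scaled_derivative_neq_0].
    apply (ex_derive_Ccomp g (fun l => l * z)); cderive.
    apply Hg; rewrite Cmod_mult, Hl; lra. }
  rewrite continuous_Cmod in HG; fold (G l) in Hneg.
  destruct (HG (- Re (G l))%R) as [d [Hd HGd]]; [lra|].
  pose proof (Cmod_ge_0 z) as Hz0.
  set (s := Rmin (d / 2) ((1 - Cmod z) / 2)).
  assert (Hs : (0 < s)%R) by (apply Rmin_pos; lra).
  assert (Hs1 : (s <= d / 2)%R) by apply Rmin_l.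
  assert (Hs2 : (s <= (1 - Cmod z) / 2)%R) by apply Rmin_r.
  set (l' := RtoC (1 + s) * l).
  assert (Hl' : Cmod l' = (1 + s)%R).
  { unfold l'; rewrite Cmod_mult, Cmod_R, Hl, Rabs_pos_eq; lra. }
  assert (Hll : (Cmod (l' - l) < d)%R).
  { replace (l' - l) with (RtoC s * l) by (unfold l'; rewrite RtoC_plus; ring).
    rewrite Cmod_mult, Cmod_R, Hl, Rabs_pos_eq; lra. }
  specialize (HGd l' Hll).
  assert (Hpos := level_convex_outside l' z ltac:(lra)
    ltac:(rewrite Cmod_mult, Hl'; nra)); fold (G l') in Hpos.
  pose proof (Re_le_Cmod (G l' - G l)) as T; rewrite Re_minus in T; lra.
Qed.

(** In [l] the quotient of [level_convex] vanishes at 1 with known derivative.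
    Divided by [|1 - l|^2], which on the unit circle is the holomorphic
    [- (1 - l)^2 / l], it keeps its sign, and the value at the centre can be
    read off. *)
Lemma scaled_derivative_near_residue (z : C) :
  (Cmod z < 1)%R -> (Cmod (g 0 - N z) <= Cmod (g 0))%R.
Proof.
  intros Hz; destruct (Ceq_dec z 0) as [->|Hz0].
  { unfold N; replace (g 0 - (g 0 - 0 * C_derive g 0)) with (RtoC 0) by ring.
    rewrite Cmod_0; apply Cmod_ge_0. }
  assert (Hzm : (0 < Cmod z)%R) by now apply Cmod_gt_0.
  assert (HNz := scaled_derivative_neq_0 z Hz).
  set (P := (/ Cmod z)%R).
  assert (HP : (1 < P)%R).
  { unfold P; rewrite <- Rinv_1; apply Rinv_lt_contravar; lra. }
  assert (HPz : forall l, (Cmod l < P)%R -> (Cmod (l * z) < 1)%R).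
  { intros l Hl; rewrite Cmod_mult; unfold P in Hl.
    apply (Rmult_lt_compat_r (Cmod z)) in Hl; auto.
    rewrite Rinv_l in Hl; lra. }
  (* [- l] times the quotient of [level_convex], free of its pole at [l = 0] *)
  set (E := fun l => (g (l * z) - l * g z) / N z).
  assert (HE : forall l, (Cmod l < P)%R -> ex_derive E l).
  { intros l Hl; unfold E; cderive; auto.
    apply (ex_derive_Ccomp g (fun l => l * z)); cderive; auto. }
  assert (E1 : E 1 = 0).
  { unfold E; rewrite Cmult_1_l; field; auto. }
  assert (HE1 : C_derive E 1 = RtoC (-1)).
  { apply is_C_derive_unique.
    replace (RtoC (-1)) with ((C_derive g (1 * z) * (1 * z + 1 * 0) - (1 * g z + 1 * 0)) * / N z
      + (g (1 * z) - 1 * g z) * 0).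
    2: { unfold N in HNz |- *; rewrite !Cmult_1_l; field; auto. }
    apply (is_derive_Cmult (fun l => g (l * z) - l * g z) (fun _ => / N z));
      [|apply is_derive_Cconst].
    apply (is_derive_Cminus (fun l => g (l * z)) (fun l => l * g z)).
    - apply (is_derive_Ccomp g (fun l => l * z)).
      + apply is_derive_C_derive, Hg; rewrite Cmult_1_l; auto.
      + apply (is_derive_Cmult (fun l => l) (fun _ => z));
          [apply is_derive_Cid | apply is_derive_Cconst].
    - apply (is_derive_Cmult (fun l => l) (fun _ => g z));
        [apply is_derive_Cid | apply is_derive_Cconst]. }
  assert (H1P : (Cmod 1 < P)%R) by (rewrite Cmod_1; auto).
  destruct (holomorphic_quotient E P 1 HE H1P) as [q [Hq [q1 Eq]]].
  destruct (holomorphic_quotient q P 1 Hq H1P) as [S [HS [_ ES]]].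
  rewrite HE1 in q1; rewrite E1 in Eq; rewrite q1 in ES.
  assert (S0 : S 0 = g 0 / N z - 1).
  { assert (A := Eq 0); rewrite (ES 0) in A; unfold E in A.
    rewrite Cmult_0_l in A.
    replace (g 0 / N z) with ((g 0 - 0 * g z) / N z) by (field; auto).
    rewrite A; ring. }
  assert (Hc : (Re (0 - S 0) <= 1 / 2)%R).
  { apply (center_re_le (fun l => 0 - S l) 1); [lra| |].
    - intros l Hl; cderive; apply HS; lra.
    - intros t Ht; set (l := polar 1 t).
      assert (Hl : Cmod l = 1%R) by (apply Cmod_polar; lra).
      assert (Hpos := level_convex l z Hl Hz).
      assert (Hl0 : l <> 0) by (apply Cmod_gt_0; lra).
      assert (Hl2 : (Re l * Re l + Im l * Im l = 1)%R).
      { rewrite <- Cmod_sqr, Hl; ring. }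
      set (m := (2 - 2 * Re l)%R).
      assert (Hl1 : (Re l < 1)%R).
      { unfold l, polar, Re; simpl; rewrite Rmult_1_l.
        destruct (COS_bound t) as [_ [H|H]]; auto; exfalso.
        assert (Hs : (sin (t / 2) = 0)%R).
        { assert (D := cos_2a_sin (t / 2)); replace (2 * (t / 2))%R with t in D by field.
          rewrite H in D; nra. }
        assert (0 < sin (t / 2))%R by (apply sin_gt_0; lra); lra. }
      assert (Hm : (0 < m)%R) by (unfold m; lra).
      assert (Hm0 : RtoC m <> 0) by (intros Em; apply RtoC_inj in Em; lra).
      assert (Hlm : (1 - l) * (1 - l) = - (RtoC m * l)).
      { apply C_eq; unfold m, Re, Im in *; destruct l as [x y]; simpl in *; nra. }
      assert (Hn1 : 1 - l <> 0).
      { intros E0; rewrite E0 in Hlm.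
        assert (E2 : RtoC m * l = 0).
        { replace (RtoC m * l) with (- - (RtoC m * l)) by ring; rewrite <- Hlm; ring. }
        apply Cmult_neq_0 in E2; auto. }
      assert (ESl : S l = (g z - g (l * z) / l) / N z / RtoC m - / (1 - l)).
      { replace (S l) with ((E l - (1 - l)) / ((1 - l) * (1 - l))).
        - replace ((E l - (1 - l)) / ((1 - l) * (1 - l)))
            with (E l / ((1 - l) * (1 - l)) - / (1 - l)) by (field; auto).
          rewrite Hlm; unfold E; f_equal; field; auto.
        - rewrite (Eq l), (ES l); field; auto. }
      assert (Hhalf : Re (/ (1 - l)) = (1 / 2)%R).
      { replace (/ (1 - l)) with ((1 - Cconj l) / RtoC m).
        - rewrite Re_div_real by lra; unfold m, Re; destruct l; simpl; field.
          unfold m, Re in Hm; simpl in Hm; lra.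
        - assert (Hcm : (1 - Cconj l) * (1 - l) = RtoC m).
          { apply C_eq; unfold m, Re, Im in *; destruct l as [x y]; simpl in *; nra. }
          rewrite <- Hcm; field; split; auto.
          intros E0; apply Hm0; rewrite <- Hcm, E0; ring. }
      rewrite Re_minus, ESl, Re_minus, Re_div_real, Hhalf by lra; change (Re 0) with 0%R.
      assert (0 <= Re ((g z - g (l * z)%C / l) / N z) / m)%R
        by (apply Rdiv_le_0_compat; auto).
      lra. }
  rewrite S0, Re_minus, Re_minus in Hc; change (Re 0) with 0%R in Hc; change (Re 1) with 1%R in Hc.
  set (y := g 0 / N z) in *.
  assert (Ey : g 0 = y * N z) by (unfold y; field; auto).
  replace (g 0 - N z) with ((y - 1) * N z) by (rewrite Ey; ring).
  rewrite Ey, !Cmod_mult; apply Rmult_le_compat_r; [apply Cmod_ge_0|].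
  assert (A := Cmod_sqr (y - 1)); assert (B := Cmod_sqr y).
  rewrite Re_minus in A; change (Re 1) with 1%R in A.
  replace (Im (y - 1)) with (Im y) in A by (simpl; ring).
  pose proof (Cmod_ge_0 y); pose proof (Cmod_ge_0 (y - 1)); nra.
Qed.

(** The regular part [k] of [h] satisfies [z^2 k' = g 0 - N]. *)
Lemma regular_part_derive_le :
  exists (b : C) (k : C -> C),
    (forall z, (Cmod z < 1)%R -> ex_derive k z) /\ k 0 = 0 /\
    (forall z, g z = g 0 + b * z + k z * z) /\
    (forall z, (Cmod z < 1)%R -> (Cmod (C_derive k z) <= Cmod (g 0))%R).
Proof.
  destruct (holomorphic_quotient g 1 0 Hg zero_in_disc) as [q [Hq [_ E]]].
  set (k := fun z => q z - q 0).
  assert (Hk : forall z, (Cmod z < 1)%R -> ex_derive k z).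
  { intros z Hz; unfold k; cderive; auto. }
  assert (Ek : forall z, g z = g 0 + q 0 * z + k z * z).
  { intros z; rewrite (E z); unfold k; ring. }
  exists (q 0), k; repeat split; auto; [unfold k; ring|].
  assert (Hk' : forall z, (Cmod z < 1)%R -> ex_derive (C_derive k) z).
  { intros z Hz; apply (derive_holomorphic k z (1 - Cmod z)); [lra|].
    intros w Hw; apply Hk, (disc_neighbourhood z), Hw. }
  assert (HN : forall z, (Cmod z < 1)%R -> C_derive k z * z * z = g 0 - N z).
  { intros z Hz.
    assert (Dg : C_derive g z = q 0 + (C_derive k z * z + k z * 1)).
    { apply is_C_derive_unique.
      replace (q 0 + (C_derive k z * z + k z * 1))
        with (0 + (0 * z + q 0 * 1) + (C_derive k z * z + k z * 1)) by ring.
      apply (is_derive_C_ext_loc (fun z => g 0 + q 0 * z + k z * z) g z _ 1); [lra| |].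
      - intros y _; auto.
      - apply (is_derive_Cplus (fun z => g 0 + q 0 * z) (fun z => k z * z)).
        + apply (is_derive_Cplus (fun _ => g 0) (fun z => q 0 * z)); [apply is_derive_Cconst|].
          apply (is_derive_Cmult (fun _ => q 0) (fun z => z));
            [apply is_derive_Cconst | apply is_derive_Cid].
        + apply (is_derive_Cmult k (fun z => z));
            [apply is_derive_C_derive; auto | apply is_derive_Cid]. }
    unfold N; rewrite Dg, (Ek z); ring. }
  apply maximum_modulus_quotient; auto.
  apply (maximum_modulus_quotient (fun z => C_derive k z * z)).
  - intros z Hz; apply ex_derive_Cmult; auto; apply ex_derive_Cid.
  - intros z Hz; rewrite HN by auto; now apply scaled_derivative_near_residue.
Qed.

End Concave.

(** * Laurent coefficients at the pole *)

(** The terms of a convergent power series are bounded at [w0], and the series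
    without its first term is then dominated by a geometric series. *)
Lemma pseries_at_center (a : nat -> C) (w0 s0 : C) :
  w0 <> 0 -> is_pseries a w0 s0 ->
  forall e : R, (0 < e)%R -> exists d : R, (0 < d)%R /\
    forall w s, (Cmod w < d)%R -> is_pseries a w s -> (Cmod (s - a 0%nat) <= e)%R.
Proof.
  intros Hw0 Hs0 e He.
  assert (Hm0 : (0 < Cmod w0)%R) by now apply Cmod_gt_0.
  assert (Hpow : forall (w : C) n, pow_n w n = w ^ n).
  { intros w n; induction n as [|n IH]; [reflexivity|].
    simpl; rewrite <- IH; reflexivity. }
  assert (Hterm : forall w n, Cmod (scal (pow_n w n) (a n)) = (Cmod w ^ n * Cmod (a n))%R).
  { intros w n; change (Cmod (pow_n w n * a n) = (Cmod w ^ n * Cmod (a n))%R).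
    rewrite Hpow, Cmod_mult, Cmod_pow; auto. }
  assert (Hbd : exists M, (0 < M)%R /\ forall n, (Cmod w0 ^ n * Cmod (a n) <= M)%R).
  { destruct (Hs0 (fun w => (Cmod (w - s0) < / 2)%R)) as [n0 Hn0].
    { apply locally_Cmod; exists (/ 2)%R; split; [lra | auto]. }
    assert (Hfin : forall n, exists M, (0 < M)%R /\
      forall m, (m < n)%nat -> (Cmod w0 ^ m * Cmod (a m) <= M)%R).
    { induction n as [|n [M [HM H]]].
      - exists 1%R; split; [lra|]; intros m Hm; lia.
      - exists (M + Cmod w0 ^ n * Cmod (a n))%R.
        assert (0 <= Cmod w0 ^ n * Cmod (a n))%R.
        { apply Rmult_le_pos; [apply pow_le; lra | apply Cmod_ge_0]. }
        split; [lra|]; intros m Hm; destruct (Nat.eq_dec m n) as [->|Hne]; [lra|].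
        specialize (H m ltac:(lia)); lra. }
    destruct (Hfin (S n0)) as [M [HM H]].
    exists (M + 1)%R; split; [lra|]; intros n.
    destruct (Nat.lt_ge_cases n (S n0)) as [Hn|Hn]; [specialize (H n Hn); lra|].
    destruct n as [|n]; [lia|].
    assert (A1 := Hn0 n ltac:(lia)); assert (A2 := Hn0 (S n) ltac:(lia)).
    rewrite sum_Sn in A2; rewrite <- Hterm.
    set (A := sum_n (fun k => scal (pow_n w0 k) (a k)) n) in *.
    set (B := scal (pow_n w0 (S n)) (a (S n))) in *.
    change (Cmod (A + B - s0) < / 2)%R in A2; change (Cmod (A - s0) < / 2)%R in A1.
    pose proof (Cmod_minus_le (A + B - s0) (A - s0)) as T.
    assert (EB : forall u v : C, u + v - s0 - (u - s0) = v) by (intros; ring).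
    rewrite (EB A B) in T; lra. }
  destruct Hbd as [M [HM HMb]].
  assert (Hpart : forall w n, (Cmod w <= Cmod w0 / 2)%R ->
    (Cmod (sum_n (fun k => scal (pow_n w k) (a k)) n - a 0%nat) <=
     2 * M * (Cmod w / Cmod w0) * (1 - (/ 2) ^ n))%R).
  { intros w n Hw; set (x := (Cmod w / Cmod w0)%R).
    assert (Hx : (0 <= x <= / 2)%R).
    { unfold x; split; [apply Rdiv_le_0_compat; [apply Cmod_ge_0 | auto]|].
      apply Rle_div_l; lra. }
    induction n as [|n IH].
    - rewrite sum_O.
      replace (scal (pow_n w 0) (a 0%nat) - a 0%nat) with (RtoC 0).
      + rewrite Cmod_0; simpl; lra.
      + change (RtoC 0 = 1 * a 0%nat - a 0%nat); ring.
    - rewrite sum_Sn.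
      set (A := sum_n (fun k => scal (pow_n w k) (a k)) n) in *.
      set (B := scal (pow_n w (S n)) (a (S n))).
      assert (EB : forall u v : C, u + v - a 0%nat = (u - a 0%nat) + v) by (intros; ring).
      match goal with |- (Cmod _ <= ?m)%R => change (Cmod (A + B - a 0%nat) <= m)%R end.
      rewrite (EB A B).
      eapply Rle_trans; [apply Cmod_triangle|].
      assert (HB : (Cmod B <= M * x * (/ 2) ^ n)%R).
      { unfold B; rewrite Hterm.
        replace (Cmod w ^ S n)%R with (x ^ S n * Cmod w0 ^ S n)%R.
        - rewrite Rmult_assoc.
          replace (M * x * (/ 2) ^ n)%R with (x * (/ 2) ^ n * M)%R by ring.
          apply Rmult_le_compat; auto.
          + apply pow_le; lra.
          + apply Rmult_le_pos; [apply pow_le; lra | apply Cmod_ge_0].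
          + simpl; apply Rmult_le_compat_l; [lra|]; apply pow_incr; lra.
        - rewrite <- Rpow_mult_distr; f_equal; unfold x; field; lra. }
      simpl pow; simpl in IH; lra. }
  exists (Rmin (Cmod w0 / 2) (e * Cmod w0 / (4 * M))); split.
  { apply Rmin_pos; [lra|]; apply Rdiv_lt_0_compat; [nra | lra]. }
  intros w s Hw Hs.
  assert (Hw1 : (Cmod w < Cmod w0 / 2)%R) by (eapply Rlt_le_trans; [apply Hw | apply Rmin_l]).
  assert (Hw2 : (Cmod w < e * Cmod w0 / (4 * M))%R)
    by (eapply Rlt_le_trans; [apply Hw | apply Rmin_r]).
  destruct (Hs (fun y => (Cmod (y - s) < e / 2)%R)) as [n Hn].
  { apply locally_Cmod; exists (e / 2)%R; split; [lra | auto]. }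
  specialize (Hn n (le_n n)); specialize (Hpart w n ltac:(lra)).
  set (A := sum_n (fun k => scal (pow_n w k) (a k)) n) in *.
  assert (Hx : (2 * M * (Cmod w / Cmod w0) <= e / 2)%R).
  { apply Rlt_div_r in Hw2; [|lra].
    replace (2 * M * (Cmod w / Cmod w0))%R with (2 * M * Cmod w / Cmod w0)%R by (field; lra).
    apply Rle_div_l; lra. }
  assert (H2 : (0 <= (/ 2) ^ n)%R) by (apply pow_le; lra).
  assert (H3 : (0 <= 2 * M * (Cmod w / Cmod w0))%R).
  { apply Rmult_le_pos; [lra|]; apply Rdiv_le_0_compat; [apply Cmod_ge_0 | auto]. }
  pose proof (Cmod_tri3 s A (a 0%nat)) as T; rewrite (Cmod_minus_sym s A) in T.
  change (Cmod (A - s) < e / 2)%R in Hn.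
  nra.
Qed.

Lemma Some_eq (u v : C) : Some u = Some v -> u = v.
Proof. congruence. Qed.

(** Uniqueness of the two coefficients that an expansion up to a vanishing
    error determines. *)
Lemma laurent_coefficients (f : C -> Csphere) (z0 : C) (r : R) (a : Z -> C)
    (A B : C) (phi : C -> C) (r' : R) :
  (0 < r)%R -> (0 < r')%R -> laurent_expansion f z0 r a ->
  continuous phi z0 -> phi z0 = 0 ->
  (forall z, (0 < Cmod (z - z0) < r')%R -> f z = Some (A / (z - z0) + B + phi z)) ->
  a (-1)%Z = A /\ a 0%Z = B.
Proof.
  intros Hr Hr' Ha Hphi Hphi0 Hf.
  assert (Hpt : forall d, (0 < d)%R -> Cmod (z0 + RtoC d - z0) = d).
  { intros d Hd; replace (z0 + RtoC d - z0) with (RtoC d) by ring.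
    rewrite Cmod_R, Rabs_pos_eq; lra. }
  destruct (Ha (z0 + RtoC (r / 2))) as [s0 [Hs0 _]]; [rewrite Hpt; lra|].
  assert (Hw0 : z0 + RtoC (r / 2) - z0 <> 0) by (apply Cmod_gt_0; rewrite Hpt; lra).
  assert (Hlim := pseries_at_center _ _ _ Hw0 Hs0).
  rewrite continuous_Cmod in Hphi; rewrite Hphi0 in Hphi.
  (* [s - B - phi] equals [(A - a_{-1}) / (z - z0)] and tends to [a_0 - B] *)
  assert (Hkey : forall e, (0 < e)%R -> exists d, (0 < d)%R /\
    forall z, (0 < Cmod (z - z0) < d)%R ->
      (Cmod ((A - a (-1)%Z) / (z - z0) - (a 0%Z - B)) <= e)%R).
  { intros e He.
    destruct (Hlim (e / 2)%R) as [d1 [Hd1 H1]]; [lra|].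
    destruct (Hphi (e / 2)%R) as [d2 [Hd2 H2]]; [lra|].
    set (d := Rmin (Rmin d1 d2) (Rmin r r')).
    exists d; split; [repeat apply Rmin_pos; auto|]; intros z Hz.
    assert (E1 : (d <= Rmin d1 d2)%R) by apply Rmin_l.
    assert (E2 : (d <= Rmin r r')%R) by apply Rmin_r.
    pose proof (Rmin_l d1 d2); pose proof (Rmin_r d1 d2).
    pose proof (Rmin_l r r'); pose proof (Rmin_r r r').
    destruct (Ha z) as [s [Hs Es]]; [lra|].
    rewrite Hf in Es by lra; apply Some_eq in Es.
    assert (Hz0 : z - z0 <> 0) by (apply Cmod_gt_0; lra).
    specialize (H1 (z - z0) s ltac:(lra) Hs); simpl in H1.
    specialize (H2 z ltac:(lra)); replace (phi z - 0) with (phi z) in H2 by ring.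
    replace ((A - a (-1)%Z) / (z - z0) - (a 0%Z - B)) with ((s - a 0%Z) - phi z).
    - eapply Rle_trans; [apply Cmod_minus_le|]; lra.
    - assert (Es' : s = A / (z - z0) + B + phi z - a (-1)%Z / (z - z0))
        by (replace s with (a (-1)%Z / (z - z0) + s - a (-1)%Z / (z - z0)) by ring;
            rewrite <- Es; ring).
      rewrite Es'; field; auto. }
  assert (HA : a (-1)%Z = A).
  { apply NNPP; intros Hne.
    assert (Hm : (0 < Cmod (A - a (-1)%Z))%R) by (apply Cmod_gt_0, Cminus_neq_0; auto).
    destruct (Hkey 1%R) as [d [Hd H]]; [lra|].
    set (m := Cmod (A - a (-1)%Z)) in *.
    assert (Hq : (0 < Cmod (a 0%Z - B) + 2)%R) by (pose proof (Cmod_ge_0 (a 0%Z - B)); lra).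
    set (x := Rmin (d / 2) (m / (Cmod (a 0%Z - B) + 2))).
    assert (Hx : (0 < x)%R) by (apply Rmin_pos; [lra | now apply Rdiv_lt_0_compat]).
    assert (Hx1 : (x <= d / 2)%R) by apply Rmin_l.
    assert (Hx2 : (x <= m / (Cmod (a 0%Z - B) + 2))%R) by apply Rmin_r.
    specialize (H (z0 + RtoC x)); rewrite Hpt in H by auto; specialize (H ltac:(lra)).
    assert (Hxz : z0 + RtoC x - z0 <> 0) by (apply Cmod_gt_0; rewrite Hpt; auto).
    pose proof (Cmod_tri_inv ((A - a (-1)%Z) / (z0 + RtoC x - z0)) (a 0%Z - B)) as T.
    rewrite Cmod_div, Hpt in T by auto; fold m in T.
    assert (Hbig : (Cmod (a 0%Z - B) + 2 <= m / x)%R).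
    { apply Rle_div_r; auto; rewrite Rmult_comm; apply Rle_div_r; auto. }
    lra. }
  split; auto.
  assert (HB : (Cmod (a 0%Z - B) = 0)%R).
  { apply Rle_antisym; [|apply Cmod_ge_0].
    apply le_epsilon; intros e He; rewrite Rplus_0_l.
    destruct (Hkey e He) as [d [Hd H]].
    specialize (H (z0 + RtoC (d / 2))); rewrite Hpt in H by lra; specialize (H ltac:(lra)).
    rewrite HA in H; replace ((A - A) / (z0 + RtoC (d / 2) - z0) - (a 0%Z - B))
      with (- (a 0%Z - B)) in H by (unfold Cdiv; ring).
    rewrite Cmod_opp in H; auto. }
  apply Cmod_eq_0 in HB; replace (a 0%Z) with (a 0%Z - B + B) by ring; rewrite HB; ring.
Qed.

(** * Moving the pole to the origin *)

Definition finite_value (w : Csphere) : C :=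
  match w with Some v => v | None => 0 end.

Lemma Cconj_RtoC (x : R) : Cconj (RtoC x) = RtoC x.
Proof. apply C_eq; simpl; ring. Qed.

Section MovePole.

Variables (p : R) (f : C -> Csphere).
Hypothesis Hp : (0 < p < 1)%R.
Hypothesis Hf : Co p f.

Lemma Cmod_pole : Cmod p = p.
Proof. rewrite Cmod_R, Rabs_pos_eq; lra. Qed.

Lemma pole_neq_0 : RtoC p <> 0.
Proof. intros E; apply RtoC_inj in E; lra. Qed.

Lemma one_sub_pole_sqr_neq_0 : 1 - p * p <> 0.
Proof.
  replace (1 - p * p) with (RtoC (1 - p * p)) by (rewrite RtoC_minus, RtoC_mult; ring).
  intros E; apply RtoC_inj in E; nra.
Qed.

(** Another pole would be a second point with the value infinity. *)
Lemma value_off_pole (z : C) :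
  (Cmod z < 1)%R -> z <> p ->
  f z = Some (finite_value (f z)) /\ ex_derive (fun y => finite_value (f y)) z.
Proof.
  intros Hz Hzp; destruct (Co_meromorphic p f Hf z Hz) as [[g Hg]|[m [_ [Hnone _]]]].
  - apply locally_Cmod in Hg; destruct Hg as [d [Hd Hg]].
    assert (Hzz : (Cmod (z - z) < d)%R).
    { replace (z - z) with (RtoC 0) by ring; now rewrite Cmod_0. }
    split.
    + rewrite (proj1 (Hg z Hzz)); reflexivity.
    + apply (ex_derive_C_ext_loc g _ z d Hd); [|apply Hg, Hzz].
      intros y Hy; rewrite (proj1 (Hg y Hy)); reflexivity.
  - exfalso; apply Hzp, (Co_injective p f Hf); auto.
    + unfold unit_disc; rewrite Cmod_pole; lra.
    + destruct (Co_pole p f Hf) as [_ [E _]]; rewrite Hnone, E; reflexivity.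
Qed.

(** The disc automorphism that takes [0] to [p] and [-p] to [0], and its inverse. *)
Let chart (x : C) : C := (x + p) / (1 + p * x).
Let chart_inv (z : C) : C := (z - p) / (1 - p * z).

Lemma chart_moebius (x : C) : chart x = moebius p x.
Proof. unfold chart, moebius; rewrite Cconj_RtoC; reflexivity. Qed.

Lemma chart_inv_moebius (z : C) : chart_inv z = moebius (- p) z.
Proof.
  unfold chart_inv, moebius; replace (- RtoC p) with (RtoC (- p)) by apply RtoC_opp.
  rewrite Cconj_RtoC, RtoC_opp.
  replace (1 + - p * z) with (1 - p * z) by ring; reflexivity.
Qed.

Lemma chart_denominator (x : C) : (Cmod x < 1)%R -> 1 + p * x <> 0.
Proof.
  intros Hx; rewrite <- (Cconj_RtoC p); apply moebius_denominator; [rewrite Cmod_pole|]; lra.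
Qed.

Lemma chart_inv_denominator (z : C) : (Cmod z < 1)%R -> 1 - p * z <> 0.
Proof.
  intros Hz; replace (1 - p * z) with (1 + p * (- z)) by ring.
  apply chart_denominator; now rewrite Cmod_opp.
Qed.

Lemma chart_disc (x : C) : (Cmod x < 1)%R -> (Cmod (chart x) < 1)%R.
Proof. intros Hx; rewrite chart_moebius; apply Cmod_moebius; try rewrite Cmod_pole; lra. Qed.

Lemma chart_inv_disc (z : C) : (Cmod z < 1)%R -> (Cmod (chart_inv z) < 1)%R.
Proof. intros Hz; rewrite chart_inv_moebius; apply Cmod_moebius; try rewrite Cmod_opp, Cmod_pole; lra. Qed.

Lemma chart_chart_inv (z : C) : (Cmod z < 1)%R -> chart (chart_inv z) = z.
Proof.
  intros Hz; rewrite chart_moebius, chart_inv_moebius; apply moebius_inverse; try rewrite Cmod_pole; lra.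
Qed.

Lemma chart_inv_chart (x : C) : (Cmod x < 1)%R -> chart_inv (chart x) = x.
Proof.
  intros Hx; rewrite chart_moebius, chart_inv_moebius.
  replace (moebius p x) with (moebius (- - p) x) by (f_equal; ring).
  apply moebius_inverse; try rewrite Cmod_opp, Cmod_pole; lra.
Qed.

Lemma chart_0 : chart 0 = p.
Proof. rewrite chart_moebius; apply moebius_center. Qed.

Lemma chart_eq_p (x : C) : (Cmod x < 1)%R -> chart x = p -> x = 0.
Proof.
  intros Hx E; rewrite <- (chart_inv_chart x Hx), E; unfold chart_inv, Cdiv; ring.
Qed.

Lemma chart_inv_eq_0 (z : C) : (Cmod z < 1)%R -> chart_inv z = 0 -> z = p.
Proof. intros Hz E; rewrite <- (chart_chart_inv z Hz), E; apply chart_0. Qed.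

Lemma chart_derive (x : C) : (Cmod x < 1)%R -> ex_derive chart x.
Proof. intros Hx; unfold chart; cderive; now apply chart_denominator. Qed.

(** Multiplication by [x] cancels the pole; the value at [0] is the limit. *)
Lemma moved_pole_exists :
  exists g : C -> C,
    (forall x, (Cmod x < 1)%R -> ex_derive g x) /\ g 0 <> 0 /\
    (forall x : C, x <> 0 -> g x = x * finite_value (f (chart x))).
Proof.
  destruct (Co_pole p f Hf) as [_ [_ [u [Hu Hloc]]]].
  apply locally_Cmod in Hloc; destruct Hloc as [d [Hd Hloc]].
  assert (Hq := one_sub_pole_sqr_neq_0).
  (* [x / (z - p) = (1 + p x) / (1 - p^2)] for [z = chart x] *)
  set (c := u p / (1 - p * p)).
  set (g := fun x => if Ceq_dec x 0 then c else x * finite_value (f (chart x))).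
  assert (Hg : forall x : C, x <> 0 -> g x = x * finite_value (f (chart x))).
  { intros x Hx; unfold g; destruct (Ceq_dec x 0); [contradiction | reflexivity]. }
  assert (Hgc : g 0 = c).
  { unfold g; destruct (Ceq_dec 0 0) as [_|n]; [reflexivity | now contradiction n]. }
  exists g; split; [|split]; auto.
  - intros x Hx; destruct (Ceq_dec x 0) as [->|Hx0].
    + assert (CT : continuous chart (RtoC 0)) by (apply ex_derive_Ccontinuous, chart_derive, Hx).
      rewrite continuous_Cmod, chart_0 in CT; destruct (CT d Hd) as [e [He HTe]].
      apply (ex_derive_C_ext_loc (fun x => u (chart x) * (1 + p * x) / (1 - p * p)) g 0 (Rmin e 1)).
      * apply Rmin_pos; lra.
      * intros y Hy.
        assert (Hye : (Cmod (y - 0) < e)%R) by (eapply Rlt_le_trans; [apply Hy | apply Rmin_l]).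
        assert (Hy1 : (Cmod (y - 0) < 1)%R) by (eapply Rlt_le_trans; [apply Hy | apply Rmin_r]).
        replace (y - 0) with y in Hy1 by ring.
        assert (Hdn := chart_denominator y Hy1).
        destruct (Ceq_dec y 0) as [->|Hy0].
        { rewrite Hgc, chart_0; unfold c; field; auto. }
        assert (HTy : chart y <> p) by (intros E; apply Hy0, chart_eq_p; auto).
        rewrite (Hg y Hy0), (proj2 (Hloc (chart y) (HTe y Hye)) HTy); simpl.
        assert (HTp : chart y - p = y * (1 - p * p) / (1 + p * y)) by (unfold chart; field; auto).
        rewrite Cmult_1_r, HTp; field; repeat split; auto.
      * cderive; auto; apply ex_derive_Ccomp; [|now apply chart_derive].
        rewrite chart_0; apply Hloc.
        replace (RtoC p - p) with (RtoC 0) by ring; rewrite Cmod_0; auto.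
    + apply (ex_derive_C_ext_loc (fun x => x * finite_value (f (chart x))) g x (Cmod x)).
      * now apply Cmod_gt_0.
      * intros y Hy; symmetry; apply Hg; intros ->.
        replace (0 - x) with (- x) in Hy by ring; rewrite Cmod_opp in Hy; lra.
      * apply ex_derive_Cmult; [apply ex_derive_Cid|].
        apply (ex_derive_Ccomp (fun z => finite_value (f z)) chart); [|now apply chart_derive].
        apply value_off_pole; [now apply chart_disc|].
        intros E; apply Hx0, chart_eq_p; auto.
  - rewrite Hgc; unfold c, Cdiv; apply Cmult_neq_0; auto.
    now apply Cinv_neq_0.
Qed.

(** In the moved coordinate [f] is concave with pole at [0]; the last two
    identities express [f 0 = 0] and [f' 0 = 1]. *)
Lemma moved_expansion :
  exists (c b : C) (k : C -> C),
    (forall x, (Cmod x < 1)%R -> ex_derive k x) /\ k 0 = 0 /\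
    (forall x, (Cmod x < 1)%R -> (Cmod (C_derive k x) <= Cmod c)%R) /\
    (forall z, (Cmod z < 1)%R -> z <> p -> f z = Some (c / chart_inv z + b + k (chart_inv z))) /\
    c - b * p - p * k (- p) = 0 /\
    c - p * p * C_derive k (- p) = - (p * p / (1 - p * p)).
Proof.
  destruct moved_pole_exists as [g [Hg [Hg0 Hgf]]].
  assert (Hfin : forall x : C, (Cmod x < 1)%R -> x <> 0 -> f (chart x) = Some (g x / x)).
  { intros x Hx Hx0.
    assert (HTp : chart x <> p) by (intros E; apply Hx0, chart_eq_p; auto).
    rewrite (proj1 (value_off_pole (chart x) (chart_disc x Hx) HTp)), (Hgf x Hx0).
    f_equal; field; auto. }
  assert (Hinj : forall z x, (Cmod z < 1)%R -> (Cmod x < 1)%R -> z <> x -> x * g z <> z * g x).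
  { intros z x Hz Hx Hzx E.
    destruct (Ceq_dec z 0) as [->|Hz0].
    { rewrite Cmult_0_l in E; revert E; apply Cmult_neq_0; auto. }
    destruct (Ceq_dec x 0) as [->|Hx0].
    { rewrite Cmult_0_l in E; symmetry in E; revert E; apply Cmult_neq_0; auto. }
    apply Hzx; rewrite <- (chart_inv_chart z Hz), <- (chart_inv_chart x Hx); f_equal.
    apply (Co_injective p f Hf); try apply chart_disc; auto.
    rewrite !Hfin by auto; f_equal.
    replace (g z / z) with (x * g z / (z * x)) by (field; auto).
    rewrite E; field; auto. }
  assert (HK : forall w, (forall z, (Cmod z < 1)%R -> g z - w * z <> 0) <->
    complement (image unit_disc f) (Some w)).
  { intros w; split.
    - intros Hw [z [Hz E]]; unfold unit_disc in Hz.
      assert (Hzp : z <> p).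
      { intros ->; destruct (Co_pole p f Hf) as [_ [E2 _]]; congruence. }
      assert (Hx0 : chart_inv z <> 0) by (intros E2; apply Hzp, chart_inv_eq_0; auto).
      assert (Hx := chart_inv_disc z Hz).
      rewrite <- (chart_chart_inv z Hz), Hfin in E by auto; apply Some_eq in E.
      apply (Hw (chart_inv z) Hx); rewrite <- E; field; auto.
    - intros Hw z Hz E; apply Hw; exists (chart z); split; [now apply chart_disc|].
      destruct (Ceq_dec z 0) as [->|Hz0].
      { exfalso; apply Hg0; replace (g 0) with (g 0 - w * 0) by ring; auto. }
      rewrite Hfin by auto; f_equal.
      replace (g z) with (g z - w * z + w * z) by ring; rewrite E; field; auto. }
  destruct (regular_part_derive_le g Hg Hg0 Hinj) as [b [k [Hk [Hk0 [Eg Hk']]]]].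
  { intros u v t Ht Hu Hv; apply HK.
    apply (proj2 (Co_convex p f Hf)); auto; now apply HK. }
  assert (Hmp : (Cmod (- p) < 1)%R) by (rewrite Cmod_opp, Cmod_pole; lra).
  assert (Hp0 := pole_neq_0); assert (Hq := one_sub_pole_sqr_neq_0).
  assert (Hmp0 : - RtoC p <> 0).
  { intros E; apply Hp0; replace (RtoC p) with (- - RtoC p) by ring; rewrite E; ring. }
  assert (T0 : chart (- p) = 0).
  { unfold chart, Cdiv; replace (- p + p) with (RtoC 0) by ring; ring. }
  assert (gp : g (- p) = 0).
  { rewrite (Hgf _ Hmp0), T0, (Co_zero p f Hf); simpl; ring. }
  assert (E1 : g 0 - b * p - p * k (- p) = 0).
  { rewrite (Eg (- p)) in gp.
    replace (g 0 - b * p - p * k (- p)) with (g 0 + b * - p + k (- p) * - p) by ring.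
    exact gp. }
  exists (g 0), b, k; repeat split; auto.
  - intros z Hz Hzp.
    assert (Hx0 : chart_inv z <> 0) by (intros E2; apply Hzp, chart_inv_eq_0; auto).
    rewrite <- (chart_chart_inv z Hz) at 1; rewrite Hfin by (auto; now apply chart_inv_disc).
    f_equal; rewrite (Eg (chart_inv z)); field; auto.
  - assert (Dg : C_derive g (- p) = b + (C_derive k (- p) * - p + k (- p))).
    { apply is_C_derive_unique.
      replace (b + (C_derive k (- p) * - p + k (- p)))
        with (0 + (0 * - p + b * 1) + (C_derive k (- p) * - p + k (- p) * 1)) by ring.
      apply (is_derive_C_ext_loc (fun z => g 0 + b * z + k z * z) g (- p) _ 1); [lra| |].
      - intros y _; auto.
      - apply (is_derive_Cplus (fun z => g 0 + b * z) (fun z => k z * z)).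
        + apply (is_derive_Cplus (fun _ => g 0) (fun z => b * z)); [apply is_derive_Cconst|].
          apply (is_derive_Cmult (fun _ => b) (fun z => z));
            [apply is_derive_Cconst | apply is_derive_Cid].
        + apply (is_derive_Cmult k (fun z => z));
            [apply is_derive_C_derive; auto | apply is_derive_Cid]. }
    assert (Dg2 : C_derive g (- p) = - (p / (1 - p * p))).
    { apply is_C_derive_unique.
      destruct (Co_derive p f Hf) as [v [Hv Dv]].
      apply locally_Cmod in Hv; destruct Hv as [d [Hd Hv]].
      assert (CT : continuous chart (- p)) by (apply ex_derive_Ccontinuous, chart_derive; auto).
      rewrite continuous_Cmod, T0 in CT; destruct (CT d Hd) as [e [He HTe]].
      assert (DT : is_derive chart (- p) (/ (1 - p * p))).
      { assert (Hdn := chart_denominator (- p) Hmp).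
        replace (/ (1 - p * p)) with ((1 + 0) * / (1 + p * - p)
          + (- p + p) * (- (0 + (0 * - p + p * 1)) / ((1 + p * - p) * (1 + p * - p)))).
        2: { replace (1 + p * - p) with (1 - p * p) by ring; field; auto. }
        apply (is_derive_Cmult (fun x => x + p) (fun x => / (1 + p * x))).
        - apply (is_derive_Cplus (fun x => x) (fun _ => RtoC p));
            [apply is_derive_Cid | apply is_derive_Cconst].
        - apply (is_derive_Cinv (fun x => 1 + p * x)); auto.
          apply (is_derive_Cplus (fun _ => RtoC 1) (fun x => p * x)); [apply is_derive_Cconst|].
          apply (is_derive_Cmult (fun _ => RtoC p) (fun x => x));
            [apply is_derive_Cconst | apply is_derive_Cid]. }
      replace (- (p / (1 - p * p))) with (1 * v (chart (- p)) + - p * (1 * / (1 - p * p))).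
      2: { rewrite T0.
           assert (Hv0 := Hv 0 ltac:(replace (0 - 0) with (RtoC 0) by ring;
             rewrite Cmod_0; auto)).
           rewrite (Co_zero p f Hf) in Hv0; apply Some_eq in Hv0; rewrite <- Hv0; field; auto. }
      apply (is_derive_C_ext_loc (fun x => x * v (chart x)) g (- p) _ (Rmin e p)).
      - apply Rmin_pos; lra.
      - intros y Hy.
        assert (Hye : (Cmod (y - - p) < e)%R) by (eapply Rlt_le_trans; [apply Hy | apply Rmin_l]).
        assert (Hyp : (Cmod (y - - p) < p)%R) by (eapply Rlt_le_trans; [apply Hy | apply Rmin_r]).
        assert (Hy0 : y <> 0).
        { intros ->; replace (0 - - p) with (RtoC p) in Hyp by ring; rewrite Cmod_pole in Hyp; lra. }
        rewrite (Hgf y Hy0), (Hv (chart y) (HTe y Hye)); reflexivity.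
      - apply (is_derive_Cmult (fun x => x) (fun x => v (chart x))); [apply is_derive_Cid|].
        apply (is_derive_Ccomp v chart); auto; rewrite T0; exact Dv. }
    rewrite Dg in Dg2.
    (* eliminate [b] between the equations for the value and the derivative *)
    replace (g 0 - p * p * C_derive k (- p)) with
      ((g 0 - b * p - p * k (- p)) + p * (b + (C_derive k (- p) * - p + k (- p)))) by ring.
    rewrite E1, Dg2; field; auto.
Qed.

(** [c / chart_inv z = c (1 - p^2) / (z - p) - c p]. *)
Lemma laurent_of_expansion (a : Z -> C) (c b : C) (k : C -> C) :
  laurent_expansion f p (1 - p) a ->
  (forall x, (Cmod x < 1)%R -> ex_derive k x) -> k 0 = 0 ->
  (forall z, (Cmod z < 1)%R -> z <> p -> f z = Some (c / chart_inv z + b + k (chart_inv z))) ->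
  a 0%Z = b - c * p.
Proof.
  intros Ha Hk Hk0 Ef.
  assert (Hchart_p : chart_inv p = 0) by (unfold chart_inv, Cdiv; ring).
  assert (Hpd : (Cmod p < 1)%R) by (rewrite Cmod_pole; lra).
  apply (laurent_coefficients f p (1 - p) a (c * (1 - p * p)) (b - c * p)
    (fun z => k (chart_inv z)) (1 - p)); auto; try lra.
  - apply (continuous_comp chart_inv k).
    + apply ex_derive_Ccontinuous; unfold chart_inv; cderive; now apply chart_inv_denominator.
    + rewrite Hchart_p; apply ex_derive_Ccontinuous, Hk; rewrite Cmod_0; lra.
  - rewrite Hchart_p; auto.
  - intros z Hz.
    assert (Hzp0 : z - p <> 0) by (apply Cmod_gt_0; lra).
    assert (Hz1 : (Cmod z < 1)%R).
    { apply (disc_neighbourhood p); rewrite Cmod_pole; lra. }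
    rewrite Ef; auto.
    + f_equal; f_equal; unfold chart_inv; field; split; auto; now apply chart_inv_denominator.
    + intros ->; apply Hzp0; ring.
Qed.

(** The equation reads [c = p^2 d - p^2 / (1 - p^2)]; if [|c|] is as large as
    [|d| <= |c|] allows, the two terms on the right are parallel. *)
Lemma residue_le (c d : C) :
  (Cmod d <= Cmod c)%R -> c - p * p * d = - (p * p / (1 - p * p)) ->
  (Cmod c <= p * p / (1 - p * p) / (1 - p * p))%R /\
  ((p * p / (1 - p * p) / (1 - p * p) <= Cmod c)%R ->
   c = d /\ c = - RtoC (p * p / (1 - p * p) / (1 - p * p))).
Proof.
  intros Hd E.
  set (q := (p * p / (1 - p * p))%R).
  assert (H1 : (0 < 1 - p * p)%R) by nra.
  assert (Hq : (0 < q)%R) by (apply Rdiv_lt_0_compat; nra).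
  assert (Eq : p * p / (1 - p * p) = RtoC q).
  { unfold q; rewrite RtoC_div, RtoC_minus, RtoC_mult by lra; reflexivity. }
  rewrite Eq in E.
  assert (E2 : c + RtoC q = RtoC (p * p) * d).
  { rewrite RtoC_mult; replace (p * p * d) with (c - (c - p * p * d)) by ring; rewrite E; ring. }
  assert (Hm : Cmod (c + RtoC q) = (p * p * Cmod d)%R).
  { rewrite E2, Cmod_mult, Cmod_R, Rabs_pos_eq; nra. }
  assert (Hle : (Cmod (c + RtoC q) <= p * p * Cmod c)%R) by (rewrite Hm; nra).
  assert (Hge : (Cmod c - q <= Cmod (c + RtoC q))%R).
  { pose proof (Cmod_tri_inv c (- RtoC q)) as T1.
    rewrite Cmod_opp, Cmod_R, Rabs_pos_eq in T1 by lra.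
    replace (c - - RtoC q) with (c + RtoC q) in T1 by ring; auto. }
  assert (Hc : (Cmod c <= q / (1 - p * p))%R) by (apply Rle_div_r; nra).
  split; auto; intros Hc2.
  assert (Ec : Cmod c = (q / (1 - p * p))%R) by (apply Rle_antisym; auto).
  assert (Ecq : (Cmod c * (1 - p * p) = q)%R) by (rewrite Ec; field; lra).
  assert (Hcm : (0 < Cmod c)%R) by (rewrite Ec; apply Rdiv_lt_0_compat; auto).
  (* [|c + q| <= |c| - q] forces [c = - |c|] *)
  assert (Hre : c = - RtoC (Cmod c)).
  { assert (S1 := Cmod_sqr (c + RtoC q)); assert (S2 := Cmod_sqr c).
    rewrite Re_plus, Im_plus in S1; simpl in S1.
    assert (Hsq : (Cmod (c + RtoC q) * Cmod (c + RtoC q) <= (Cmod c - q) * (Cmod c - q))%R).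
    { pose proof (Cmod_ge_0 (c + RtoC q)); nra. }
    fold (Re c) (Im c) in S1.
    assert (Hre : (Re c <= - Cmod c)%R) by nra.
    assert (Hre2 : (Re c = - Cmod c)%R).
    { pose proof (re_le_Cmod c) as A; apply Rabs_le_between in A; lra. }
    apply C_eq; simpl; [exact Hre2|].
    rewrite Hre2 in S2; fold (Im c); nra. }
  split; [|rewrite Hre, Ec; reflexivity].
  assert (Hpp : RtoC (p * p) <> 0) by (intros E0; apply RtoC_inj in E0; nra).
  replace d with (/ RtoC (p * p) * (RtoC (p * p) * d)) by (field; auto).
  rewrite <- E2.
  replace (RtoC q) with (RtoC (Cmod c) * (1 - RtoC (p * p))).
  - rewrite Hre at 2; rewrite Hre at 1; field; auto.
  - rewrite <- Ecq, (RtoC_mult (Cmod c)), RtoC_minus; reflexivity.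
Qed.

End MovePole.

(** * The sharp bound *)

Lemma derive_const_linear (k : C -> C) (c : C) :
  (forall x, (Cmod x < 1)%R -> ex_derive k x) -> k 0 = 0 ->
  (forall x, (Cmod x < 1)%R -> C_derive k x = c) ->
  forall x, (Cmod x < 1)%R -> k x = c * x.
Proof.
  intros Hk Hk0 Hc x Hx.
  assert (Hseg : forall t, (0 <= t <= 1)%R -> (Cmod (0 + RtoC t * x) < 1)%R).
  { intros t Ht; rewrite Cplus_0_l, Cmod_mult, Cmod_R, Rabs_pos_eq by lra.
    pose proof (Cmod_ge_0 x); nra. }
  assert (H := segment_increment_le (fun x => k x - c * x) (fun _ => 0) 0 x 0).
  assert (E : k x - c * x = 0).
  { apply Cmod_eq_0, Rle_antisym; [|apply Cmod_ge_0].
    rewrite Cplus_0_l, Hk0 in H.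
    replace (k x - c * x - (0 - c * 0)) with (k x - c * x) in H by ring.
    rewrite Rmult_0_l in H; apply H.
    - intros t Ht; set (y := 0 + RtoC t * x).
      replace (RtoC 0) with (C_derive k y - (0 * y + c * 1))
        by (rewrite Hc by (now apply Hseg); ring).
      apply (is_derive_Cminus k (fun x => c * x)).
      + now apply is_derive_C_derive, Hk, Hseg.
      + apply (is_derive_Cmult (fun _ => c) (fun x => x));
          [apply is_derive_Cconst | apply is_derive_Cid].
    - intros t _; rewrite Cmod_0; lra. }
  replace (k x) with (k x - c * x + c * x) by ring; rewrite E; ring.
Qed.

(** The first summand is the principal part at [p] and the second one is regular
    there. *)
Lemma sphere_div_extremal (p : R) (z : C) :
  (0 < p < 1)%R -> (Cmod z < 1)%R -> z <> p ->
  sphere_div z ((1 - z / p) * (1 - z * p)) =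
  Some (- (p * p / (1 - p * p)) / (z - p) + - (p / ((1 - p * p) * (1 - p * z)))).
Proof.
  intros Hp Hz Hzp; unfold sphere_div.
  assert (Hp0 := pole_neq_0 p Hp); assert (Hq := one_sub_pole_sqr_neq_0 p Hp).
  assert (Hd := chart_inv_denominator p Hp z Hz); assert (Hzp0 := Cminus_neq_0 z p Hzp).
  assert (H1 : 1 - z / p <> 0).
  { intros E; apply Hzp0; replace (z - p) with (- p * (1 - z / p)) by (field; auto).
    rewrite E; ring. }
  assert (H2 : 1 - z * p <> 0) by (replace (1 - z * p) with (1 - p * z) by ring; auto).
  destruct (Ceq_dec ((1 - z / p) * (1 - z * p)) 0) as [E|_].
  { exfalso; revert E; apply Cmult_neq_0; auto. }
  assert (H3 : RtoC p - z <> 0).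
  { intros E; apply Hzp0; replace (z - p) with (- (p - z)) by ring; rewrite E; ring. }
  f_equal; field; repeat split; auto.
Qed.

Theorem theorem1 (p : R) (Hp : (0 < p < 1)%R) (f : C -> Csphere) (a : Z -> C)
    (Hf : Co p f) (Ha : laurent_expansion f (RtoC p) (1 - p)%R a) :
  (Re (a 0%Z) >= - (p / (1 - p ^ 2) ^ 2))%R /\
  (Re (a 0%Z) = (- (p / (1 - p ^ 2) ^ 2))%R <->
   forall z : C, unit_disc z ->
     f z = sphere_div z
             ((RtoC 1 - z / RtoC p) * (RtoC 1 - z * RtoC p))%C).
Proof.
  destruct (moved_expansion p f Hp Hf) as [c [b [k [Hk [Hk0 [Hk' [Ef [E1 E2]]]]]]]].
  assert (Hp0 := pole_neq_0 p Hp); assert (Hq := one_sub_pole_sqr_neq_0 p Hp).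
  assert (Hmp : (Cmod (- p) < 1)%R) by (rewrite Cmod_opp, (Cmod_pole p Hp); lra).
  assert (Hpd : (Cmod p < 1)%R) by (rewrite (Cmod_pole p Hp); lra).
  set (B := (p / (1 - p ^ 2) ^ 2)%R).
  assert (EB : (p * p / (1 - p * p) / (1 - p * p) = B * p)%R) by (unfold B; field; nra).
  destruct (residue_le p Hp c (C_derive k (- p)) (Hk' _ Hmp) E2) as [Hc Hc_eq].
  rewrite EB in Hc, Hc_eq.
  assert (Hkp : (Cmod (k (- p)%C) <= Cmod c * p)%R).
  { assert (H := segment_increment_le k (C_derive k) 0 (- p) (Cmod c)).
    rewrite Cplus_0_l, Hk0, Cmod_opp, (Cmod_pole p Hp) in H.
    replace (k (- p) - 0) with (k (- p)) in H by ring.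
    assert (Hseg : forall t, (0 <= t <= 1)%R -> (Cmod (0 + RtoC t * - p) < 1)%R).
    { intros t Ht; rewrite Cplus_0_l, Cmod_mult, Cmod_R, Rabs_pos_eq, Cmod_opp, (Cmod_pole p Hp)
        by lra; nra. }
    apply H; intros t Ht; [apply is_derive_C_derive|]; auto. }
  assert (Ea := laurent_of_expansion p f Hp a c b k Ha Hk Hk0 Ef).
  assert (Ea' : p * a 0%Z = c * (1 - p * p) - p * k (- p)).
  { rewrite Ea; replace (p * (b - c * p))
      with (c * (1 - p * p) - p * k (- p) - (c - b * p - p * k (- p))) by ring.
    rewrite E1; ring. }
  assert (Hac : (p * Cmod (a 0%Z) <= Cmod c)%R).
  { rewrite <- (Cmod_pole p Hp) at 1; rewrite <- Cmod_mult, Ea'.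
    eapply Rle_trans; [apply Cmod_minus_le|]; rewrite !Cmod_mult, (Cmod_pole p Hp).
    replace (1 - p * p) with (RtoC (1 - p * p)) by (rewrite RtoC_minus, RtoC_mult; ring).
    rewrite Cmod_R, Rabs_pos_eq by nra; nra. }
  assert (Hre := re_le_Cmod (a 0%Z)); apply Rabs_le_between in Hre.
  assert (Hlow : (- B <= Re (a 0%Z))%R) by nra.
  split; [lra|split].
  - intros Heq.
    destruct Hc_eq as [Ecd Ec]; [nra|].
    assert (HB : (0 < B * p)%R) by (rewrite <- EB; repeat apply Rdiv_lt_0_compat; nra).
    assert (Hcm : Cmod c = (B * p)%R) by (rewrite Ec, Cmod_opp, Cmod_R, Rabs_pos_eq; lra).
    assert (Hc0 : c <> 0) by (apply Cmod_gt_0; lra).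
    (* [k' / c] attains the value 1 at [-p] *)
    assert (Hk'c : forall x, (Cmod x < 1)%R -> C_derive k x = c).
    { intros x Hx.
      replace (C_derive k x) with (C_derive k x / c * c) by (field; auto).
      replace (C_derive k x / c) with (RtoC 1); [ring|symmetry].
      apply (strong_maximum (fun x => C_derive k x / c) (- p)); auto.
      - intros y Hy; cderive; auto.
        apply (derive_holomorphic k y (1 - Cmod y)); [lra|].
        intros w Hw; apply Hk, (disc_neighbourhood y), Hw.
      - intros y Hy; eapply Rle_trans; [apply Re_le_Cmod|].
        rewrite Cmod_div by auto; apply Rle_div_l; [lra|]; rewrite Rmult_1_l; auto.
      - rewrite <- Ecd; field; auto. }
    assert (Ek := derive_const_linear k c Hk Hk0 Hk'c).
    assert (Eb : b = c * (1 + p * p) / p).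
    { rewrite Ek in E1 by auto.
      replace b with ((c * (1 + p * p) - (c - b * p - p * (c * - p))) / p) by (field; auto).
      rewrite E1; field; auto. }
    assert (Ec' : c = - (p * p / ((1 - p * p) * (1 - p * p)))).
    { rewrite Ec, <- EB, !RtoC_div, RtoC_minus, !RtoC_mult by nra; field; auto. }
    intros z Hz; unfold unit_disc in Hz.
    destruct (Ceq_dec z p) as [->|Hzp].
    + destruct (Co_pole p f Hf) as [_ [-> _]]; unfold sphere_div.
      destruct (Ceq_dec _ 0) as [_|n]; [reflexivity|].
      exfalso; apply n; field; auto.
    + rewrite (sphere_div_extremal p z Hp Hz Hzp), (Ef z Hz Hzp).
      rewrite Ek by now apply chart_inv_disc.
      assert (Hd := chart_inv_denominator p Hp z Hz); assert (Hzp0 := Cminus_neq_0 z p Hzp).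
      f_equal; rewrite Eb, Ec'; field; repeat split; auto.
  - intros Hext.
    assert (Hcoef : a (-1)%Z = - (p * p / (1 - p * p)) /\
      a 0%Z = - RtoC B).
    { set (phi := fun z : C => RtoC B - p / ((1 - p * p) * (1 - p * z))).
      assert (EBC : RtoC B = p / ((1 - p * p) * (1 - p * p))).
      { replace B with (p / ((1 - p * p) * (1 - p * p)))%R by (unfold B; field; nra).
        assert (H1 : (0 < 1 - p * p)%R) by nra.
        rewrite RtoC_div, RtoC_mult, RtoC_minus, RtoC_mult; [reflexivity|].
        apply Rmult_integral_contrapositive_currified; lra. }
      apply (laurent_coefficients f p (1 - p) a _ _ phi (1 - p)); auto; try lra.
      - apply ex_derive_Ccontinuous; unfold phi; cderive.
        apply Cmult_neq_0; auto.
      - unfold phi; rewrite EBC; ring.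
      - intros z Hz.
        assert (Hz1 : (Cmod z < 1)%R).
        { apply (disc_neighbourhood p); rewrite (Cmod_pole p Hp); lra. }
        assert (Hzp : z <> p).
        { intros ->; replace (RtoC p - p) with (RtoC 0) in Hz by ring; rewrite Cmod_0 in Hz; lra. }
        rewrite (Hext z Hz1), (sphere_div_extremal p z Hp Hz1 Hzp).
        f_equal; unfold phi; ring. }
    rewrite (proj2 Hcoef); reflexivity.
Qed.
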